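(* There is a universal constant $M \geq 1$ such that for every complete CAT$(-1)$ space $X$ and every $b \in \hat{\mathcal{B}}(X)$, the density $\rho_{1,b}(x)=e^{-b(x)}$ is a GH-density with constant $M$. Moreover, for each $K\ge 0$ there are constants $A=A(K)\ge 1$ and $L=L(K)\ge 1$, depending only on $K$, such that if $X$ is a complete CAT$(-1)$ space, $b\in\hat{\mathcal{B}}(X)$ has basepoint $\omega$, and $X$ is $K$-roughly starlike from $\omega$, then: (i) every geodesic in $X$ is an $A$-uniform curve in $X_{1,b}$, consequently $X_{1,b}$ is an $A$-uniform metric space, and $X_{1,b}$ is bounded if and only if $b\in\mathcal{D}(X)$; (ii) the canonical map $\varphi_{1,b}:\partial_\omega X\to\partial X_{1,b}$ is a well-defined bijection, and under this identification the restriction of $d_{1,b}$ to $\partial X_{1,b}$ defines a visual metric on $\partial_\omega X$ based at $\omega$ with parameter $1$ and comparison constant $L$; in particular the restriction of $d_{1,b}$ to $\partial X_{1,b}$ is $L$-biLipschitz to $\theta_{1,b}$, i.e. $L^{-1}\theta_{1,b}(\xi,\zeta)\le d_{1,b}(\varphi_{1,b}(\xi),\varphi_{1,b}(\zeta))\le L\,\theta_{1,b}(\xi,\zeta)$ for all $\xi,\zeta\in\partial_\omega X$.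
   Context: CAT$(-1)$ space: a geodesic metric space in which geodesic triangles are at least as thin as their comparison triangles in the hyperbolic plane $\mathbb{H}^2$ (the standard definition); such a space is Gromov hyperbolic. Notation. $|xy|=d(x,y)$. A geodesic is an isometric map $\gamma:I\to X$ of an interval $I\subset\mathbb{R}$ (or its image). The Gromov product is $(x|y)_p=\frac12(|xp|+|yp|-|xy|)$. A sequence $\{x_n\}$ converges to infinity if $(x_n|x_m)_p\to\infty$ as $m,n\to\infty$; the Gromov boundary $\partial X$ is the set of such sequences modulo $\{x_n\}\sim\{y_n\}$ iff $(x_n|y_n)_p\to\infty$ (independent of $p$). We write $\{x_n\}\in\xi$ if $\{x_n\}$ represents $\xi$. A geodesic ray $\gamma:[0,\infty)\to X$ determines the class $[\gamma]\in\partial X$ of $\{\gamma(n)\}$; $\gamma\in\xi$ means $[\gamma]=\xi$, and for $\gamma:(-\infty,0]\to X$, $\gamma\in\xi$ means $\{\gamma(-n)\}\in\xi$. Busemann functions. For a geodesic ray $\gamma$, $b_\gamma(x)=\lim_{t\to\infty}(d(\gamma(t),x)-t)$. $\mathcal{B}(X)=\{b_\gamma+s\}$ ($\gamma$ a geodesic ray, $s\in\mathbb{R}$); the basepoint of $b=b_\gamma+s$ is $[\gamma]\in\partial X$. $\mathcal{D}(X)=\{d(\cdot,z)+s : z\in X, s\in\mathbb{R}\}$; the basepoint of $b=d(\cdot,z)+s$ is $z$. $\hat{\mathcal{B}}(X)=\mathcal{B}(X)\cup\mathcal{D}(X)$. For $\omega\in\partial X$, $\partial_\omega X=\partial X\setminus\{\omega\}$;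 for $\omega\in X$, $\partial_\omega X=\partial X$. Rough starlikeness. For $z\in X$, $X$ is $K$-roughly starlike from $z$ if (1) for each $x\in X$ there is a geodesic ray $\gamma:[0,\infty)\to X$ with $\gamma(0)=z$ and $\mathrm{dist}(x,\gamma)\le K$; (2) for each $\xi\in\partial X$ there is a geodesic ray $\gamma$ with $\gamma(0)=z$ and $\gamma\in\xi$. For $\omega\in\partial X$, $X$ is $K$-roughly starlike from $\omega$ if (1) for each $x\in X$ there is a geodesic line $\gamma:\mathbb{R}\to X$ with $\mathrm{dist}(x,\gamma)\le K$ and $\gamma|_{(-\infty,0]}\in\omega$; (2) for each $\xi\in\partial_\omega X$ there is a geodesic line $\gamma$ with $\gamma|_{[0,\infty)}\in\xi$ and $\gamma|_{(-\infty,0]}\in\omega$. Conformal deformation. For a continuous $\rho:X\to(0,\infty)$ (a density), $\ell_\rho(\gamma)=\int_\gamma\rho\,ds$ and $d_\rho(x,y)=\inf\ell_\rho(\gamma)$ over all curves joining $x$ to $y$. $\rho$ is a GH-density with constant $M\ge1$ if $\ell_\rho(\gamma)\le M d_\rho(x,y)$ for all $x,y\in X$ and every geodesic $\gamma$ of $X$ joining $x$ to $y$. $X_{1,b}=(X,d_{1,b})$ is $X$ with the metric $d_\rho$ for $\rho=\rho_{1,b}=e^{-b}$; $\bar X_{1,b}$ is its completion (extended metric still $d_{1,b}$) and $\partial X_{1,b}=\bar X_{1,b}\setminus X_{1,b}$. Model quasi-metric. $(x|y)_b=\frac12(b(x)+b(y)-|xy|)$ for $x,y\in X$; for $\xi,\zeta\in\partial_\omega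 X$, $(\xi|\zeta)_b=\inf\liminf_{n}(x_n|y_n)_b$ over all $\{x_n\}\in\xi$, $\{y_n\}\in\zeta$. $\theta_{1,b}(\xi,\zeta)=e^{-(\xi|\zeta)_b}$ (with $e^{-\infty}=0$). A visual metric based at $\omega$ with parameter $1$ and comparison constant $L$ is a metric $\theta$ on $\partial_\omega X$ with $L^{-1}\theta_{1,b}\le\theta\le L\theta_{1,b}$. The canonical map $\varphi_{1,b}$ sends $\xi\in\partial_\omega X$ to the limit in $\bar X_{1,b}$ of any sequence $\{x_n\}\in\xi$. Uniform curves and spaces. Let $(\Omega,d)$ be an incomplete metric space, $\partial\Omega=\bar\Omega\setminus\Omega$, $d_\Omega(x)=\mathrm{dist}(x,\partial\Omega)$. Let $\gamma:I\to\Omega$ be a curve on an interval $I$ with endpoints $t_-\in[-\infty,\infty)$, $t_+\in(-\infty,\infty]$, $\ell$ denoting length, $I_{\le t}=\{s\in I:s\le t\}$, $I_{\ge t}=\{s\in I:s\ge t\}$. If $\ell(\gamma)<\infty$, let $\gamma_\pm\in\bar\Omega$ be the limits of $\gamma(t)$ as $t\to t_\pm$; $\gamma$ is $A$-uniform if (a) $\ell(\gamma)\le A\,d(\gamma_-,\gamma_+)$ and (b) $\min\{\ell(\gamma|_{I_{\le t}}),\ell(\gamma|_{I_{\ge t}})\}\le A\,d_\Omega(\gamma(t))$ for all $t\in I$. If $\ell(\gamma)=\infty$, $\gamma$ is $A$-uniform if (b) holds and $d(\gamma(s),\gamma(t))\to\infty$ as $s\to t_-$, $t\to t_+$. $\Omega$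 is $A$-uniform if any two of its points can be joined by an $A$-uniform curve. *)

(* Defs.v *)
(* The base space is a [metricType R].  The deformed space
   X_{1,b} has the same points, so everything that is applied to both (geodesics,
   lengths, completions, uniform curves) is stated for an arbitrary distance
   function d : T -> T -> R. *)
From HB Require Import structures.
From mathcomp Require Import all_boot all_order all_algebra.
From mathcomp Require Import all_classical all_reals all_analysis.

Set Implicit Arguments.
Unset Strict Implicit.
Unset Printing Implicit Defensive.

Import Order.TTheory GRing.Theory Num.Theory.
Import numFieldNormedType.Exports.

Local Open Scope classical_set_scope.
Local Open Scope ring_scope.

(* +oo when S is empty *)
Definition dist_to_set {R : realType} {T : Type} (d : T -> T -> R)
    (x : T) (S : set T) : \bar R :=
  ereal_inf [set (d x y)%:E | y in S].

Section Distances.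
Context {R : realType} {T : Type}.
Implicit Types (d : T -> T -> R) (gamma : R -> T) (I : set R).

Definition metric_on (D : set T) d : Prop :=
  [/\ forall x y, D x -> D y -> 0 <= d x y,
      forall x y, D x -> D y -> (d x y = 0 <-> x = y),
      forall x y, D x -> D y -> d x y = d y x &
      forall x y z, D x -> D y -> D z -> d x z <= d x y + d y z].

Definition bounded_distance d : Prop := exists C : R, forall x y, d x y <= C.

(* Curves and geodesics are total functions of which only the values on I
   matter; I may be open, half-open, closed, bounded or not. *)
Definition curve d I gamma : Prop :=
  [/\ is_interval I, I !=set0 &
      forall t, I t -> d (gamma t) (gamma s) @[s --> within I (nbhs t)] --> (0 : R)].

Definition geodesic d I gamma : Prop :=
  [/\ is_interval I, I !=set0 &
      forall s t, I s -> I t -> d (gamma s) (gamma t) = `|s - t|].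

Definition geodesic_segment d (x y : T) (S : set T) : Prop :=
  exists gamma, [/\ geodesic d `[0, d x y] gamma,
    gamma 0 = x, gamma (d x y) = y & S = gamma @` `[0, d x y]].

Definition geodesic_space d : Prop :=
  forall x y, exists S, geodesic_segment d x y S.

(* The side S i joins the vertex v i to the vertex v (i + 1 mod 3). *)
Definition geodesic_triangle d (v : 'I_3 -> T) (S : 'I_3 -> set T) : Prop :=
  forall i, geodesic_segment d (v i) (v (ordS i)) (S i).

Definition curve_length d gamma I : \bar R :=
  ereal_sup [set (\sum_(0 <= i < (size ts).-1)
                    d (gamma (nth 0 ts i)) (gamma (nth 0 ts i.+1)))%:E
            | ts in [set ts : seq R | sorted <=%R ts /\ forall t, t \in ts -> I t]].

Definition cauchy_sequence d (x : nat -> T) : Prop :=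
  d (x n.1) (x n.2) @[n --> (\oo, \oo)] --> (0 : R).

(* Points of the completion are equivalence classes of Cauchy sequences, seen
   as sets of sequences. *)
Definition cauchy_class d (x : nat -> T) : set (nat -> T) :=
  [set y | cauchy_sequence d y /\ d (x n) (y n) @[n --> \oo] --> (0 : R)].

Definition completion d : set (set (nat -> T)) :=
  [set p | exists2 x, cauchy_sequence d x & p = cauchy_class d x].

Definition to_completion d (x : T) : set (nat -> T) :=
  cauchy_class d (fun=> x).

Definition completion_dist d (p q : set (nat -> T)) : R :=
  get [set r : R | exists x y,
    [/\ p x, q y & d (x n) (y n) @[n --> \oo] --> r]].

Definition metric_boundary d : set (set (nat -> T)) :=
  completion d `\` range (to_completion d).

(* d_Omega *)
Definition boundary_dist d (x : T) : \bar R :=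
  dist_to_set (completion_dist d) (to_completion d x) (metric_boundary d).

(* The filters t --> t_- and t --> t_+ in I; if I contains the endpoint, the
   limit is the value there. *)
Definition left_end I : set_system R :=
  filter_from I (fun t0 => [set t | I t /\ t <= t0]).

Definition right_end I : set_system R :=
  filter_from I (fun t0 => [set t | I t /\ t0 <= t]).

Definition curve_limit d gamma (F : set_system R) (p : set (nat -> T)) : Prop :=
  completion d p /\
  completion_dist d (to_completion d (gamma t)) p @[t --> F] --> (0 : R).

Definition uniform_curve d (A : R) I gamma : Prop :=
  [/\ curve d I gamma,
      (curve_length d gamma I < +oo)%E ->
        exists p q, [/\ curve_limit d gamma (left_end I) p,
          curve_limit d gamma (right_end I) q &
          (curve_length d gamma I <= (A * completion_dist d p q)%:E)%E],
      curve_length d gamma I = +oo%E ->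
        d (gamma u.1) (gamma u.2) @[u --> (left_end I, right_end I)] --> +oo &
      forall t, I t ->
        (Order.min (curve_length d gamma [set s | I s /\ (s <= t)%R])
                   (curve_length d gamma [set s | I s /\ (t <= s)%R])
           <= A%:E * boundary_dist d (gamma t))%E].

Definition uniform_space d (A : R) : Prop :=
  [/\ metric_on setT d, metric_boundary d !=set0 &
      forall x y, exists a c gamma,
        [/\ a <= c, gamma a = x, gamma c = y & uniform_curve d A `[a, c] gamma]].

End Distances.

Section HyperbolicPlane.
Context {R : realType}.

(* The upper half-plane; arcosh u = ln (u + sqrt (u^2 - 1)). *)
Definition hyperbolic_plane : Type := {p : R * R | 0 < p.2}.

Definition arcosh (u : R) : R := ln (u + Num.sqrt (u ^+ 2 - 1)).

Definition hyperbolic_dist (p q : hyperbolic_plane) : R :=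
  let: (x1, y1) := val p in let: (x2, y2) := val q in
  arcosh (1 + ((x1 - x2) ^+ 2 + (y1 - y2) ^+ 2) / (2 * y1 * y2)).

End HyperbolicPlane.

Section Spaces.
Context {R : realType} {X : metricType R}.
Implicit Types (b rho : X -> R) (gamma : R -> X).

Local Notation d := (@mdist R X).

Definition complete_space : Prop :=
  forall F : set_system X, ProperFilter F -> cauchy F -> exists l : X, F --> l.

Definition CAT_minus1 : Prop :=
  geodesic_space d /\
  forall (v : 'I_3 -> X) S (v' : 'I_3 -> @hyperbolic_plane R) S',
    geodesic_triangle d v S -> geodesic_triangle hyperbolic_dist v' S' ->
    (forall i, hyperbolic_dist (v' i) (v' (ordS i)) = d (v i) (v (ordS i))) ->
    forall i j p q p' q',
      S i p -> S' i p' -> hyperbolic_dist (v' i) p' = d (v i) p ->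
      S j q -> S' j q' -> hyperbolic_dist (v' j) q' = d (v j) q ->
      d p q <= hyperbolic_dist p' q'.

Definition geodesic_ray gamma : Prop := geodesic d `[0, +oo[ gamma.

Definition geodesic_line gamma : Prop := geodesic d setT gamma.

(* (x|y)_b; the usual product (x|y)_p is the case b = d(., p). *)
Definition gromov_product b x y : R := (b x + b y - d x y) / 2.

Definition gromov_product_at (p x y : X) : R := gromov_product (d ^~ p) x y.

Definition converges_to_infinity (x : nat -> X) : Prop :=
  forall p, gromov_product_at p (x n.1) (x n.2) @[n --> (\oo, \oo)] --> +oo.

Definition gromov_class (x : nat -> X) : set (nat -> X) :=
  [set y | converges_to_infinity y /\
           forall p, gromov_product_at p (x n) (y n) @[n --> \oo] --> +oo].

(* As for completions, a point of the boundary is the set of the sequences that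
   represent it. *)
Definition gromov_boundary : set (set (nat -> X)) :=
  [set xi | exists2 x, converges_to_infinity x & xi = gromov_class x].

Definition ray_class gamma : set (nat -> X) :=
  gromov_class (fun n => gamma n%:R).

Definition busemann gamma x : R := lim ((d (gamma t) x - t) @[t --> +oo]).

Inductive basepoint : Type :=
| Inside of X
| AtInfinity of set (nat -> X).

Definition has_basepoint b (omega : basepoint) : Prop :=
  match omega with
  | Inside z => exists s : R, b = (fun x => d x z + s)
  | AtInfinity xi => exists gamma (s : R),
      [/\ geodesic_ray gamma, b = (fun x => busemann gamma x + s) &
          xi = ray_class gamma]
  end.

Definition busemann_functions : set (X -> R) :=
  [set b | exists xi, has_basepoint b (AtInfinity xi)].

Definition distance_functions : set (X -> R) :=
  [set b | exists z, has_basepoint b (Inside z)].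

Definition extended_busemann_functions : set (X -> R) :=
  busemann_functions `|` distance_functions.

Definition punctured_boundary (omega : basepoint) : set (set (nat -> X)) :=
  match omega with
  | Inside _ => gromov_boundary
  | AtInfinity xi => gromov_boundary `\ xi
  end.

Definition roughly_starlike (K : R) (omega : basepoint) : Prop :=
  match omega with
  | Inside z =>
      (forall x, exists gamma, [/\ geodesic_ray gamma, gamma 0 = z &
        (dist_to_set d x (gamma @` `[0%R, +oo[) <= K%:E)%E]) /\
      (forall xi, gromov_boundary xi -> exists gamma,
        [/\ geodesic_ray gamma, gamma 0 = z & ray_class gamma = xi])
  | AtInfinity w =>
      (forall x, exists gamma, [/\ geodesic_line gamma,
        (dist_to_set d x (range gamma) <= K%:E)%E &
        w (fun n => gamma (- n%:R))]) /\
      (forall xi, punctured_boundary omega xi -> exists gamma,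
        [/\ geodesic_line gamma, ray_class gamma = xi &
            w (fun n => gamma (- n%:R))])
  end.

Definition density rho : Prop := continuous rho /\ forall x, 0 < rho x.

(* For gamma of finite length on [a, c]: the point gamma t such that gamma has
   length s on [a, t]. *)
Definition arclength_param gamma (a c s : R) : X :=
  gamma (get [set t : R | a <= t <= c /\ curve_length d gamma `[a, t] = s%:E]).

(* The integral of rho over gamma on [a, c] with respect to arclength; +oo if
   gamma is not rectifiable. *)
Definition rho_length rho gamma (a c : R) : \bar R :=
  match curve_length d gamma `[a, c] with
  | l%:E%E =>
      (\int[lebesgue_measure]_(s in `[0%R, l]) (rho (arclength_param gamma a c s))%:E)%E
  | _ => +oo%E
  end.

Definition rho_dist rho x y : R :=
  fine (ereal_inf [set L : \bar R | exists a c gamma,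
    [/\ a <= c, curve d `[a, c] gamma, gamma a = x, gamma c = y &
        L = rho_length rho gamma a c]]).

Definition GH_density (M : R) rho : Prop :=
  density rho /\
  forall x y a c gamma, a <= c -> geodesic d `[a, c] gamma ->
    gamma a = x -> gamma c = y ->
    (rho_length rho gamma a c <= (M * rho_dist rho x y)%:E)%E.

Definition rho1 b x : R := expR (- b x).

(* d_{1,b} *)
Definition dist1 b : X -> X -> R := rho_dist (rho1 b).

Definition boundary_product b (xi zeta : set (nat -> X)) : \bar R :=
  ereal_inf [set L : \bar R | exists x y,
    [/\ xi x, zeta y &
        L = limn_einf (fun n => (gromov_product b (x n) (y n))%:E)]].

(* Kept extended-real valued: the real theta_{1,b}(xi, zeta), with e^{-oo} = 0. *)
Definition theta1 b (xi zeta : set (nat -> X)) : \bar R :=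
  expeR (- boundary_product b xi zeta)%E.

Definition visual_metric b (omega : basepoint) (L : R)
    (theta : set (nat -> X) -> set (nat -> X) -> R) : Prop :=
  metric_on (punctured_boundary omega) theta /\
  forall xi zeta, punctured_boundary omega xi -> punctured_boundary omega zeta ->
    (L^-1%:E * theta1 b xi zeta <= (theta xi zeta)%:E)%E /\
    ((theta xi zeta)%:E <= L%:E * theta1 b xi zeta)%E.

Definition converges_in_completion b (x : nat -> X) (p : set (nat -> X)) : Prop :=
  completion (dist1 b) p /\
  completion_dist (dist1 b) (to_completion (dist1 b) (x n)) p @[n --> \oo] --> (0 : R).

(* phi_{1,b}: the common limit of the sequences in xi, with the default value
   set0 if there is none. *)
Definition canonical_map b (xi : set (nat -> X)) : set (nat -> X) :=
  xget set0 [set p | forall x, xi x -> converges_in_completion b x p].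

End Spaces.

Arguments complete_space {R} X.
Arguments CAT_minus1 {R} X.
Arguments basepoint {R} X.

(* Main.v *)
(* The comparison with the hyperbolic plane is used only through the radial
   retraction pi onto a ball of radius r about a point z:
     e^{-r} d(pi x, pi y) <= 4 e^{-(|xz|+|yz|)/2} sinh(|xy|/2).
   The left side is a pseudodistance and the right side is infinitesimally
   2 e^{-|xz|} ds, so up to a constant the left side bounds from below the
   rho-length of every curve from x to y, rho = e^{-d(., z)}.  For
   r = (x|y)_z + 1 one has d(pi x, pi y) >= min(1, |xy|), whence a lower bound
   c e^{-(x|y)_z} min(1, |xy|) for these lengths.  As the right side above is at
   most 2 e^{-(x|y)_z}, the triangle inequality for d(pi x, pi y) also yields the
   four-point inequality of Gromov hyperbolicity.

   Conversely b is 1-Lipschitz, so along a geodesic from x to y it is at least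
   (x|y)_b + |t - t0| for some t0, and geodesics have rho-length at most
   C e^{-(x|y)_b} min(1, |xy|).  A Busemann function b is a decreasing limit of
   translated distance functions b_n, and b <= b_n gives e^{-b} >= e^{-b_n}, so
   the lower bound passes to the limit with the same constant.  Therefore
     c e^{-(x|y)_b} min(1, |xy|) <= d_{1,b}(x, y) <= C e^{-(x|y)_b} min(1, |xy|)
   with universal constants: this is the Gehring-Hayman inequality, and it
   identifies the d_{1,b}-Cauchy sequences without limit with the sequences such
   that (x_n|x_m)_b tends to infinity, i.e. with those that represent a point of
   the Gromov boundary other than the basepoint of b. *)

Require Import Defs.
From HB Require Import structures.
From mathcomp Require Import all_boot all_order all_algebra.
From mathcomp Require Import all_classical all_reals all_analysis.
From mathcomp Require Import ring lra.

Set Implicit Arguments.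
Unset Strict Implicit.
Unset Printing Implicit Defensive.

Import Order.TTheory GRing.Theory Num.Theory.
Import numFieldNormedType.Exports.

Local Open Scope classical_set_scope.
Local Open Scope ring_scope.

(** * Comparison with the hyperbolic plane *)

(** The estimate for pi is a computation in polar coordinates about z. If sides u, v enclose an
    angle of cosine c and l is the opposite side, then e^{-(u+v)} (cosh l - 1) = (e^{-u} - e^{-v})^2
    / 2 + (1 - c)(1 - e^{-2u})(1 - e^{-2v}) / 4, and truncating u and v at r decreases both terms.
    The technical obstacle is that d_{1,b} is built from Lebesgue integrals along arclength
    parametrizations obtained by choice, which are awkward to reverse, join or compare. They are
    traded for costs of 1-Lipschitz paths, given by primitives in a two-sided (straddle) sense. The
    infimum is the same, and the integral estimates become monotonicity statements that ask no
    differentiability of the functions compared. Uniformity needs one more fact: on at least one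
    side of each point of a geodesic, b grows at unit speed up to an additive 6. That side has
    d_{1,b}-length at most a multiple of e^{-b}, while the distance to the boundary is at least a
    multiple of e^{-b}, because b tends to infinity along sequences that converge to a boundary
    point. *)

Section HyperbolicFunctions.
Context {R : realType}.
Implicit Types s t u v l r : R.

Definition cosh t : R := (expR t + expR (- t)) / 2.
Definition sinh t : R := (expR t - expR (- t)) / 2.

Lemma coshN t : cosh (- t) = cosh t.
Proof. by rewrite /cosh opprK addrC. Qed.

Lemma cosh_norm t : cosh `|t| = cosh t.
Proof. by case: (ger0P t) => // _; rewrite coshN. Qed.

Lemma cosh2B_sinh2 t : cosh t ^+ 2 - sinh t ^+ 2 = 1.
Proof.
rewrite /cosh /sinh expRN; have := expR_gt0 t.
by move: (expR t) => E E0; field; rewrite gt_eqF.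
Qed.

Lemma coshB s t : cosh (s - t) = cosh s * cosh t - sinh s * sinh t.
Proof.
rewrite /cosh /sinh opprB !expRB !expRN.
have := expR_gt0 s; have := expR_gt0 t.
by move: (expR s) (expR t) => E F F0 E0; field; rewrite !gt_eqF.
Qed.

Lemma coshDexp t : cosh t + sinh t = expR t.
Proof. by rewrite /cosh /sinh; lra. Qed.

Lemma sinh_ge0 t : 0 <= t -> 0 <= sinh t.
Proof.
by move=> t0; rewrite /sinh divr_ge0// subr_ge0 ler_expR; lra.
Qed.

Lemma cosh_ge1 t : 1 <= cosh t.
Proof.
have := cosh2B_sinh2 t; have := sqr_ge0 (sinh t).
have : 0 <= cosh t by rewrite /cosh divr_ge0// addr_ge0// expR_ge0.
nra.
Qed.

Lemma ler_cosh : {in Num.nneg &, {homo cosh : s t / s <= t}}.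
Proof.
move=> s t; rewrite !nnegrE => s0 t0 st.
suff : 0 <= (expR t - expR s) * (1 - expR (- s) * expR (- t)).
  have := expRxMexpNx_1 s; have := expRxMexpNx_1 t; rewrite /cosh.
  move: (expR s) (expR (- s)) (expR t) (expR (- t)) => a b c d cd ab.
  have -> : (c - a) * (1 - b * d) = c - a - b * (c * d) + (a * b) * d by ring.
  by rewrite cd ab; lra.
rewrite mulr_ge0 ?subr_ge0 ?ler_expR//.
by rewrite -expRD expR_le1; lra.
Qed.

Lemma arcosh_cosh t : 0 <= t -> arcosh (cosh t) = t.
Proof.
move=> t0; rewrite /arcosh.
have -> : cosh t ^+ 2 - 1 = sinh t ^+ 2 by have := cosh2B_sinh2 t; lra.
by rewrite sqrtr_sqr ger0_norm ?sinh_ge0// coshDexp expRK.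
Qed.

Lemma cosh_arcosh u : 1 <= u -> cosh (arcosh u) = u.
Proof.
move=> u1; rewrite /cosh /arcosh expRN.
set w := Num.sqrt _.
have w0 : 0 <= w by exact: sqrtr_ge0.
have w2 : w ^+ 2 = u ^+ 2 - 1 by rewrite sqr_sqrtr//; nra.
rewrite lnK ?posrE; last by lra.
suff -> : (u + w)^-1 = u - w by lra.
apply: (mulfI (_ : u + w != 0)); first by rewrite gt_eqF//; lra.
rewrite divff; first by nra.
by rewrite gt_eqF//; lra.
Qed.

Lemma arcosh_ge0 u : 1 <= u -> 0 <= arcosh u.
Proof.
by move=> u1; rewrite ln_ge0//; have := sqrtr_ge0 (u ^+ 2 - 1); lra.
Qed.

Lemma le_sinh t : 0 <= t -> t <= 2 * sinh t.
Proof.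
move=> t0; have E1 := expR_ge1Dx t.
have : expR t * expR (- t) = 1 := expRxMexpNx_1 t.
rewrite /sinh; move: (expR t) (expR (- t)) E1 => E F E1 EF.
have F1 : F <= 1 by nra.
nra.
Qed.

Lemma coshB1 t : cosh t - 1 = 2 * sinh (t / 2) ^+ 2.
Proof.
rewrite /cosh /sinh.
have -> : expR t = expR (t / 2) ^+ 2.
  by rewrite -expRM_natr; congr expR; field.
have -> : expR (- t) = expR (- (t / 2)) ^+ 2.
  by rewrite -expRM_natr; congr expR; field.
by have := expRxMexpNx_1 (t / 2); nra.
Qed.

Lemma sqr_le_cosh t : t ^+ 2 <= 8 * (cosh t - 1).
Proof.
rewrite -(cosh_norm t) -(real_normK (num_real t)) coshB1.
have := @le_sinh (`|t| / 2); have : 0 <= `|t| by [].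
move: (`|t|) => a a0 H.
have := H ltac:(lra); nra.
Qed.

Lemma coshB1_scaled u v :
  expR (- (u + v)) * (cosh (u - v) - 1) = (expR (- u) - expR (- v)) ^+ 2 / 2.
Proof.
rewrite /cosh opprB !expRN !expRD !expRN.
have := expR_gt0 u; have := expR_gt0 v.
by move: (expR u) (expR v) => E F F0 E0; field; rewrite !gt_eqF.
Qed.

Lemma sinh_scaled u : expR (- u) * sinh u = (1 - expR (- u) ^+ 2) / 2.
Proof.
rewrite /sinh; have := expRxMexpNx_1 u.
by move: (expR u) (expR (- u)) => E F EF; nra.
Qed.

(** Here [c] is the cosine of the angle between sides of lengths [u] and [v] of a hyperbolic
    triangle; the value is the cosh of the third side. *)
Definition cosine_law u v (c : R) := cosh u * cosh v - c * sinh u * sinh v.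

Lemma cosine_law_ge1 u v c : 0 <= u -> 0 <= v -> c <= 1 -> 1 <= cosine_law u v c.
Proof.
move=> u0 v0 c1; apply: le_trans (cosh_ge1 (u - v)) _.
rewrite coshB /cosine_law -mulrA lerD2l lerN2 ler_piMl//.
by rewrite mulr_ge0 ?sinh_ge0.
Qed.

(** The scaling separates a radial term, a squared difference in e^{-u} and e^{-v}, from an angular
    term that increases with [u] and [v]; each can be compared with its truncated version on its
    own. *)
Lemma cosine_law_scaled u v c :
  expR (- (u + v)) * (cosine_law u v c - 1) =
  (expR (- u) - expR (- v)) ^+ 2 / 2 +
  (1 - c) * ((1 - expR (- u) ^+ 2) / 2) * ((1 - expR (- v) ^+ 2) / 2).
Proof.
rewrite -coshB1_scaled -(sinh_scaled u) -(sinh_scaled v) coshB /cosine_law.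
rewrite opprD expRD.
ring.
Qed.

(* In terms of e^{-u} and e^{-v}, truncating u and v at r is the 1-Lipschitz
   map max(., e^{-r}). *)
Lemma cosine_law_contraction r u v c : 0 <= r -> 0 <= u -> 0 <= v -> c <= 1 ->
  expR (- r) ^+ 2 * (cosine_law (Num.min r u) (Num.min r v) c - 1) <=
  expR (- (u + v)) * (cosine_law u v c - 1).
Proof.
move=> r0 u0 v0 c1; set u' := Num.min r u; set v' := Num.min r v.
have u'r : u' <= r by rewrite ge_min lexx.
have v'r : v' <= r by rewrite ge_min lexx.
have u'u : u' <= u by rewrite ge_min lexx orbT.
have v'v : v' <= v by rewrite ge_min lexx orbT.
have u'0 : 0 <= u' by rewrite le_min r0.
have v'0 : 0 <= v' by rewrite le_min r0.
have H (x : R) : 0 <= x -> 0 <= (1 - expR (- x) ^+ 2) / 2.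
  by move=> x0; rewrite -sinh_scaled mulr_ge0 ?expR_ge0 ?sinh_ge0.
have H' (x y : R) : 0 <= x -> x <= y -> (1 - expR (- x) ^+ 2) / 2 <= (1 - expR (- y) ^+ 2) / 2.
  move=> x0 xy; rewrite ler_pM2r// lerD2l lerN2 ler_pXn2r ?nnegrE ?expR_ge0//.
  by rewrite ler_expR lerN2.
have P : 0 <= expR (- (u' + v')) * (cosine_law u' v' c - 1).
  by rewrite mulr_ge0 ?expR_ge0// subr_ge0 cosine_law_ge1.
(* As u' + v' <= 2r, the factor e^{-2r} may be enlarged to e^{-(u'+v')}; both sides then have the
   form of [cosine_law_scaled]. *)
apply: (@le_trans _ _ (expR (- (u' + v')) * (cosine_law u' v' c - 1))).
  rewrite pmulr_rge0 ?expR_gt0// in P.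
  by rewrite ler_wpM2r// expr2 -expRD ler_expR; lra.
rewrite !cosine_law_scaled lerD//.
  rewrite ler_pM2r// -[leLHS]real_normK ?num_real// -[leRHS]real_normK ?num_real//.
  rewrite ler_pXn2r ?nnegrE//.
  have E (x : R) : expR (- Num.min r x) = Num.max (expR (- r)) (expR (- x)).
    case: (leP r x) => rx.
      by rewrite max_l// ler_expR lerN2.
    by rewrite max_r// ler_expR lerN2 ltW.
  rewrite /u' /v' !E; move: (expR (-r)) (expR (- u)) (expR (- v)) => T U V.
  case: (leP T U) => TU; case: (leP T V) => TV;
    case: (ger0P (U - V)) => ?; rewrite ?ler_norml; try (apply/andP; split); lra.
apply: ler_pM; rewrite ?H ?H'//; first by rewrite mulr_ge0 ?H ?subr_ge0.
by rewrite ler_wpM2l ?H' ?subr_ge0.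
Qed.

End HyperbolicFunctions.

(** * Polar coordinates in the upper half-plane *)

Section HyperbolicPlanePolar.
Context {R : realType}.
Implicit Types (o p q : @hyperbolic_plane R) (c s t : R).

(** The quantity is ((1 - c) e^t + (1 + c) e^{-t}) / 2 with |c| <= 1, and the two weights do not
    vanish together. *)
Lemma polar_denom_gt0 c s t : c ^+ 2 + s ^+ 2 = 1 -> 0 < cosh t - c * sinh t.
Proof.
move=> cs; have c1 : c ^+ 2 <= 1 by have := sqr_ge0 s; lra.
have := expR_gt0 t; have := expR_gt0 (- t); rewrite /cosh /sinh.
move: (expR t) (expR (- t)) => E F F0 E0.
have /andP[cl cr] : -1 <= c <= 1 by rewrite -ler_norml -(@expr_le1 _ 2)// real_normK ?num_real.
have : 0 <= E * (1 - c) by rewrite mulr_ge0 ?(ltW E0)//; lra.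
have : 0 <= F * (1 + c) by rewrite mulr_ge0 ?(ltW F0)//; lra.
by case: (leP c 0) => c0; nra.
Qed.

(* The point at distance t from o on the geodesic leaving o at an angle with
   cosine c and sine s to the upward vertical. *)
Definition polar o c s (cs : c ^+ 2 + s ^+ 2 = 1) t : @hyperbolic_plane R :=
  exist _ ((val o).1 + (val o).2 * (s * sinh t / (cosh t - c * sinh t)),
           (val o).2 / (cosh t - c * sinh t))
    (divr_gt0 (valP o) (polar_denom_gt0 t cs)).

Lemma hyperbolic_dist_polar o c s (cs : c ^+ 2 + s ^+ 2 = 1)
    c' s' (cs' : c' ^+ 2 + s' ^+ 2 = 1) t t' :
  hyperbolic_dist (polar o cs t) (polar o cs' t') =
  arcosh (cosine_law t t' (c * c' + s * s')).
Proof.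
case: o => -[x y] /= y0; rewrite /hyperbolic_dist /=; congr arcosh.
have := polar_denom_gt0 t cs; have := polar_denom_gt0 t' cs'.
have := cosh2B_sinh2 t; have := cosh2B_sinh2 t'; rewrite /cosine_law.
move: (cosh t) (sinh t) (cosh t') (sinh t') => C S C' S' CS' CS.
set B := C' - _; set A := C - _ => B0 A0.
(* The distance formula with denominators cleared. It rests on s^2 S^2 + 1 = C^2 - c^2 S^2 = (C - c
   S)(C + c S), which makes each square term divisible by its denominator [A] or [B]. *)
have key : (s * S * B - s' * S' * A) ^+ 2 + (B - A) ^+ 2 =
    2 * A * B * (C * C' - (c * c' + s * s') * S * S' - 1).
  have E1 : s ^+ 2 * S ^+ 2 + 1 = A * (C + c * S).
    have -> : s ^+ 2 = 1 - c ^+ 2 by lra.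
    have -> : C + c * S = A + 2 * c * S by rewrite /A; ring.
    by rewrite /A; lra.
  have E2 : s' ^+ 2 * S' ^+ 2 + 1 = B * (C' + c' * S').
    have -> : s' ^+ 2 = 1 - c' ^+ 2 by lra.
    by rewrite /B; lra.
  transitivity (B ^+ 2 * (s ^+ 2 * S ^+ 2 + 1) + A ^+ 2 * (s' ^+ 2 * S' ^+ 2 + 1)
      - 2 * A * B * (s * s' * S * S' + 1)); first by ring.
  by rewrite E1 E2 /A /B; ring.
apply/eqP; rewrite -subr_eq0; apply/eqP.
transitivity (((s * S * B - s' * S' * A) ^+ 2 + (B - A) ^+ 2) / (2 * A * B)
   - (C * C' - (c * c' + s * s') * S * S' - 1)).
  field; rewrite !gt_eqF//.
rewrite key; field; rewrite !gt_eqF//.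
Qed.

Lemma hyperbolic_dist_polar_same o c s (cs : c ^+ 2 + s ^+ 2 = 1) t t' :
  hyperbolic_dist (polar o cs t) (polar o cs t') = `|t - t'|.
Proof.
rewrite hyperbolic_dist_polar -[LHS]/(arcosh _) -(arcosh_cosh (normr_ge0 _)).
congr arcosh; rewrite cosh_norm coshB /cosine_law -!expr2 cs; ring.
Qed.

Lemma polar0 o c s (cs : c ^+ 2 + s ^+ 2 = 1) : polar o cs 0 = o.
Proof.
have c0 : cosh (0 : R) = 1 by rewrite /cosh oppr0 expR0; lra.
have s0 : sinh (0 : R) = 0 by rewrite /sinh oppr0 subrr mul0r.
case: o => -[x y] y0; apply: val_inj => /=.
by rewrite c0 s0 !mulr0 !mul0r subr0 divr1 mulr0 addr0.
Qed.

(** After moving [o] to (0, 1) by a similarity, [q] becomes (a, h) at a distance t with cosh t =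
    (a^2 + h^2 + 1) / (2 h). Comparing with [polar] gives C - c S = 1 / h and s S = a / h, which are
    solved for c and s. *)
Lemma polar_surj o q : exists c s (cs : c ^+ 2 + s ^+ 2 = 1) t,
  0 <= t /\ q = polar o cs t.
Proof.
case: o => -[x y] /= y0; case: q => -[x' y'] /= y'0.
have [a aE] : exists a, a = (x' - x) / y by exists ((x' - x) / y).
have [h hE] : exists h, h = y' / y by exists (y' / y).
have h0 : 0 < h by rewrite hE divr_gt0.
pose C := (a ^+ 2 + h ^+ 2 + 1) / (2 * h).
have CE : 2 * h * C = a ^+ 2 + h ^+ 2 + 1 by rewrite /C; field; rewrite gt_eqF.
have C1 : 1 <= C by rewrite ler_pdivlMr ?mulr_gt0//; have := sqr_ge0 a; have := sqr_ge0 (h - 1); lra.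
pose t := arcosh C; have t0 : 0 <= t by exact: arcosh_ge0.
have Ct : cosh t = C by rewrite cosh_arcosh.
have xE : x' = x + y * a by rewrite aE; field; rewrite gt_eqF.
have yE : y' = y * h by rewrite hE; field; rewrite gt_eqF.
(* Here q = o, and any direction serves; the upward vertical is taken. *)
have [S0|S0] := eqVneq (sinh t) 0.
  have cs : (1 : R) ^+ 2 + 0 ^+ 2 = 1 by rewrite expr1n expr0n addr0.
  exists 1, 0, cs, t; split=> //; apply: val_inj => /=.
  have := cosh2B_sinh2 t; rewrite S0 Ct => C2.
  have {}C2 : C = 1 by nra.
  rewrite C2 in CE *.
  have h1 : h = 1 by have := sqr_ge0 a; have := sqr_ge0 (h - 1); nra.
  have a0 : a = 0 by apply/eqP; rewrite -sqrf_eq0; apply/eqP; rewrite h1 in CE; lra.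
  by rewrite xE yE a0 h1 !mulr0 mul0r subr0 mulr0 divr1 mulr1.
have cs : ((C - h^-1) / sinh t) ^+ 2 + (a / (h * sinh t)) ^+ 2 = 1.
  have S2 : sinh t ^+ 2 = C ^+ 2 - 1 by have := cosh2B_sinh2 t; rewrite Ct; lra.
  have h2 : h ^+ 2 * (C ^+ 2 - 1) != 0.
    by rewrite -S2 mulf_neq0// sqrf_eq0 ?S0// gt_eqF.
  transitivity ((a ^+ 2 + (h * C - 1) ^+ 2) / (h ^+ 2 * (C ^+ 2 - 1))).
    by rewrite -S2; field; rewrite S0 gt_eqF.
  rewrite -[RHS](divff h2); congr (_ / _); nra.
exists ((C - h^-1) / sinh t), (a / (h * sinh t)), cs, t; split=> //.
apply: val_inj => /=.
have -> : cosh t - (C - h^-1) / sinh t * sinh t = h^-1.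
  by rewrite divfK// Ct; lra.
rewrite xE yE; congr (_, _); first by field; rewrite S0 gt_eqF.
by rewrite invrK.
Qed.

End HyperbolicPlanePolar.

Section Geodesics.
Context {R : realType} {T : Type} (d : T -> T -> R).

Lemma geodesic_segment_sym x y S : d x y = d y x -> 0 <= d x y ->
  geodesic_segment d x y S -> geodesic_segment d y x S.
Proof.
move=> xy l0 [g [[_ _ gE] g0 gl ->]].
have I t : t \in `[0, d y x] -> d x y - t \in `[0, d x y].
  by rewrite !in_itv/= -xy => /andP[? ?]; apply/andP; split; lra.
exists (fun t => g (d x y - t)); split.
- split; first exact: interval_is_interval.
    by exists 0; rewrite /= in_itv/= lexx -xy.
  move=> s t /I Is /I It; rewrite gE// -normrN; congr `|_|; lra.
- by rewrite subr0.
- by rewrite xy subrr.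
- apply/seteqP; split=> [_ [t It <-]|_ [t It <-]].
    exists (d x y - t); last by congr g; lra.
    by move: It; rewrite /= !in_itv/= -xy => /andP[? ?]; apply/andP; split; lra.
  by exists (d x y - t) => //; exact: I.
Qed.

Lemma geodesic_segment_end x y S p : geodesic_segment d x y S -> S p -> 0 <= d x y ->
  0 <= d x p <= d x y /\ d p y = d x y - d x p.
Proof.
move=> [g [[_ _ gE] g0 gl ->]] [t It <-] l0.
have I0 : 0 \in `[0, d x y] by rewrite in_itv/= lexx.
have Il : d x y \in `[0, d x y] by rewrite in_itv/= lexx l0.
move: (It); rewrite /= in_itv/= => /andP[t0 tl].
have -> : d x (g t) = t by rewrite -{1}g0 gE// sub0r normrN ger0_norm.
have -> : d (g t) y = d x y - t by rewrite -{1}gl gE// distrC ger0_norm// subr_ge0.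
by rewrite t0 tl.
Qed.

Lemma geodesic_segment_point x y S r : geodesic_segment d x y S ->
  0 <= r <= d x y -> exists2 p, S p & d x p = r.
Proof.
move=> [g [[_ _ gE] g0 gl ->]] r0; exists (g r).
  by exists r => //; rewrite /= in_itv.
move: r0 => /andP[r0 rl].
rewrite -{1}g0 gE/= ?in_itv/= ?lexx ?r0 ?rl//; last by rewrite (le_trans r0).
by rewrite sub0r normrN ger0_norm.
Qed.

End Geodesics.

Section HyperbolicGeodesics.
Context {R : realType}.
Implicit Types (o p q : @hyperbolic_plane R) (c s t : R).

Lemma geodesic_segment_polar o c s (cs : c ^+ 2 + s ^+ 2 = 1) t : 0 <= t ->
  geodesic_segment hyperbolic_dist o (polar o cs t) (polar o cs @` `[0, t]).
Proof.
move=> t0; have E : hyperbolic_dist o (polar o cs t) = t.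
  by rewrite -{1}(polar0 o cs) hyperbolic_dist_polar_same sub0r normrN ger0_norm.
exists (polar o cs); rewrite E; split=> //; last exact: polar0.
split; first exact: interval_is_interval.
  by exists 0; rewrite /= in_itv/= lexx.
by move=> a b _ _; exact: hyperbolic_dist_polar_same.
Qed.

Lemma geodesic_hyperbolic_plane : geodesic_space (@hyperbolic_dist R).
Proof.
move=> o q; have [c [s [cs [t [t0 ->]]]]] := polar_surj o q.
by exists (polar o cs @` `[0, t]); exact: geodesic_segment_polar.
Qed.

Lemma hyperbolic_distC p q : hyperbolic_dist p q = hyperbolic_dist q p.
Proof.
case: p q => -[x y] y0 [[x' y'] y'0]; rewrite /hyperbolic_dist/=.
congr (arcosh (1 + _ / _)); ring.
Qed.

Lemma hyperbolic_dist_ge0 p q : 0 <= hyperbolic_dist p q.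
Proof.
case: p q => -[x y] /= y0 [[x' y'] /= y'0]; rewrite /hyperbolic_dist/= arcosh_ge0//.
by rewrite lerDl divr_ge0// ?addr_ge0 ?sqr_ge0// !mulr_ge0// ltW.
Qed.

End HyperbolicGeodesics.

Section Comparison.
Context {R : realType}.

(** [cosine_law] is affine in [c], with value cosh (u - v) at 1 and cosh (u + v) at -1; the triangle
    inequalities place cosh l between the two. *)
Lemma comparison_triangle (u v l : R) : 0 <= u -> 0 <= v -> `|u - v| <= l <= u + v ->
  exists c s, [/\ c ^+ 2 + s ^+ 2 = 1, c <= 1 & cosine_law u v c = cosh l].
Proof.
move=> u0 v0 /andP[uvl luv].
have l0 : 0 <= l by exact: le_trans uvl.
have lo : cosine_law u v 1 <= cosh l.
  rewrite /cosine_law mul1r -coshB -cosh_norm ler_cosh// ?nnegrE//.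
have hi : cosh l <= cosine_law u v (-1).
  have -> : cosine_law u v (-1) = cosh (u + v).
    by rewrite -[v in RHS]opprK coshB coshN /sinh /cosine_law /sinh opprK; lra.
  by rewrite ler_cosh ?nnegrE ?addr_ge0.
suff [c [c1 cl cE]] : exists c, [/\ -1 <= c, c <= 1 & cosine_law u v c = cosh l].
  exists c, (Num.sqrt (1 - c ^+ 2)); split=> //.
  by rewrite sqr_sqrtr ?subrKC//; nra.
have := sinh_ge0 u0; have := sinh_ge0 v0; rewrite /cosine_law in lo hi *.
move: (sinh u) (sinh v) lo hi => a b lo hi b0 a0.
(* In a degenerate triangle the value does not depend on [c]. *)
have [ab|ab] := eqVneq (a * b) 0.
  exists 0; split; [lra..|].
  have E c : c * a * b = 0 by rewrite -mulrA ab mulr0.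
  by move: lo hi; rewrite !E => ? ?; lra.
have {}ab : 0 < a * b by rewrite lt_neqAle eq_sym ab mulr_ge0.
exists ((cosh u * cosh v - cosh l) / (a * b)); split.
- by rewrite ler_pdivlMr//; lra.
- by rewrite ler_pdivrMr//; lra.
- by rewrite -mulrA divfK ?gt_eqF//; lra.
Qed.

Definition vertices {T : Type} (x0 x1 x2 : T) (i : 'I_3) : T :=
  match val i with 0%N => x0 | 1%N => x1 | _ => x2 end.

Lemma forall_ord3 (P : 'I_3 -> Prop) :
  P (@Ordinal 3 0 isT) -> P (@Ordinal 3 1 isT) -> P (@Ordinal 3 2 isT) ->
  forall i, P i.
Proof.
by move=> P0 P1 P2 [[|[|[|//]]] Hi]; [move: P0|move: P1|move: P2];
  congr P; apply: val_inj.
Qed.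

(** The comparison triangle is drawn in polar coordinates about [o], with one side vertical, so that
    the comparison points of [p] and [q] are the truncated radii on its two sides and
    [cosine_law_contraction] applies. *)
Lemma CAT_minus1_contraction (X : metricType R) (z x y p q : X) (Sx Sy : set X) r :
  CAT_minus1 X -> 0 <= r ->
  geodesic_segment (@mdist R X) z x Sx -> geodesic_segment (@mdist R X) z y Sy ->
  Sx p -> Sy q ->
  mdist z p = Num.min r (mdist z x) -> mdist z q = Num.min r (mdist z y) ->
  expR (- r) ^+ 2 * (cosh (mdist p q) - 1) <=
  expR (- (mdist z x + mdist z y)) * (cosh (mdist x y) - 1).
Proof.
move=> [geo cat] r0 gx gy Sxp Syq zp zq.
set u := mdist z x in zp *; set v := mdist z y in zq *; set l := mdist x y.
have u0 : 0 <= u := mdist_ge0 _ _; have v0 : 0 <= v := mdist_ge0 _ _.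
have l0 : 0 <= l := mdist_ge0 _ _.
have T1 : u <= v + l by rewrite /u (le_trans (metric_triangle _ y _))// lerD2l metric_sym.
have T2 : v <= u + l by rewrite /v (le_trans (metric_triangle _ x _)).
have T3 : l <= u + v by rewrite /l (le_trans (metric_triangle _ z _))// lerD2r metric_sym.
have [c [s [cs c1 cl]]] : exists c s,
    [/\ c ^+ 2 + s ^+ 2 = 1, c <= 1 & cosine_law u v c = cosh l].
  by apply: comparison_triangle => //; rewrite ler_norml T3; lra.
have c0 : (1 : R) ^+ 2 + 0 ^+ 2 = 1 by rewrite expr1n expr0n addr0.
have i0 : (0 : R) < ((0 : R), (1 : R)).2 by [].
pose o : @hyperbolic_plane R := exist _ (0, 1) i0.
pose x' := polar o c0 u; pose y' := polar o cs v.
have xy' : hyperbolic_dist x' y' = l.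
  by rewrite hyperbolic_dist_polar mul1r mul0r addr0 cl arcosh_cosh.
have D0 t : 0 <= t -> hyperbolic_dist o (polar o c0 t) = t.
  by move=> t0; rewrite -{1}(polar0 o c0) hyperbolic_dist_polar_same sub0r normrN ger0_norm.
have D1 t : 0 <= t -> hyperbolic_dist o (polar o cs t) = t.
  by move=> t0; rewrite -{1}(polar0 o cs) hyperbolic_dist_polar_same sub0r normrN ger0_norm.
have [S1 gS1] := geo x y.
have [S1' gS1'] := geodesic_hyperbolic_plane x' y'.
(* The third side of a triangle runs from [y] back to [z], whereas [Sy] is given from [z]. *)
have gyz : geodesic_segment (@mdist R X) y z Sy.
  by apply: geodesic_segment_sym => //; exact: metric_sym.
have gyz' : geodesic_segment hyperbolic_dist y' o (polar o cs @` `[0, v]).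
  apply: geodesic_segment_sym; rewrite ?hyperbolic_dist_ge0 1?hyperbolic_distC//.
  exact: geodesic_segment_polar.
have u'0 : 0 <= Num.min r u by rewrite le_min r0.
have v'0 : 0 <= Num.min r v by rewrite le_min r0.
have := cat (vertices z x y) (vertices Sx S1 Sy) (vertices o x' y')
  (vertices (polar o c0 @` `[0, u]) S1' (polar o cs @` `[0, v])).
move=> /(_ _ _ _ (@Ordinal 3 0 isT) (@Ordinal 3 2 isT) p q
  (polar o c0 (Num.min r u)) (polar o cs (Num.min r v))) H.
have {H} : mdist p q <= hyperbolic_dist (polar o c0 (Num.min r u)) (polar o cs (Num.min r v)).
  apply: H => //.
  - exact: forall_ord3.
  - by apply: forall_ord3 => //; exact: geodesic_segment_polar.
  - apply: forall_ord3; rewrite /vertices/=.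
    + exact: D0.
    + exact: xy'.
    + by rewrite hyperbolic_distC D1// metric_sym.
  - exists (Num.min r u) => //; rewrite /= in_itv/= u'0 ge_min lexx orbT//.
  - by rewrite /vertices/= D0// zp.
  - exists (Num.min r v) => //; rewrite /= in_itv/= v'0 ge_min lexx orbT//.
  - rewrite /vertices/= hyperbolic_dist_polar_same.
    have [_] := geodesic_segment_end gy Syq v0.
    rewrite metric_sym => ->; rewrite zq ger0_norm// subr_ge0 ge_min lexx orbT//.
rewrite hyperbolic_dist_polar mul1r mul0r addr0 => Hpq.
rewrite -cl; apply: le_trans (cosine_law_contraction r0 u0 v0 c1).
rewrite ler_wpM2l ?sqr_ge0// lerD2r -[leRHS]cosh_arcosh ?cosine_law_ge1//.
by rewrite ler_cosh ?nnegrE ?mdist_ge0// (le_trans _ Hpq)// mdist_ge0.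
Qed.

End Comparison.

(** * Gromov hyperbolicity *)

(** Absorbs the error [c] made when a point of the four-point inequality is replaced by the
    basepoint of [b]. *)
Lemma min_shift {R : realDomainType} (a b a' b' c r r' k : R) :
  Num.min a b - k <= r -> a' <= a + c -> b' <= b + c -> r + c <= r' ->
  Num.min a' b' - k <= r'.
Proof.
by case: (leP a b) => ?; case: (leP a' b') => ? ? ? ? ?; lra.
Qed.

Section Hyperbolicity.
Context {R : realType} {X : metricType R}.
Hypothesis catX : CAT_minus1 X.
Local Notation d := (@mdist R X).
Implicit Types (x y z w p : X) (b : X -> R) (r s e : R).

(** [pi x] is taken at distance min(r, |xz|) from [z] on a chosen geodesic from [z] to [x]. The 4 is
    the square root of 16, from t^2 <= 8 (cosh t - 1) for the retracted points and cosh t - 1 = 2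
    sinh(t/2)^2 for the original ones. *)
Lemma CAT_minus1_retraction z r : 0 <= r -> exists pi : X -> X,
  (forall x, d (pi x) x = d x z - Num.min r (d x z)) /\
  (forall x y, expR (- r) * d (pi x) (pi y) <=
     4 * (expR (- ((d x z + d y z) / 2)) * sinh (d x y / 2))).
Proof.
move=> r0; have [geo _] := catX.
have /choice[pi piP] x : exists p, exists S,
    [/\ geodesic_segment d z x S, S p & d z p = Num.min r (d z x)].
  have [S gS] := geo z x.
  have [|p Sp zp] := @geodesic_segment_point _ _ _ z x S (Num.min r (d z x)) gS.
    by rewrite ge_min lexx orbT andbT le_min r0 mdist_ge0.
  by exists p, S.
exists pi; split=> [x|x y].
  have [S [gS Sp zp]] := piP x.
  have [_ ->] := geodesic_segment_end gS Sp (mdist_ge0 _ _).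
  by rewrite zp (metric_sym z x).
have [Sx [gSx Spx zpx]] := piP x; have [Sy [gSy Spy zpy]] := piP y.
have := CAT_minus1_contraction catX r0 gSx gSy Spx Spy zpx zpy.
rewrite (coshB1 (d x y)) (metric_sym z x) (metric_sym z y).
have := sqr_le_cosh (d (pi x) (pi y)).
move: (cosh (d (pi x) (pi y)) - 1) => C D2.
have -> : expR (- (d x z + d y z)) = expR (- ((d x z + d y z) / 2)) ^+ 2.
  by rewrite -expRM_natr; congr expR; field.
have S0 : 0 <= sinh (d x y / 2) by rewrite sinh_ge0// divr_ge0 ?mdist_ge0.
move: (sinh _) S0 => S S0 H; rewrite -(@ler_pXn2r _ 2)// ?nnegrE.
- rewrite !exprMn; apply: (@le_trans _ _ (8 * (expR (- r) ^+ 2 * C))).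
    by rewrite [leRHS]mulrCA ler_wpM2l ?sqr_ge0.
  move: H; move: (expR (- r) ^+ 2 * C) (expR _ ^+ 2) => A W; lra.
- by rewrite mulr_ge0 ?expR_ge0 ?mdist_ge0.
- by rewrite !mulr_ge0 ?expR_ge0.
Qed.

Lemma sinh_half_le z x y :
  4 * (expR (- ((d x z + d y z) / 2)) * sinh (d x y / 2)) <=
  2 * expR (- gromov_product_at z x y).
Proof.
have -> : - gromov_product_at z x y = - ((d x z + d y z) / 2) + d x y / 2.
  by rewrite /gromov_product_at /gromov_product; lra.
rewrite expRD /sinh.
have := expR_gt0 (- ((d x z + d y z) / 2)); have := expR_gt0 (- (d x y / 2)).
nra.
Qed.

Lemma gromov_product_at_ge0 z x y : 0 <= gromov_product_at z x y.
Proof.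
rewrite /gromov_product_at /gromov_product divr_ge0// subr_ge0.
by rewrite (metric_sym y z) metric_triangle.
Qed.

(** If both points lie outside the ball, moving them inwards leaves a distance of at least |xy| -
    (|xz| - r) - (|yz| - r) = 2. If only one does, what is left is at least 1 by the triangle
    inequality; if neither does, nothing moves. *)
Lemma retraction_separates z x y (pi : X -> X) :
  let r := gromov_product_at z x y + 1 in
  (forall x, d (pi x) x = d x z - Num.min r (d x z)) ->
  Num.min 1 (d x y) <= d (pi x) (pi y).
Proof.
move=> r piP; have := piP x; have := piP y.
have := metric_triangle x (pi x) y; have := metric_triangle (pi x) (pi y) y.
rewrite (metric_sym x (pi x)).
have := metric_triangle x y z; have := metric_triangle y x z.
rewrite (metric_sym y x) /r /gromov_product_at /gromov_product.
move: (d (pi x) (pi y)) (d (pi x) x) (d (pi y) y) (d (pi x) y) => a b c e.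
move: (d x y) (d x z) (d y z) => l u v ? ? ? ?.
by case: (leP _ u) => ?; case: (leP _ v) => ?; case: (leP 1 l) => ? ? ?; lra.
Qed.

(** The 3 is the excess 1 of the radius over (x|y)_z, plus 2 from 4 <= e^2. *)
Lemma gromov_hyperbolic z x y w :
  Num.min (gromov_product_at z x w) (gromov_product_at z w y) - 3 <=
  gromov_product_at z x y.
Proof.
set m := Num.min _ _.
have mx : m <= d x z.
  rewrite ge_min; apply/orP; left; rewrite /gromov_product_at /gromov_product.
  by have := metric_triangle w x z; rewrite (metric_sym w x); lra.
have [l1|l1] := ltP (d x y) 1.
  rewrite /gromov_product_at /gromov_product.
  by have := metric_triangle x y z; lra.
set h := gromov_product_at z x y.
have r0 : 0 <= h + 1 by rewrite addr_ge0 ?gromov_product_at_ge0.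
have [pi [piP piL]] := CAT_minus1_retraction z r0.
have := retraction_separates piP; rewrite min_l// => sep.
have H : expR (- (h + 1)) <= 2 * expR (- gromov_product_at z x w) +
    2 * expR (- gromov_product_at z w y).
  apply: (@le_trans _ _ (expR (- (h + 1)) * d (pi x) (pi y))).
    by rewrite ler_peMr ?expR_ge0.
  apply: (@le_trans _ _ (expR (- (h + 1)) * (d (pi x) (pi w) + d (pi w) (pi y)))).
    by rewrite ler_wpM2l ?expR_ge0 ?metric_triangle.
  by rewrite mulrDr lerD// (le_trans (piL _ _))// sinh_half_le.
have [mE mE'] : expR (- gromov_product_at z x w) <= expR (- m) /\
    expR (- gromov_product_at z w y) <= expR (- m).
  by rewrite !ler_expR !lerN2 !ge_min !lexx orbT.
have : expR (- (h + 1)) <= expR (2 - m).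
  apply: (@le_trans _ _ (4 * expR (- m))); first by lra.
  rewrite expRD ler_wpM2r ?expR_ge0// (_ : 2 = 1 + 1)// expRD.
  by have := expR_ge1Dx (1 : R); nra.
rewrite ler_expR; lra.
Qed.

(* Common abstraction of distance functions and Busemann functions: b is
   an infimum of translated distance functions, attained up to e simultaneously
   at any three given points. *)
Definition distance_approximable b := forall x y w e, 0 < e -> exists z s,
  [/\ forall p, b p <= d p z + s, d x z + s <= b x + e, d y z + s <= b y + e &
      d w z + s <= b w + e].

(* With b = b_omega, this is (x|omega)_p. *)
Definition gromov_product_end b p x : R := (b p + d x p - b x) / 2.

Section Approximable.
Variable b : X -> R.
Hypothesis bP : distance_approximable b.

Lemma approximable_lipschitz x y : b x <= b y + d x y.
Proof.
apply/ler_addgt0Pr => e e0; have [z [s [bz _ yz _]]] := bP x y x e0.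
by have := bz x; have := metric_triangle x y z; lra.
Qed.

Lemma gromov_product_le x y : gromov_product b x y <= b x.
Proof. by rewrite /gromov_product; have := approximable_lipschitz y x; rewrite metric_sym; lra. Qed.

Lemma gromov_productC x y : gromov_product b x y = gromov_product b y x.
Proof. by rewrite /gromov_product metric_sym; lra. Qed.

(** The four-point inequality with [z] in place of the basepoint of [b]. One [z] has to serve [x],
    [y] and [p], which is why the approximation is required at three points at once. *)
Lemma gromov_product_at_end_hyperbolic p x y :
  Num.min (gromov_product_end b p x) (gromov_product_end b p y) - 3 <=
  gromov_product_at p x y.
Proof.
apply/ler_addgt0Pr => e e0; have [z [s [bz xz yz pz]]] := bP x y p e0.
move: (bz x) (bz y) (bz p) => bx by_ bp.
apply: (min_shift (c := e) (gromov_hyperbolic p x y z));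
  rewrite /gromov_product_end /gromov_product_at /gromov_product;
  by rewrite ?(metric_sym z p) ?(metric_sym z y); lra.
Qed.

Lemma gromov_product_end_hyperbolic p x y :
  Num.min (gromov_product_at p x y) (gromov_product_end b p y) - 3 <=
  gromov_product_end b p x.
Proof.
apply/ler_addgt0Pr => e e0; have [z [s [bz xz yz pz]]] := bP x y p e0.
move: (bz x) (bz y) (bz p) => bx by_ bp.
apply: (min_shift (c := e / 2) (gromov_hyperbolic p x z y));
  rewrite /gromov_product_end /gromov_product_at /gromov_product;
  by rewrite ?(metric_sym z p); lra.
Qed.

(** Links products based at [b], which govern d_{1,b}, with products at a point, which define the
    Gromov boundary; they are comparable along sequences on which [gromov_product_end] stays
    bounded. *)
Lemma gromov_product_endE p x y : gromov_product b x y =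
  gromov_product_at p x y - gromov_product_end b p x - gromov_product_end b p y + b p.
Proof.
by rewrite /gromov_product_end /gromov_product_at /gromov_product; lra.
Qed.

Lemma gromov_product_end_ge0 p x : 0 <= gromov_product_end b p x.
Proof.
by have H := approximable_lipschitz x p; rewrite divr_ge0//; lra.
Qed.

Lemma gromov_product_at_ge p x y :
  gromov_product b x y - b p <= gromov_product_at p x y.
Proof.
have := gromov_product_endE p x y.
by have := gromov_product_end_ge0 p x; have := gromov_product_end_ge0 p y; lra.
Qed.

(** As [w] lies between [x] and [y], (x|y)_w = 0, so (x|z)_w or (z|y)_w is at most 3. This says that
    the distance to [z], hence [b], grows at unit speed from [w] towards [x] or [y], up to 6. *)
Lemma approximable_between x w y : d x y = d x w + d w y ->
  b w - 6 <= b x - d x w \/ b w - 6 <= b y - d w y.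
Proof.
move=> xwy; case: (leP (b w - 6) (b x - d x w)) => H; first by left.
right; apply/ler_addgt0Pr => e e0.
(* The first alternative fails by a positive gap; an error of at most half that gap keeps it false
   for the approximation. *)
have e'0 : 0 < Num.min e ((b w - 6 - (b x - d x w)) / 2).
  by rewrite lt_min e0 divr_gt0// subr_gt0.
have [z [s [bz xz yz wz]]] := bP x y w e'0.
have e'e : Num.min e ((b w - 6 - (b x - d x w)) / 2) <= e by rewrite ge_min lexx.
have e'H : Num.min e ((b w - 6 - (b x - d x w)) / 2) <= (b w - 6 - (b x - d x w)) / 2.
  by rewrite ge_min lexx orbT.
have := gromov_hyperbolic w x y z.
move: (bz x) (bz y) (bz w) => bx by_ bw; rewrite lerBlDr ge_min.
rewrite /gromov_product_at /gromov_product xwy.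
rewrite (metric_sym w y) (metric_sym z w) (metric_sym z y).
by case/orP; lra.
Qed.

End Approximable.

End Hyperbolicity.

(** * Busemann functions as infima of distance functions *)

Section Busemann.
Context {R : realType} {X : metricType R}.
Local Notation d := (@mdist R X).
Implicit Types (x y z w p : X) (b : X -> R) (gamma : R -> X) (s t e : R).

Lemma geodesic_rayE gamma s t : geodesic_ray gamma -> 0 <= s -> 0 <= t ->
  d (gamma s) (gamma t) = `|s - t|.
Proof. by move=> [_ _ gE] s0 t0; rewrite gE//= in_itv/= ?s0 ?t0. Qed.

(** By the triangle inequality d (gamma t) x - t is nonincreasing and bounded below by - d (gamma 0)
    x, so its limit is its infimum. The second part holds for all large [t], so that one parameter
    can serve several points. *)
Lemma busemannP gamma x : geodesic_ray gamma ->
  (forall t, 0 <= t -> busemann gamma x <= d (gamma t) x - t) /\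
  (forall e, 0 < e -> exists2 T, 0 <= T &
     forall t, T <= t -> d (gamma t) x - t <= busemann gamma x + e).
Proof.
move=> ray; pose f t := d (gamma t) x - t.
have fmono s t : 0 <= s -> s <= t -> f t <= f s.
  move=> s0 st; have t0 := le_trans s0 st.
  have := metric_triangle (gamma t) (gamma s) x.
  by rewrite geodesic_rayE// ger0_norm ?subr_ge0// /f; lra.
have inff : has_inf (f @` [set t | 0 <= t]).
  split; first by exists (f 0), 0 => /=.
  exists (- d (gamma 0) x) => _ [t /= t0 <-].
  have := metric_triangle (gamma t) x (gamma 0).
  by rewrite geodesic_rayE// subr0 ger0_norm// (metric_sym x) /f; lra.
set m := inf (f @` [set t | 0 <= t]).
have lo t : 0 <= t -> m <= f t by move=> t0; apply: ge_inf; [case: inff|exists t].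
have up e : 0 < e -> exists2 T, 0 <= T & forall t, T <= t -> f t <= m + e.
  move=> e0; have [_ [T /= T0 <-] fT] := inf_adherent e0 inff.
  by exists T => // t Tt; rewrite (le_trans (fmono _ _ T0 Tt))// ltW.
have -> : busemann gamma x = m.
  apply/cvg_lim => //; apply/cvgrPdist_le => e e0.
  have [T T0 fT] := up e e0.
  near=> t; have Tt : T <= t by near: t; apply: nbhs_pinfty_ge; exact: num_real.
  have := fT t Tt; have := lo t (le_trans T0 Tt).
  by rewrite -/(f t) ler_norml => ? ?; apply/andP; split; lra.
by [].
Unshelve. all: by end_near.
Qed.

Lemma busemann_ray gamma t : geodesic_ray gamma -> 0 <= t -> busemann gamma (gamma t) = - t.
Proof.
move=> ray t0; have [lo up] := busemannP (gamma t) ray.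
apply/eqP; rewrite eq_le; apply/andP; split.
  by have := lo t t0; rewrite mdistxx sub0r.
apply/ler_addgt0Pr => e /up[T T0 /(_ (Num.max T t))].
rewrite le_max lexx => /(_ isT); rewrite geodesic_rayE ?le_max ?T0//.
by rewrite ger0_norm ?subr_ge0 ?le_max ?lexx ?orbT//; lra.
Qed.

Lemma has_basepoint_approximable b omega : has_basepoint b omega ->
  distance_approximable b.
Proof.
case: omega => [z|xi] /=.
  by move=> [s ->] x y w e e0; exists z, s; split=> //; lra.
move=> [gamma [s [ray -> _]]] x y w e e0.
have [_ /(_ _ e0)[Tx Tx0 upx]] := busemannP x ray.
have [_ /(_ _ e0)[Ty Ty0 upy]] := busemannP y ray.
have [_ /(_ _ e0)[Tw Tw0 upw]] := busemannP w ray.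
pose T := Num.max Tx (Num.max Ty Tw).
exists (gamma T), (s - T); split=> [p|||].
- have [lo _] := busemannP p ray.
  have /lo : 0 <= T by rewrite le_max Tx0.
  by rewrite (metric_sym p); lra.
- have /upx : Tx <= T by rewrite le_max lexx.
  by rewrite (metric_sym x); lra.
- have /upy : Ty <= T by rewrite !le_max lexx orbT.
  by rewrite (metric_sym y); lra.
- have /upw : Tw <= T by rewrite !le_max lexx !orbT.
  by rewrite (metric_sym w); lra.
Qed.

Lemma extended_busemann_basepoint b : extended_busemann_functions b ->
  exists omega, has_basepoint b omega.
Proof. by move=> [[xi]|[z]] bo; [exists (AtInfinity xi)|exists (Inside z)]. Qed.

End Busemann.

(** * Straddle primitives and costs of Lipschitz paths *)

Section Straddle.
Context {R : realType}.
Implicit Types (l s t u e : R) (F G K N : R -> R).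

Definition straddles l u eta s t : Prop :=
  [/\ 0 <= s, s <= u, u <= t, t <= l & u - s < eta /\ t - u < eta].

(* N' = G on [0, l], as a straddle derivative: no one-sided derivatives at the
   end points, and N may be glued or reparametrized freely. *)
Definition primitive_on l G N := forall u e, 0 <= u <= l -> 0 < e ->
  exists2 eta, 0 < eta & forall s t, straddles l u eta s t ->
    `|N t - N s - G u * (t - s)| <= e * (t - s).

(** Let [u] be the supremum of the points where K is at most K 0. The local hypothesis at [u], used
    with a right end equal to [u], puts [u] in this set; used with left end [u], it puts a larger
    point there unless u = l. Continuity of [K] is replaced by the fact that straddling pairs may
    have [u] as an end point. *)
Lemma straddle_nonincreasing l K : 0 <= l ->
  (forall u, 0 <= u <= l -> exists2 eta, 0 < eta &
    forall s t, straddles l u eta s t -> K t <= K s) ->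
  K l <= K 0.
Proof.
move=> l0 loc; pose A := [set t | 0 <= t <= l /\ K t <= K 0].
have supA : has_sup A.
  split; first by exists 0; split; rewrite /= ?lexx ?l0.
  by exists l => t [/andP[]].
set u := sup A.
have u0 : 0 <= u by apply: ub_le_sup; [case: supA|split; rewrite /= ?lexx ?l0].
have ul : u <= l by apply: ge_sup; [case: supA|move=> t [/andP[]]].
have [eta eta0 H] := loc u ltac:(by rewrite u0 ul).
have [s [/andP[s0 sl] Ks] us] := sup_adherent eta0 supA.
have su : s <= u by apply: ub_le_sup; [case: supA|split=> //; rewrite s0].
have Au : K u <= K 0.
  apply: le_trans (H s u _) Ks.
  by rewrite -/u in us; split=> //; split; lra.
have [->//|ltul] := eqVneq l u.
pose t := Num.min l (u + eta / 2).
have ut : u < t by rewrite lt_min lt_neqAle eq_sym ltul ul/= ltrDl divr_gt0.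
have tl : t <= l by rewrite ge_min lexx.
have tu : t <= u + eta / 2 by rewrite ge_min lexx orbT.
suff : t <= u by rewrite leNgt ut.
apply: ub_le_sup; [by case: supA|split; first by apply/andP; split; lra].
apply: le_trans (H u t _) Au.
by split; [exact: u0|exact: lexx|exact: ltW|exact: tl|split; lra].
Qed.

(** [F] needs only an upper bound on its increments, so it may be a distance to a fixed point, with
    no derivative. *)
Lemma primitive_on_ge l F G N : 0 <= l -> primitive_on l G N ->
  (forall u e, 0 <= u <= l -> 0 < e -> exists2 eta, 0 < eta &
    forall s t, straddles l u eta s t -> F t - F s <= (G u + e) * (t - s)) ->
  F l - F 0 <= N l - N 0.
Proof.
move=> l0 NG FG; apply/ler_addgt0Pr => e e0.
(* Each of [F] and [N] contributes e' per unit length; dividing by l + 1 allows l = 0. *)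
pose e' := e / (2 * (l + 1)).
have e'0 : 0 < e' by rewrite divr_gt0// mulr_gt0// ltr_wpDl.
suff : F l - N l - 2 * e' * l <= F 0 - N 0 - 2 * e' * 0.
  have : 2 * e' * l <= e.
    have -> : 2 * e' * l = e * (l / (l + 1)) by rewrite /e'; field; rewrite gt_eqF// ltr_wpDl.
    by rewrite ler_piMr ?(ltW e0)// ler_pdivrMr ?mul1r ?lerDl// ltr_wpDl.
  lra.
apply: (straddle_nonincreasing (K := fun t => F t - N t - 2 * e' * t)) => // u ul.
have [eta1 eta10 H1] := NG u e' ul e'0.
have [eta2 eta20 H2] := FG u e' ul e'0.
exists (Num.min eta1 eta2); first by rewrite lt_min eta10.
move=> s t [s0 su ut tl]; rewrite !lt_min => -[/andP[a1 a2] /andP[a3 a4]].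
have /ler_normlP[+ _] : `|N t - N s - G u * (t - s)| <= e' * (t - s) by apply: H1.
have : F t - F s <= (G u + e') * (t - s) by apply: H2.
nra.
Qed.

Lemma eq_primitive_on l G G' N N' :
  (forall u, 0 <= u <= l -> G u = G' u) -> (forall u, 0 <= u <= l -> N u = N' u) ->
  primitive_on l G N -> primitive_on l G' N'.
Proof.
move=> GG' NN' H u e ul e0; have [eta eta0 {}H] := H u e ul e0.
exists eta => // s t st; have := H s t st; rewrite GG'//.
by case: st => s0 su ut tl _; rewrite !NN'//; apply/andP; split=> //; lra.
Qed.

Lemma primitive_on_rev l G N : primitive_on l G N ->
  primitive_on l (fun u => G (l - u)) (fun u => - N (l - u)).
Proof.
move=> H u e /andP[u0 ul] e0; have [|//|eta eta0 {}H] := H (l - u) e.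
  by apply/andP; split; lra.
exists eta => // s t [s0 su ut tl [us tu]].
have := H (l - t) (l - s) => /(_ _); have -> : l - s - (l - t) = t - s by ring.
have -> : - N (l - t) - - N (l - s) = N (l - s) - N (l - t) by ring.
by apply; split; try split; lra.
Qed.

Lemma primitive_on_cat l1 l2 G1 N1 G2 N2 : 0 <= l1 -> 0 <= l2 ->
  G1 l1 = G2 0 -> primitive_on l1 G1 N1 -> primitive_on l2 G2 N2 ->
  primitive_on (l1 + l2) (fun u => if u <= l1 then G1 u else G2 (u - l1))
    (fun u => if u <= l1 then N1 u else N1 l1 + (N2 (u - l1) - N2 0)).
Proof.
move=> l10 l20 G12 H1 H2 u e /andP[u0 ul] e0.
have [ul1|l1u|ul1] := ltgtP u l1.
- have [|//|eta eta0 H] := H1 u e; first by rewrite u0 ltW.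
  exists (Num.min eta (l1 - u)); first by rewrite lt_min eta0 subr_gt0.
  move=> s t [s0 su ut tl]; rewrite !lt_min => -[/andP[a1 a2] /andP[a3 a4]].
  rewrite (le_trans su (ltW ul1)).
  have -> : t <= l1 by lra.
  by apply: H; split=> //; lra.
- have [|//|eta eta0 H] := H2 (u - l1) e; first by apply/andP; split; lra.
  exists (Num.min eta (u - l1)); first by rewrite lt_min eta0 subr_gt0.
  move=> s t [s0 su ut tl]; rewrite !lt_min => -[/andP[a1 a2] /andP[a3 a4]].
  have /negbTE -> : ~~ (t <= l1) by rewrite -ltNge; lra.
  have /negbTE -> : ~~ (s <= l1) by rewrite -ltNge; lra.
  have -> : N1 l1 + (N2 (t - l1) - N2 0) - (N1 l1 + (N2 (s - l1) - N2 0)) =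
    N2 (t - l1) - N2 (s - l1) by ring.
  have -> : t - s = t - l1 - (s - l1) by ring.
  by apply: H; split; try split; lra.
(* At the junction the pair (s, t) is cut at [l1] and the two estimates are added; their slopes
   agree by [G12]. *)
- have [|//|eta1 eta10 {}H1] := H1 l1 e; first by rewrite l10/=.
  have [|//|eta2 eta20 {}H2] := H2 0 e; first by rewrite lexx.
  exists (Num.min eta1 eta2); first by rewrite lt_min eta10.
  move=> s t [s0 su ut tl]; rewrite ul1 !lt_min in su ut * => -[/andP[a1 a2] /andP[a3 a4]].
  rewrite su; have {}H1 : `|N1 l1 - N1 s - G1 l1 * (l1 - s)| <= e * (l1 - s).
    by apply: H1; split=> //; lra.
  have [tl1|tl1] := leP t l1.
    by have -> : t = l1 by lra.
  have {}H2 : `|N2 (t - l1) - N2 0 - G2 0 * (t - l1 - 0)| <= e * (t - l1 - 0).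
    by apply: H2; split; try split; lra.
  move: H1 H2; rewrite G12 !ler_norml => /andP[? ?] /andP[? ?].
  by apply/andP; split; lra.
Qed.

(** Its derivative e^{-t} / (1 + e^{-t})^2 is comparable to e^{-|t|}, so this bounded function
    replaces a primitive of e^{-|t|} that would have to be defined piecewise. *)
Definition sigmoid t : R := (1 + expR (- t))^-1.

Lemma sigmoid_itv t : 0 <= sigmoid t <= 1.
Proof.
have E := expR_gt0 (- t).
by rewrite /sigmoid invr_ge0 addr_ge0 ?(ltW E)//= invf_le1 ?lerDl ?(ltW E)// addr_gt0.
Qed.

(** Within 1/4 of [u], exponentials change by a factor of at most 2, so the exact increment (e^t -
    e^s) / ((1 + e^t)(1 + e^s)) can be compared with its value at [u]. The 12 is needed for u < 0,
    where the denominator is at most 6 and e^u <= 2 e^s. *)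
Lemma sigmoid_straddle s u t : s <= u -> u <= t -> u - s < 4^-1 -> t - u < 4^-1 ->
  expR (- `|u|) * (t - s) <= 12 * (sigmoid t - sigmoid s).
Proof.
move=> su ut us tu.
have sE x : sigmoid x = expR x / (1 + expR x).
  rewrite /sigmoid expRN; have := expR_gt0 x; move: (expR x) => E E0.
  by field; rewrite !gt_eqF ?addr_gt0.
have EF : expR s * (t - s) <= expR t - expR s.
  have -> : expR t = expR s * expR (t - s) by rewrite -expRD subrKC.
  have := expR_ge1Dx (t - s); have := expR_gt0 s; nra.
have U0 := expR_gt0 u.
have FU : expR s <= expR u by rewrite ler_expR.
have UF : expR u / 2 <= expR s.
  have -> : expR s = expR u * expR (s - u) by rewrite -expRD subrKC.
  by have := expR_ge1Dx (s - u); nra.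
have EU : expR t <= 2 * expR u.
  have -> : expR u = expR t * expR (u - t) by rewrite -expRD subrKC.
  by have := expR_ge1Dx (u - t); have := expR_gt0 t; nra.
have -> : 12 * (sigmoid t - sigmoid s) =
    12 * (expR t - expR s) / ((1 + expR t) * (1 + expR s)).
  rewrite !sE; have := expR_gt0 t; have := expR_gt0 s.
  by move: (expR t) (expR s) => E F F0 E0; field; rewrite !gt_eqF ?addr_gt0.
rewrite ler_pdivlMr ?mulr_gt0 ?addr_gt0 ?expR_gt0//.
have key : expR (- `|u|) * ((1 + expR t) * (1 + expR s)) <= 12 * expR s.
  case: (ger0P u) => u0.
    have V1 : expR u * expR (- u) = 1 := expRxMexpNx_1 u.
    have U1 : 1 <= expR u by have := expR_ge1Dx u; lra.
    have V0 := expR_gt0 (- u).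
    have B1 : (1 + expR t) * (1 + expR s) <= 3 * expR u * (3 * expR s).
      by rewrite ler_pM ?addr_ge0 ?expR_ge0//; lra.
    apply: le_trans (ler_wpM2l (ltW V0) B1) _.
    rewrite !mulrA (mulrC _ 3) -mulrA (mulrC (expR (- u))) -!mulrA; nra.
  rewrite opprK; have U1 : expR u <= 1 by rewrite -expR0 ler_expR ltW.
  have B1 : (1 + expR t) * (1 + expR s) <= 3 * 2.
    by rewrite ler_pM ?addr_ge0 ?expR_ge0//; lra.
  apply: le_trans (ler_wpM2l (ltW U0) B1) _; lra.
have ts : 0 <= t - s by lra.
rewrite mulrAC; apply: le_trans (ler_wpM2r ts key) _.
rewrite -mulrA; lra.
Qed.

End Straddle.

Section PathCost.
Context {R : realType} {X : metricType R}.
Local Notation d := (@mdist R X).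
Implicit Types (x y z w p : X) (b rho : X -> R) (f gamma : R -> X) (l c s t e : R).

Definition lipschitz_path l f := forall s t, 0 <= s <= l -> 0 <= t <= l ->
  d (f s) (f t) <= `|s - t|.

(* c is the integral of rho o f along a 1-Lipschitz path f from x to y. *)
Definition path_cost rho x y c := exists l f N,
  [/\ 0 <= l, lipschitz_path l f, f 0 = x, f l = y &
      primitive_on l (rho \o f) N /\ c = N l - N 0].

Lemma path_cost_sym rho x y c : path_cost rho x y c -> path_cost rho y x c.
Proof.
move=> [l [f [N [l0 fL f0 fl [Nf ->]]]]].
exists l, (fun u => f (l - u)), (fun u => - N (l - u)); split=> //.
- move=> s t /andP[s0 sl] /andP[t0 tl].
  have -> : `|s - t| = `|l - s - (l - t)| by rewrite distrC; congr `|_|; ring.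
  by apply: fL; apply/andP; split; lra.
- by rewrite subr0.
- by rewrite subrr.
- by split; [exact: (primitive_on_rev Nf)|rewrite subr0 subrr; ring].
Qed.

Lemma path_cost_cat rho x y z c c' : path_cost rho x y c -> path_cost rho y z c' ->
  path_cost rho x z (c + c').
Proof.
move=> [l1 [f1 [N1 [l10 L1 f10 f1l [P1 ->]]]]] [l2 [f2 [N2 [l20 L2 f20 f2l [P2 ->]]]]].
exists (l1 + l2), (fun u => if u <= l1 then f1 u else f2 (u - l1)),
  (fun u => if u <= l1 then N1 u else N1 l1 + (N2 (u - l1) - N2 0)); split.
- exact: addr_ge0.
- suff H s t : 0 <= s -> s <= t -> t <= l1 + l2 ->
    d (if s <= l1 then f1 s else f2 (s - l1)) (if t <= l1 then f1 t else f2 (t - l1))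
    <= t - s.
    move=> s t /andP[s0 sl] /andP[t0 tl]; case: (leP s t) => st.
      by rewrite distrC ger0_norm ?subr_ge0//; exact: H.
    by rewrite metric_sym ger0_norm ?subr_ge0 ?(ltW st)//; apply: H; rewrite ?(ltW st).
  move=> s0 st tl; case: (leP t l1) => tl1.
    rewrite (le_trans st tl1); have := L1 s t ltac:(by apply/andP; split; lra) ltac:(by apply/andP; split; lra).
    by rewrite distrC ger0_norm ?subr_ge0.
  case: (leP s l1) => sl1; last first.
    have := L2 (s - l1) (t - l1) ltac:(by apply/andP; split; lra) ltac:(by apply/andP; split; lra).
    by rewrite distrC ger0_norm; lra.
  have := metric_triangle (f1 s) (f1 l1) (f2 (t - l1)); rewrite {2}f1l -f20.
  have := L1 s l1 ltac:(by rewrite s0 sl1) ltac:(by rewrite l10 lexx).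
  have := L2 0 (t - l1) ltac:(by rewrite lexx l20) ltac:(by apply/andP; split; lra).
  by rewrite sub0r normrN ger0_norm ?subr_ge0 ?(ltW tl1)// distrC ger0_norm ?subr_ge0//; lra.
- by rewrite l10.
- case: (leP (l1 + l2) l1) => [l20'|_]; last by rewrite addrAC subrr add0r.
  have l2E : l2 = 0 by lra.
  by rewrite l2E addr0 f1l -f2l l2E f20.
split.
  apply: eq_primitive_on (primitive_on_cat l10 l20 _ P1 P2).
  - by move=> u _ /=; case: ifP.
  - by [].
  - by rewrite /= f1l f20.
rewrite l10; case: (leP (l1 + l2) l1) => [l20'|_]; last by rewrite (addrAC l1) subrr add0r; ring.
have l2E : l2 = 0 by lra.
by rewrite l2E addr0; ring.
Qed.

Lemma path_cost_ge0 rho x y c : (forall x, 0 < rho x) -> path_cost rho x y c -> 0 <= c.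
Proof.
move=> rho0 [l [f [N [l0 _ _ _ [NP ->]]]]].
have := @primitive_on_ge _ l (fun=> 0) (rho \o f) N l0 NP.
rewrite /= subrr; apply=> u e ul e0.
exists 1 => // s t [? ? ? ? _]; rewrite mulr_ge0//; last by lra.
by rewrite addr_ge0 ?(ltW e0)// ltW//=.
Qed.

Section Approximable.
Variable b : X -> R.
Hypothesis catX : CAT_minus1 X.
Hypothesis bP : distance_approximable b.

(* The pseudodistance d (pi x) (pi y), where pi is the radial retraction onto
   a ball about the approximating point z, is dominated infinitesimally by
   rho ds and separates x from y at the scale of their Gromov product. *)
Lemma path_cost_ge x y c : path_cost (rho1 b) x y c ->
  expR (- 2) / 4 * (expR (- gromov_product b x y) * Num.min 1 (d x y)) <= c.
Proof.
move=> [l [f [N [l0 fL f0 fl [NP ->]]]]].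
(* A fixed error 1 is enough, at the price of a factor e^{-1} in the constant. *)
have [z [s0 [bz xz yz _]]] := bP x y x ltr01.
pose r := gromov_product_at z x y + 1.
have r0 : 0 <= r by rewrite addr_ge0 ?gromov_product_at_ge0.
have [pi [piP piL]] := CAT_minus1_retraction catX z r0.
pose F t := expR (- s0) * (expR (- r) * d (pi x) (pi (f t))) / 4.
have FN : F l - F 0 <= N l - N 0.
  apply: primitive_on_ge NP _ => // u e /andP[u0 ul] e0.
  (* Then t - s < 1/2, where e^{t-s} - 1 <= 2 (t - s). *)
  exists 4^-1 => // s t [s1 su ut tl [us tu]].
  have ts : 0 <= t - s by lra.
  have H1 : F t - F s <= expR (- s0) * (expR (- r) * d (pi (f s)) (pi (f t))) / 4.
    rewrite -mulrBl -!mulrBr ler_pM2r// ler_pM2l ?expR_gt0// ler_pM2l ?expR_gt0//.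
    by rewrite lerBlDr addrC metric_triangle.
  apply: (le_trans H1); apply: (@le_trans _ _ (rho1 b (f u) * (t - s))); last first.
    by rewrite ler_wpM2r// lerDl ltW.
  set D := d (f s) (f t).
  have Dts : D <= t - s.
    rewrite /D (le_trans (fL s t _ _))//; try by apply/andP; split; lra.
    by rewrite distrC ger0_norm.
  have D0 : 0 <= D := mdist_ge0 _ _.
  have su' : d (f u) z <= d (f s) z + (u - s).
    apply: le_trans (metric_triangle _ (f s) _) _; rewrite addrC lerD2l.
    rewrite (le_trans (fL u s _ _))//; try by apply/andP; split; lra.
    by rewrite ger0_norm; lra.
  have tu' : d (f u) z <= d (f t) z + (t - u).
    apply: le_trans (metric_triangle _ (f t) _) _; rewrite addrC lerD2l.
    rewrite (le_trans (fL u t _ _))//; try by apply/andP; split; lra.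
    by rewrite distrC ger0_norm; lra.
  have := piL (f s) (f t); rewrite -/D => H2.
  apply: (@le_trans _ _ (expR (- s0) *
      (expR (- d (f u) z + (t - s) / 2) * sinh ((t - s) / 2)))).
    rewrite -mulrA ler_pM2l ?expR_gt0// ler_pdivrMr// [leRHS]mulrC; apply: (le_trans H2).
    rewrite ler_pM2l//; apply: ler_pM; rewrite ?expR_ge0 ?sinh_ge0//.
    - lra.
    - by rewrite ler_expR; lra.
    - by rewrite /sinh ler_pM2r// lerB ?ler_expR//; lra.
  (* Passing from the mean of the heights at s and t to the height at u costs e^{(t-s)/2}, which
     merges with the sinh into (e^{t-s} - 1) / 2. *)
  have -> : expR (- d (f u) z + (t - s) / 2) * sinh ((t - s) / 2) =
      expR (- d (f u) z) * ((expR (t - s) - 1) / 2).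
    rewrite (expRD (- d (f u) z)) -mulrA; congr (_ * _); rewrite /sinh mulrA mulrBr expRxMexpNx_1.
    by rewrite -expRD -splitr.
  have E2 : (expR (t - s) - 1) / 2 <= t - s.
    have := expR_ge1Dx (- (t - s)); have := expRxMexpNx_1 (t - s).
    have : t - s < 2^-1 by lra.
    by have := expR_gt0 (t - s); nra.
  rewrite mulrA -expRD; apply: ler_pM; rewrite ?expR_ge0//.
    have := expR_ge1Dx (t - s); lra.
  by rewrite ler_expR; have := bz (f u); lra.
apply: le_trans FN; rewrite /F f0 fl mdistxx !mulr0 mul0r subr0.
have sep : Num.min 1 (d x y) <= d (pi x) (pi y) by exact: (@retraction_separates _ _ z x y pi piP).
have M0 : 0 <= Num.min 1 (d x y) by rewrite le_min ler01 mdist_ge0.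
rewrite mulrAC ler_pM2r// [leRHS]mulrA mulrA -!expRD.
apply: ler_pM; rewrite ?expR_ge0//.
rewrite ler_expR /r /gromov_product_at /gromov_product; lra.
Qed.

End Approximable.

(** The density is at most e^{-h} e^{-|a+u|}, so [sigmoid] bounds the increments of [N]. The
    tolerance taken at each point is the density itself, which doubles it: 24 is twice the 12 of
    [sigmoid_straddle]. *)
Lemma primitive_le_exp l f N b h a : 0 <= l -> primitive_on l (rho1 b \o f) N ->
  (forall u, 0 <= u <= l -> h + `|a + u| <= b (f u)) ->
  N l - N 0 <= 24 * expR (- h) * (sigmoid (a + l) - sigmoid a).
Proof.
move=> l0 NP bh; set C := 24 * expR (- h).
have C0 : 0 <= C by rewrite mulr_ge0 ?expR_ge0.
suff : N l - C * sigmoid (a + l) <= N 0 - C * sigmoid (a + 0) by rewrite addr0; lra.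
apply: (straddle_nonincreasing (K := fun u => N u - C * sigmoid (a + u))) => // u ul.
have [|eta eta0 H] := NP u (rho1 b (f u)) ul; first exact: expR_gt0.
exists (Num.min eta 4^-1); first by rewrite lt_min eta0/= invr_gt0 ltr0n.
move=> s t [s0 su ut tl]; rewrite !lt_min => -[/andP[a1 a2] /andP[a3 a4]].
have /ler_normlP[_] : `|N t - N s - (rho1 b \o f) u * (t - s)| <= rho1 b (f u) * (t - s).
  by apply: H.
have := @sigmoid_straddle R (a + s) (a + u) (a + t).
move=> /(_ ltac:(lra) ltac:(lra) ltac:(lra) ltac:(lra)) S.
have B : rho1 b (f u) <= expR (- h) * expR (- `|a + u|).
  by rewrite -expRD ler_expR; have := bh u ul; lra.
have ts : 0 <= t - s by lra.
have := ler_wpM2r ts B; have := ler_wpM2l (expR_ge0 (- h)) S.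
have -> : a + t - (a + s) = t - s by ring.
rewrite /C /=; move: (expR (- h)) (expR (- `|_|)) (sigmoid _) (sigmoid _) => *; lra.
Qed.

Lemma primitive_le_length l f N b h : 0 <= l -> primitive_on l (rho1 b \o f) N ->
  (forall u, 0 <= u <= l -> h <= b (f u)) -> N l - N 0 <= 2 * expR (- h) * l.
Proof.
move=> l0 NP bh.
suff : N l - 2 * expR (- h) * l <= N 0 - 2 * expR (- h) * 0 by lra.
apply: (straddle_nonincreasing (K := fun u => N u - 2 * expR (- h) * u)) => // u ul.
have [|eta eta0 H] := NP u (rho1 b (f u)) ul; first exact: expR_gt0.
exists eta => // s t st; have := H s t st; case: st => [s0 su ut tl _] /ler_normlP[_].
have B : rho1 b (f u) <= expR (- h) by rewrite ler_expR lerN2 bh.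
rewrite /=; nra.
Qed.

End PathCost.

(** * Arc length *)

Section PartitionSums.
Context {R : realType} {T : Type} (d : T -> T -> R).
Hypothesis dM : metric_on setT d.
Implicit Types (gamma : R -> T) (s t a c e L : R) (ts r : seq R) (I : set R).

Lemma metric_on_ge0 x y : 0 <= d x y. Proof. by case: dM => + _ _ _; exact. Qed.
Lemma metric_on_xx x : d x x = 0. Proof. by case: dM => _ + _ _ => H; exact/H. Qed.
Lemma metric_on_eq0 x y : d x y = 0 -> x = y.
Proof. by case: dM => _ + _ _ => H; exact: (H x y I I).1. Qed.
Lemma metric_on_sym x y : d x y = d y x. Proof. by case: dM => _ _ + _; exact. Qed.
Lemma metric_on_triangle y x z : d x z <= d x y + d y z.
Proof. by case: dM => _ _ _; exact. Qed.

Fixpoint polygon gamma s ts : R :=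
  if ts is t :: ts' then d (gamma s) (gamma t) + polygon gamma t ts' else 0.

Definition partition_sum gamma ts : R := if ts is t :: ts' then polygon gamma t ts' else 0.

Definition sorted_in I ts : Prop := sorted <=%R ts /\ forall t, t \in ts -> I t.

Lemma partition_sumE gamma ts :
  \sum_(0 <= i < (size ts).-1) d (gamma (nth 0 ts i)) (gamma (nth 0 ts i.+1)) =
  partition_sum gamma ts.
Proof.
case: ts => [|t ts]; first by rewrite big_geq.
rewrite [(size (t :: ts)).-1]/= /partition_sum.
elim: ts t => [|t' ts IH] t /=; first by rewrite big_geq.
by rewrite big_nat_recl//= -IH.
Qed.

Lemma polygon_cat gamma s ts t ts' :
  polygon gamma s (ts ++ t :: ts') = polygon gamma s (rcons ts t) + polygon gamma t ts'.
Proof.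
by elim: ts s => [|u ts IH] s /=; [rewrite addr0|rewrite IH addrA].
Qed.

Lemma polygon_rcons_ge gamma s ts t : polygon gamma s ts <= polygon gamma s (rcons ts t).
Proof.
by elim: ts s => [|u ts IH] s /=; rewrite ?addr0 ?metric_on_ge0 ?lerD2l.
Qed.

(** The right side is the polygon after inserting [s] and [t] between [r1] and [r2]. *)
Lemma polygon_gap gamma x r1 r2 s t :
  polygon gamma x (r1 ++ r2) <=
  polygon gamma x (rcons r1 s) + d (gamma s) (gamma t) + polygon gamma t r2.
Proof.
elim: r1 x => [|u r1 IH] x /=; last by rewrite -!addrA lerD2l !addrA.
case: r2 => [|y r2] /=; first by rewrite !addr0 addr_ge0 ?metric_on_ge0.
rewrite addr0 addrA lerD2r.
rewrite (le_trans (metric_on_triangle (gamma t) _ _))// lerD2r.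
exact: metric_on_triangle.
Qed.

Lemma sorted_gap s t x r : s <= t -> path <=%R x r -> x <= s ->
  (forall p, p \in r -> p <= s \/ t <= p) ->
  exists r1 r2, [/\ r = r1 ++ r2, forall p, p \in r1 -> p <= s &
    forall p, p \in r2 -> t <= p].
Proof.
move=> st; elim: r x => [|y r IH] x; first by exists [::], [::].
move=> xyr xs gap; have /andP[xy yr] : (x <= y) && path <=%R y r := xyr.
have [ys|ty] := gap y (mem_head _ _).
  have [p pr|r1 [r2 [-> H1 H2]]] := IH y yr ys.
    by apply: gap; rewrite in_cons pr orbT.
  exists (y :: r1), r2; split=> // p; rewrite in_cons => /predU1P[->//|]; exact: H1.
exists [::], (y :: r); split=> // p; rewrite in_cons => /predU1P[->//|pr].
apply: le_trans ty _; move: yr; rewrite (path_sortedE (@le_trans _ _)).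
by move=> /andP[/allP/(_ _ pr)].
Qed.

Lemma le_curve_length gamma I ts : sorted_in I ts ->
  ((partition_sum gamma ts)%:E <= curve_length d gamma I)%E.
Proof.
by move=> tsI; apply: ereal_sup_ubound; exists ts => //; rewrite partition_sumE.
Qed.

Lemma curve_length_le gamma I (C : \bar R) :
  (forall ts, sorted_in I ts -> ((partition_sum gamma ts)%:E <= C)%E) ->
  (curve_length d gamma I <= C)%E.
Proof.
by move=> H; apply: ge_ereal_sup => _ [ts tsI <-]; rewrite partition_sumE; exact: H.
Qed.

Lemma curve_length_gt gamma I (C : R) : (C%:E < curve_length d gamma I)%E ->
  exists2 ts, sorted_in I ts & C < partition_sum gamma ts.
Proof.
move=> /ereal_sup_gt[_ [ts tsI <-]]; rewrite lte_fin partition_sumE.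
by exists ts.
Qed.

Lemma curve_length_ge0 gamma I : (0 <= curve_length d gamma I)%E.
Proof.
by have := @le_curve_length gamma I [::]; apply; split.
Qed.

Lemma curve_length_subset gamma I J : I `<=` J ->
  (curve_length d gamma I <= curve_length d gamma J)%E.
Proof.
move=> IJ; apply: curve_length_le => ts [tss tsI]; apply: le_curve_length.
by split=> // t /tsI /IJ.
Qed.

Lemma sorted_in_rcons I ts t : sorted_in I ts -> I t -> (forall s, s \in ts -> s <= t) ->
  sorted_in I (rcons ts t).
Proof.
move=> [tss tsI] It tst; split; last first.
  by move=> s; rewrite mem_rcons in_cons => /predU1P[->//|]; exact: tsI.
case: ts tss tst {tsI} => //= x ts xts tst; rewrite rcons_path xts/=.
by apply: tst; rewrite mem_last.
Qed.

Lemma sorted_in_cons I ts t : sorted_in I ts -> I t -> (forall s, s \in ts -> t <= s) ->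
  sorted_in I (t :: ts).
Proof.
move=> [tss tsI] It tst; split; last first.
  by move=> s; rewrite in_cons => /predU1P[->//|]; exact: tsI.
case: ts tss tst {tsI} => //= x ts xts tst; rewrite xts andbT.
by apply: tst; rewrite mem_head.
Qed.

Lemma sorted_in_cat I ts ts' s : sorted_in I ts -> sorted_in I ts' ->
  (forall p, p \in ts -> p <= s) -> (forall p, p \in ts' -> s <= p) ->
  sorted_in I (ts ++ ts').
Proof.
move=> [tss tsI] [tss' tsI'] l1 l2; split; last first.
  by move=> p; rewrite mem_cat => /orP[/tsI|/tsI'].
move: tss tss'; rewrite !(sorted_pairwise (@le_trans _ _)) pairwise_cat => -> ->.
by rewrite !andbT; apply/allrelP => x y /l1 xs /l2; exact: le_trans.
Qed.

(** The bounds telescope along [K]. It is used with the identity for Lipschitz paths and with a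
    multiple of [sigmoid] for geodesics in the deformed distance. *)
Lemma polygon_le gamma (K : R -> R) s t ts : (forall u v, u \in s :: ts -> v \in s :: ts -> u <= v ->
    d (gamma u) (gamma v) <= K v - K u) ->
  path <=%R s ts -> (forall u, u \in s :: ts -> K u <= t) ->
  polygon gamma s ts <= t - K s.
Proof.
elim: ts s => [|u ts IH] s H /=.
  by move=> _ /(_ s); rewrite mem_head subr_ge0; exact.
move=> /andP[su uts] Ht.
have : polygon gamma u ts <= t - K u.
  apply: IH => // [v w vu wu vw|v vu]; first by apply: H => //; rewrite in_cons ?vu ?wu orbT.
  by apply: Ht; rewrite in_cons vu orbT.
have := H s u; rewrite !in_cons !eqxx orbT => /(_ isT isT su); lra.
Qed.

End PartitionSums.

Section ArcLength.
Context {R : realType} {T : Type} (d : T -> T -> R).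
Hypothesis dM : metric_on setT d.
Variables (gamma : R -> T) (a c l : R).
Hypothesis ac : a <= c.
Hypothesis gammac : curve d `[a, c] gamma.
Hypothesis lE : curve_length d gamma `[a, c] = l%:E.
Implicit Types (s t u e : R) (ts : seq R).

Definition len s t : R := fine (curve_length d gamma `[s, t]).

Lemma itv_subset s t : a <= s -> t <= c -> `[s, t] `<=` `[a, c].
Proof.
move=> as_ tc u; rewrite /= !in_itv/= => /andP[su ut].
by rewrite (le_trans as_ su) (le_trans ut tc).
Qed.

Lemma lenE s t : a <= s -> t <= c -> curve_length d gamma `[s, t] = (len s t)%:E.
Proof.
move=> as_ tc; rewrite fineK// ge0_fin_numE ?curve_length_ge0//.
apply: (@le_lt_trans _ _ l%:E); last exact: ltry.
by rewrite -lE; apply: curve_length_subset; exact: itv_subset.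
Qed.

Lemma len_ub s t ts : a <= s -> t <= c -> sorted_in `[s, t] ts ->
  partition_sum d gamma ts <= len s t.
Proof. by move=> as_ tc tsI; rewrite -lee_fin -lenE//; exact: le_curve_length. Qed.

Lemma len_adherent s t e : a <= s -> t <= c -> 0 < e ->
  exists2 ts, sorted_in `[s, t] ts & len s t - e < partition_sum d gamma ts.
Proof.
move=> as_ tc e0; apply: curve_length_gt; rewrite lenE// lte_fin; lra.
Qed.

Lemma len_le s t C : a <= s -> t <= c ->
  (forall ts, sorted_in `[s, t] ts -> partition_sum d gamma ts <= C) -> len s t <= C.
Proof.
move=> as_ tc H; rewrite -lee_fin -lenE//.
by apply: curve_length_le => ts /H; rewrite lee_fin.
Qed.

(** Near-optimal partitions of the two outer pieces are joined through [s] and [t]. With s = t this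
    is half of additivity; with a trivial last piece it bounds the distance by the length between
    [s] and [t]. *)
Lemma len_superadd x s t y : a <= x -> x <= s -> s <= t -> t <= y -> y <= c ->
  len x s + d (gamma s) (gamma t) + len t y <= len x y.
Proof.
move=> ax xs st ty yc; apply/ler_addgt0Pr => e e0.
have [|||ts1 ts1I l1] := @len_adherent x s (e / 2); [lra|lra|lra|].
have [|||ts2 ts2I l2] := @len_adherent t y (e / 2); [lra|lra|lra|].
suff : partition_sum d gamma ts1 + d (gamma s) (gamma t) + partition_sum d gamma ts2 <= len x y by lra.
have bd1 p : p \in ts1 -> x <= p /\ p <= s.
  by move=> /(proj2 ts1I); rewrite /= in_itv/= => /andP[].
have bd2 p : p \in ts2 -> t <= p /\ p <= y.
  by move=> /(proj2 ts2I); rewrite /= in_itv/= => /andP[].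
have sI : sorted_in `[x, y] (ts1 ++ s :: t :: ts2).
  have E u : u \in `[x, y] = (x <= u <= y) by rewrite in_itv.
  apply: (@sorted_in_cat _ _ _ _ s).
  - split; first by case: ts1I.
    by move=> p /bd1[? ?] /=; rewrite E; apply/andP; split; lra.
  - apply: sorted_in_cons; first apply: sorted_in_cons.
    + split; first by case: ts2I.
      by move=> p /bd2[? ?] /=; rewrite E; apply/andP; split; lra.
    + by rewrite /= E; apply/andP; split; lra.
    + by move=> p /bd2[].
    + by rewrite /= E; apply/andP; split; lra.
    + by move=> p; rewrite in_cons => /predU1P[->//|/bd2[tp _]]; exact: le_trans tp.
  - by move=> p /bd1[].
  - move=> p; rewrite !in_cons => /predU1P[->//|/predU1P[->//|/bd2[tp _]]].
    exact: le_trans tp.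
apply: le_trans (len_ub ax yc sI).
have H2 z : partition_sum d gamma ts2 <= polygon d gamma z ts2.
  by case: (ts2) => //= u r; rewrite lerDr (metric_on_ge0 dM).
have -> : partition_sum d gamma (ts1 ++ s :: t :: ts2) =
    partition_sum d gamma (rcons ts1 s) + (d (gamma s) (gamma t) + polygon d gamma t ts2).
  case: (ts1) => [|u r] /=; first by rewrite add0r.
  by rewrite polygon_cat.
have H1 : partition_sum d gamma ts1 <= partition_sum d gamma (rcons ts1 s).
  by case: (ts1) => //= u r; exact: polygon_rcons_ge.
by rewrite -addrA lerD// lerD2l.
Qed.

(** A converse to [len_superadd] for partitions without points strictly between [s] and [t]. For s =
    t it gives the other half of additivity; a nontrivial gap is what continuity of the length
    needs. *)
Lemma partition_sum_gap x s t y ts : a <= x -> x <= s -> s <= t -> t <= y -> y <= c ->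
  sorted_in `[x, y] ts -> (forall p, p \in ts -> p <= s \/ t <= p) ->
  partition_sum d gamma ts <= len x s + d (gamma s) (gamma t) + len t y.
Proof.
move=> ax xs st ty yc tsI gap.
have L1 : 0 <= len x s by rewrite -lee_fin -lenE ?curve_length_ge0//; lra.
have L2 : 0 <= len t y by rewrite -lee_fin -lenE ?curve_length_ge0//; lra.
have D0 := metric_on_ge0 dM (gamma s) (gamma t).
case: ts tsI gap => [|p r] tsI gap; first by rewrite /= !addr_ge0.
have bd q : q \in p :: r -> x <= q /\ q <= y.
  by move=> /(proj2 tsI); rewrite /= in_itv/= => /andP[].
have pr : path <=%R p r by case: tsI.
have [ps|tp] := gap p (mem_head _ _); last first.
  apply: (@le_trans _ _ (len t y)); last by rewrite lerDr addr_ge0.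
  apply: len_ub => //; first by lra.
  split=> // q qr /=; rewrite in_itv/= (bd q qr).2 andbT.
  move: qr; rewrite in_cons => /predU1P[->//|qr].
  apply: le_trans tp _; move: pr; rewrite (path_sortedE (@le_trans _ _)).
  by move=> /andP[/allP/(_ _ qr)].
have [r1 [r2 [rE H1 H2]]] := sorted_gap st pr ps
  (fun q qr => gap q ltac:(by rewrite in_cons qr orbT)).
rewrite rE /=; apply: le_trans (polygon_gap dM gamma p r1 r2 s t) _.
rewrite rE in pr bd.
have S0 : sorted <=%R (p :: r1 ++ r2) := pr.
have S1 : sorted <=%R (p :: r1) by have [] := cat_sorted2 (S0 : sorted _ ((p :: r1) ++ r2)).
have S2 : sorted <=%R r2 by have [_ ] := cat_sorted2 (S0 : sorted _ ((p :: r1) ++ r2)).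
have I1 : sorted_in `[x, s] (rcons (p :: r1) s).
  apply: sorted_in_rcons.
  - split=> // q qr; rewrite /= in_itv/= (bd q _).1.
      by move: qr; rewrite in_cons => /predU1P[->//|/H1].
    by rewrite -cat_cons mem_cat qr.
  - by rewrite /= in_itv/= xs lexx.
  - by move=> q; rewrite in_cons => /predU1P[->//|/H1].
have I2 : sorted_in `[t, y] (t :: r2).
  apply: sorted_in_cons => //.
  - split=> // q qr; rewrite /= in_itv/= H2// (bd q _).2//.
    by rewrite -cat_cons mem_cat qr orbT.
  - by rewrite /= in_itv/= ty lexx.
have := len_ub ax (_ : s <= c) I1 => /(_ ltac:(lra)) /=.
have := len_ub (_ : a <= t) yc I2 => /(_ ltac:(lra)) /=.
lra.
Qed.

Lemma len_split t : a <= t <= c -> len a t + len t c = l.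
Proof.
move=> /andP[at_ tc]; have lacE : len a c = l by rewrite /len lE.
apply/eqP; rewrite eq_le; apply/andP; split.
  have := @len_superadd a t t c (lexx _) at_ (lexx _) tc (lexx _).
  by rewrite (metric_on_xx dM) addr0 lacE.
rewrite -lacE; apply: len_le => // ts tsI.
have := @partition_sum_gap a t t c ts (lexx _) at_ (lexx _) tc (lexx _) tsI.
rewrite (metric_on_xx dM) addr0; apply=> p _.
by case: (leP p t) => ?; [left|right; exact: ltW].
Qed.

Lemma len_ge_dist s t : a <= s -> s <= t -> t <= c ->
  d (gamma s) (gamma t) <= len a t - len a s.
Proof.
move=> as_ st tc; have := @len_superadd a s t t (lexx _) as_ st (lexx _) tc.
have : 0 <= len t t by rewrite -lee_fin -lenE ?curve_length_ge0//; lra.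
lra.
Qed.

Lemma len_mono s t : a <= s -> s <= t -> t <= c -> len a s <= len a t.
Proof.
move=> as_ st tc; have := len_ge_dist as_ st tc.
have := metric_on_ge0 dM (gamma s) (gamma t); lra.
Qed.

Lemma len_start : len a a = 0.
Proof.
have := @len_split a; rewrite lexx ac => /(_ isT).
by rewrite [len a c]/len lE /=; lra.
Qed.

Lemma len_end : len a c = l. Proof. by rewrite /len lE. Qed.

Lemma isolated ts u : exists2 eta : R, 0 < eta &
  forall p, p \in ts -> p = u \/ eta <= `|p - u|.
Proof.
elim: ts => [|q ts [eta eta0 IH]]; first by exists 1.
have [->|qu] := eqVneq q u.
  exists eta => // p; rewrite in_cons => /predU1P[->|/IH//]; by left.
exists (Num.min eta `|q - u|); first by rewrite lt_min eta0 normr_gt0 subr_eq0.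
move=> p; rewrite in_cons => /predU1P[->|/IH[->|H]]; [right|left|right] => //.
  by rewrite ge_min lexx orbT.
by rewrite ge_min H.
Qed.

(** Fix a partition whose sum is within e/2 of the whole length. For [t] close to [u] none of its
    points lies strictly between them, so the length between [u] and [t] exceeds their distance by
    less than e/2. *)
Lemma len_continuous u e : a <= u <= c -> 0 < e -> exists2 eta, 0 < eta &
  forall t, a <= t <= c -> `|t - u| < eta -> `|len a t - len a u| < e.
Proof.
move=> /andP[au uc] e0.
have [ts tsI tsl] := @len_adherent a c (e / 2) (lexx _) (lexx _) ltac:(lra).
rewrite len_end in tsl.
have [eta1 eta10 iso] := isolated ts u.
have [eta2 /= eta20 H] : exists2 eta : R, 0 < eta & forall t, a <= t <= c ->
    `|t - u| < eta -> d (gamma u) (gamma t) < e / 2.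
  have [_ _ /(_ u)] := gammac; rewrite /= in_itv/= au uc => /(_ isT).
  move=> /cvgrPdist_lt/(_ (e / 2) ltac:(lra)).
  rewrite near_withinE => /nbhs_ballP[eta /= eta0 H].
  exists eta => // t tac tu; have := H t.
  rewrite /ball/= distrC => /(_ tu); rewrite in_itv/= => /(_ tac).
  by rewrite sub0r normrN ger0_norm ?(metric_on_ge0 dM).
exists (Num.min eta1 eta2); first by rewrite lt_min eta10.
move=> t tac; have /andP[at_ tc] := tac; rewrite lt_min => /andP[t1 /(H _ tac) t2].
have [ut|tu] := leP u t.
  have := @partition_sum_gap a u t c ts (lexx _) au ut tc (lexx _) tsI.
  move=> /(_ _)/wrap[p /iso[->|pu]|K]; first by left.
    case: (leP p u) => ?; [by left|right].
    by move: pu t1; rewrite !ger0_norm ?subr_ge0//; lra.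
  have := @len_split t tac; have := len_mono au ut tc.
  by rewrite ltr_norml => ? ?; apply/andP; split; lra.
have := @partition_sum_gap a t u c ts (lexx _) at_ (ltW tu) uc (lexx _) tsI.
move=> /(_ _)/wrap[p /iso[->|pu]|K]; first by right.
  case: (leP u p) => ?; [by right|left].
  by move: pu t1; rewrite !ltr0_norm ?subr_lt0//; lra.
have := @len_split u; rewrite au uc => /(_ isT); have := len_mono at_ (ltW tu) uc.
rewrite (metric_on_sym dM) in K.
by rewrite ltr_norml => ? ?; apply/andP; split; lra.
Qed.

Lemma len_surj s : 0 <= s <= l -> exists2 t, a <= t <= c & len a t = s.
Proof.
move=> sl; have [] := @IVT _ (len a) a c s ac.
- apply/subspace_continuousP => u; rewrite /= in_itv/= => uac.
  apply/cvgrPdist_lt => e e0; have [eta eta0 H] := len_continuous uac e0.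
  rewrite near_withinE; apply/nbhs_ballP; exists eta => // t.
  rewrite /ball/= distrC => tu; rewrite in_itv/= => tac.
  by rewrite distrC; exact: H.
- rewrite len_start len_end; have /andP[s0 sl'] := sl.
  by rewrite min_l ?max_r ?sl//; exact: le_trans sl'.
by move=> t; rewrite in_itv/= => tac tE; exists t.
Qed.

End ArcLength.

Section LebesguePrimitive.
Context {R : realType}.
Implicit Types (l s t u e : R) (g : R -> R).
Local Notation mu := (@lebesgue_measure R).

(** The interval is half-open because it arises as the difference of [0, t] and [0, s]. *)
Lemma Rintegral_itv_bounds g s t m M : s <= t ->
  mu.-integrable `]s, t] (EFin \o g) ->
  (forall u, s < u <= t -> m <= g u <= M) ->
  m * (t - s) <= Rintegral mu `]s, t] g <= M * (t - s).
Proof.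
move=> st gI gb.
have muE : fine (mu `]s, t]) = t - s.
  rewrite lebesgue_measure_itv/= lte_fin.
  by case: ltP => // ts; rewrite /=; lra.
have cI k : mu.-integrable `]s, t] (EFin \o cst k).
  have : mu.-integrable `[s, t] (EFin \o cst k).
    apply: continuous_compact_integrable; first exact: segment_compact.
    by apply: continuous_subspaceT => x; exact: cvg_cst.
  by apply: integrableS => //; apply: subset_itvr; rewrite bnd_simp.
rewrite -!muE -!Rintegral_cst//; apply/andP; split; apply: le_Rintegral => //.
- exact: cI.
- by move=> u /=; rewrite in_itv/= => /gb/andP[].
- exact: cI.
- by move=> u /=; rewrite in_itv/= => /gb/andP[].
Qed.

Lemma Rintegral_primitive_on l g : 0 <= l -> {within `[0, l], continuous g} ->
  primitive_on l g (fun t => Rintegral mu `[0, t] g).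
Proof.
move=> l0 gc.
have gI : mu.-integrable `[0, l] (EFin \o g).
  by apply: continuous_compact_integrable => //; exact: segment_compact.
move=> u e /andP[u0 ul] e0.
have /subspace_continuousP/(_ u) := gc; rewrite /= in_itv/= u0 ul => /(_ isT).
move=> /cvgrPdist_le/(_ e e0); rewrite near_withinE => /nbhs_ballP[eta /= eta0 H].
exists eta => // s t [s0 su ut tl [us tu]].
have It : mu.-integrable `[0, t] (EFin \o g).
  apply: integrableS gI => //; apply: subset_itvl; by rewrite bnd_simp.
rewrite Rintegral_itvB//; last by rewrite bnd_simp; exact: le_trans ut.
have st : s <= t := le_trans su ut.
have Ist : mu.-integrable `]s, t] (EFin \o g).
  by apply: integrableS It => //; apply: subset_itvr; rewrite bnd_simp.
have := @Rintegral_itv_bounds g s t (g u - e) (g u + e) st Ist.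
move=> /(_ _)/wrap[v /andP[sv vt]|/andP[lo hi]].
  have := H v; rewrite /ball/= in_itv/= => /(_ _ _)/wrap[||].
  - by rewrite ltr_norml; apply/andP; split; lra.
  - by apply/andP; split; lra.
  - by move=> K; have : `|g u - g v| <= e := K; rewrite ler_norml => /andP[? ?];
      apply/andP; split; lra.
by rewrite ler_norml; apply/andP; split; lra.
Qed.

End LebesguePrimitive.

(** * Curve lengths and path costs *)

Section RhoLength.
Context {R : realType} {X : metricType R}.
Local Notation d := (@mdist R X).
Implicit Types (x y z w p : X) (rho : X -> R) (f gamma : R -> X) (l a c s t e : R).

Lemma mdist_metric_on : metric_on setT d.
Proof.
split=> [x y _ _|x y _ _|x y _ _|x y z _ _ _].
- exact: mdist_ge0.
- by split=> [/mdist_positivity//|->]; exact: mdistxx.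
- exact: metric_sym.
- exact: metric_triangle.
Qed.

Lemma lipschitz_path_continuous l f rho : lipschitz_path l f -> continuous rho ->
  {within `[0, l], continuous (rho \o f)}.
Proof.
move=> fL rhoc; apply/subspace_continuousP => u; rewrite /= in_itv/= => u0.
apply: (@cvg_comp _ _ _ f rho _ (nbhs (f u))); last exact: rhoc.
apply/metricType_numDomainType.cvgrPdist_lt => e e0.
rewrite near_withinE; apply/nbhs_ballP; exists e => // t.
rewrite /ball/= in_itv/= => ut t0; apply: le_lt_trans ut; exact: fL.
Qed.

Lemma integral_lipschitz_path l f rho : 0 <= l -> lipschitz_path l f -> continuous rho ->
  exists2 N, primitive_on l (rho \o f) N &
    (\int[lebesgue_measure]_(s in `[0%R, l]) (rho (f s))%:E)%E = (N l - N 0)%:E.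
Proof.
move=> l0 fL rhoc; have gc := lipschitz_path_continuous fL rhoc.
exists (fun t => Rintegral lebesgue_measure `[0, t] (rho \o f)).
  exact: Rintegral_primitive_on.
rewrite (_ : `[0, 0]%classic = [set (0 : R)]) ?set_itv1// Rintegral_set1 subr0.
rewrite fineK// integrable_fin_num//.
apply: (@continuous_compact_integrable R (rho \o f)) => //; exact: segment_compact.
Qed.

Section Rectifiable.
Variables (gamma : R -> X) (a c l : R).
Hypothesis ac : a <= c.
Hypothesis gammac : curve d `[a, c] gamma.
Hypothesis lE : curve_length d gamma `[a, c] = l%:E.

Local Notation L := (len d gamma a).
Local Notation P := (arclength_param gamma a c).

(** The choice in [arclength_param] may return another parameter with the same length, but the arc
    in between then has length 0 and gamma takes the same value there. *)
Lemma arclength_paramK t : a <= t <= c -> P (L t) = gamma t.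
Proof.
move=> /andP[at_ tc]; rewrite /arclength_param; case: xgetP => [t' _|].
  move=> [/andP[at' t'c]] t'L; apply: (metric_on_eq0 mdist_metric_on).
  have {}t'L : L t' = L t by rewrite /len t'L.
  apply/eqP; rewrite eq_le mdist_ge0 andbT.
  case: (leP t t') => tt'.
    have := len_ge_dist mdist_metric_on lE at_ tt' t'c.
    by rewrite t'L subrr metric_sym.
  have := len_ge_dist mdist_metric_on lE at' (ltW tt') tc.
  by rewrite t'L subrr.
by move=> /(_ t) []; split; [rewrite at_ tc|exact: (lenE lE)].
Qed.

Lemma arclength_param_lipschitz : lipschitz_path l P.
Proof.
suff H s t : 0 <= s -> s <= t -> t <= l -> d (P s) (P t) <= t - s.
  move=> s t /andP[s0 sl] /andP[t0 tl]; case: (leP s t) => st.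
    by rewrite distrC ger0_norm ?subr_ge0//; exact: H.
  by rewrite metric_sym ger0_norm ?subr_ge0 ?(ltW st)//; apply: H; rewrite ?(ltW st).
move=> s0 st tl.
(* Every value in [0, l] is attained as a length, so the choice never falls back on its default. *)
have [u uac uE] : exists2 u, a <= u <= c & L u = s.
  by apply: (len_surj mdist_metric_on ac gammac lE); rewrite s0 (le_trans st).
have [v vac vE] : exists2 v, a <= v <= c & L v = t.
  by apply: (len_surj mdist_metric_on ac gammac lE); rewrite (le_trans s0 st).
rewrite -uE -vE !arclength_paramK//; move: uac vac => /andP[au uc] /andP[av vc].
case: (leP u v) => uv; first exact: (len_ge_dist mdist_metric_on lE).
have := len_ge_dist mdist_metric_on lE av (ltW uv) uc.
by rewrite metric_sym; have := mdist_ge0 (gamma u) (gamma v); lra.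
Qed.

Lemma length_ge0 : 0 <= l.
Proof. by rewrite -lee_fin -lE curve_length_ge0. Qed.

Lemma rho_length_primitive rho : continuous rho ->
  exists2 N, primitive_on l (rho \o P) N & rho_length rho gamma a c = (N l - N 0)%:E.
Proof.
move=> rhoc; rewrite /rho_length lE.
exact: (integral_lipschitz_path length_ge0 arclength_param_lipschitz rhoc).
Qed.

Lemma rho_length_path_cost rho : continuous rho ->
  exists2 r, rho_length rho gamma a c = r%:E & path_cost rho (gamma a) (gamma c) r.
Proof.
move=> rhoc; have [N NP NE] := rho_length_primitive rhoc.
exists (N l - N 0) => //; exists l, P, N; split=> //.
- exact: length_ge0.
- exact: arclength_param_lipschitz.
- by rewrite -(len_start mdist_metric_on ac lE) arclength_paramK// lexx ac.
- by rewrite -{1}(len_end lE) arclength_paramK// lexx ac.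
Qed.

End Rectifiable.

Lemma lipschitz_path_rectifiable l f a c : 0 <= a -> a <= c -> c <= l -> lipschitz_path l f ->
  (curve_length d f `[a, c] <= (c - a)%:E)%E.
Proof.
move=> a0 ac cl fL; apply: curve_length_le => -[|s ts] [tss tsI] /=.
  by rewrite lee_fin subr_ge0.
have bd u : u \in s :: ts -> a <= u <= c by move=> /tsI; rewrite /= in_itv.
rewrite lee_fin; have : polygon d f s ts <= c - s.
  apply: (polygon_le (K := id)) => // [u v /bd/andP[au uc] /bd/andP[av vc] uv|u /bd/andP[]//].
  have := fL u v ltac:(by apply/andP; split; lra) ltac:(by apply/andP; split; lra).
  by rewrite distrC ger0_norm ?subr_ge0.
by have /andP[] := bd s (mem_head _ _); lra.
Qed.

(** With [rho_length_path_cost] this makes path costs and rho-lengths have the same infimum. A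
    1-Lipschitz path may move slower than unit speed, which can only make its cost exceed its
    rho-length. *)
Lemma path_cost_rho_length rho x y r : continuous rho -> (forall x, 0 < rho x) ->
  path_cost rho x y r -> exists a c gamma,
  [/\ a <= c, curve d `[a, c] gamma, gamma a = x, gamma c = y &
      (rho_length rho gamma a c <= r%:E)%E].
Proof.
move=> rhoc rho0 [l [f [N [l0 fL f0 fl [NP ->]]]]]; exists 0, l, f.
have fcurve : curve d `[0, l] f.
  split; [exact: interval_is_interval|by exists 0; rewrite /= in_itv/= lexx|].
  move=> t; rewrite /= in_itv/= => t0; apply/cvgrPdist_lt => e e0.
  rewrite near_withinE; apply/nbhs_ballP; exists e => // s.
  rewrite /ball/= in_itv/= => ts s0.
  by rewrite sub0r normrN ger0_norm ?mdist_ge0//; apply: le_lt_trans ts; exact: fL.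
split=> //.
have lenl := lipschitz_path_rectifiable (lexx 0) l0 (lexx l) fL.
have [l' l'E] : exists l', curve_length d f `[0, l] = l'%:E.
  exists (fine (curve_length d f `[0, l])); rewrite fineK// ge0_fin_numE ?curve_length_ge0//.
  by apply: le_lt_trans lenl _; exact: ltry.
have [N' N'P ->] := rho_length_primitive l0 fcurve l'E rhoc.
pose L := len d f 0; rewrite lee_fin.
have -> : N' l' = N' (L l) by rewrite /L (len_end l'E).
have -> : N' 0 = N' (L 0) by rewrite /L (len_start mdist_metric_on l0 l'E).
(* The arc length [L] grows at most at unit speed and maps straddling pairs to straddling pairs, so
   N' composed with [L] grows at rate at most rho (f u). *)
apply: (primitive_on_ge (F := fun t => N' (L t))) NP _ => // u e ul e0.
have uP : arclength_param f 0 l (L u) = f u := arclength_paramK l'E ul.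
have /andP[u0 ul'] := ul.
have Lmono s t : 0 <= s -> s <= t -> t <= l -> L s <= L t.
  by move=> s0 st tl; exact: (len_mono mdist_metric_on l'E).
have L0 : L 0 = 0 := len_start mdist_metric_on l0 l'E.
have Ll : L l = l' := len_end l'E.
have Ll' : 0 <= L u <= l' by rewrite -{1}L0 -Ll !Lmono.
have LL s t : 0 <= s -> s <= t -> t <= l -> L t - L s <= t - s.
  move=> s0 st tl; rewrite lerBlDl; apply: (len_le l'E) => // ts tsI.
  have := partition_sum_gap mdist_metric_on l'E (lexx 0) s0 (lexx s) st tl tsI.
  rewrite mdistxx addr0 => /(_ _)/wrap[p _|K].
    by case: (leP p s) => ?; [left|right; exact: ltW].
  apply: (le_trans K); rewrite lerD2l -lee_fin -(lenE l'E)//.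
  exact: (lipschitz_path_rectifiable s0 st tl fL).
have [eta eta0 H] := N'P (L u) e Ll' e0.
exists eta => // s t [s0 su ut tl [us tu]].
have st := le_trans su ut; have sl := le_trans st tl; have t0 := le_trans s0 st.
have : straddles l' (L u) eta (L s) (L t).
  split; rewrite -?Ll; try by apply: Lmono.
    by rewrite -{1}L0; exact: Lmono.
  by have := LL s u s0 su ul'; have := LL u t u0 ut tl; split; lra.
move=> /H /ler_normlP[_]; rewrite /= uP => K.
apply: (@le_trans _ _ ((rho (f u) + e) * (L t - L s))); first by lra.
by rewrite ler_wpM2l ?LL// addr_ge0 ?(ltW e0) ?(ltW (rho0 _)).
Qed.

Lemma geodesic_rho_length rho gamma a c : continuous rho -> a <= c ->
  geodesic d `[a, c] gamma ->
  exists N, [/\ rho_length rho gamma a c = (N (c - a) - N 0)%:E,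
    primitive_on (c - a) (rho \o (fun s => gamma (a + s))) N &
    lipschitz_path (c - a) (fun s => gamma (a + s))].
Proof.
move=> rhoc ac [_ _ gE].
have {}gE s t : a <= s <= c -> a <= t <= c -> d (gamma s) (gamma t) = `|s - t|.
  by move=> sac tac; rewrite gE//= in_itv.
have gL : lipschitz_path (c - a) (fun s => gamma (a + s)).
  move=> s t /andP[s0 sl] /andP[t0 tl]; rewrite gE; try by apply/andP; split; lra.
  by rewrite (_ : a + s - (a + t) = s - t)//; ring.
have gcurve : curve d `[a, c] gamma.
  split; [exact: interval_is_interval|by exists a; rewrite /= in_itv/= lexx ac|].
  move=> t; rewrite /= in_itv/= => tac; apply/cvgrPdist_lt => e e0.
  rewrite near_withinE; apply/nbhs_ballP; exists e => // s.
  rewrite /ball/= in_itv/= => ts sac.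
  by rewrite sub0r normrN ger0_norm ?mdist_ge0// gE.
have lens s t : a <= s -> s <= t -> t <= c -> curve_length d gamma `[s, t] = (t - s)%:E.
  move=> as_ st tc; apply/eqP; rewrite eq_le; apply/andP; split.
    apply: curve_length_le => -[|u ts] [tss tsI] /=; first by rewrite lee_fin subr_ge0.
    have bd v : v \in u :: ts -> s <= v <= t by move=> /tsI; rewrite /= in_itv.
    rewrite lee_fin; have : polygon d gamma u ts <= t - u.
      apply: (polygon_le (K := id)) => // [v w /bd/andP[? ?] /bd/andP[? ?] vw|v /bd/andP[]//].
      rewrite gE; try by apply/andP; split; lra.
      by rewrite distrC ger0_norm ?subr_ge0.
    by have /andP[] := bd u (mem_head _ _); lra.
  have : sorted_in `[s, t] [:: s; t].
    split; first by rewrite /= st.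
    by move=> u; rewrite !inE => /orP[/eqP->|/eqP->]; rewrite /= in_itv/= ?lexx st.
  move=> /(le_curve_length d gamma) /=; rewrite addr0 gE; try by apply/andP; split; lra.
  by rewrite distrC ger0_norm ?subr_ge0.
have lE := lens a c (lexx _) ac (lexx _).
have [N NP ->] := rho_length_primitive ac gcurve lE rhoc.
exists N; split=> //; apply: eq_primitive_on NP => // u /andP[u0 ul] /=.
have aul : a <= a + u <= c by apply/andP; split; lra.
have := arclength_paramK lE aul; rewrite /len lens//=; last by case/andP: aul.
  by rewrite addrAC subrr add0r => ->.
by case/andP: aul.
Qed.

End RhoLength.

(** * The deformed distance *)

Section DeformedDistance.
Context {R : realType} {X : metricType R}.
Local Notation d := (@mdist R X).
Implicit Types (x y z w p : X) (f gamma : R -> X) (l a c s t e r : R).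

(** One factor e^{-1} pays for approximating [b] up to 1, the other for a radius exceeding (x|y)_z
    by 1; the 4 is that of [CAT_minus1_retraction]. *)
Definition lower_constant : R := expR (- 2) / 4.

Lemma lower_constant_gt0 : 0 < lower_constant.
Proof. by rewrite /lower_constant divr_gt0// expR_gt0. Qed.

Section Deformation.
Variable b : X -> R.
Hypothesis catX : CAT_minus1 X.
Hypothesis bP : distance_approximable b.
Local Notation rho := (rho1 b).
Local Notation D := (dist1 b).
Local Notation gp := (gromov_product b).

Lemma rho1_gt0 x : 0 < rho x. Proof. exact: expR_gt0. Qed.

Lemma rho1_continuous : continuous rho.
Proof.
move=> x; apply: (@cvg_comp _ _ _ (fun y => - b y) expR _ (nbhs (- b x))); last first.
  exact: continuous_expR.
apply/cvgrPdist_lt => e e0; apply/nbhs_ballP; exists e => //= y.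
rewrite -metricType_numDomainType.ball_mdistE /= => xy.
have := approximable_lipschitz bP x y; have := approximable_lipschitz bP y x.
by rewrite (metric_sym y) ltr_norml => ? ?; apply/andP; split; lra.
Qed.

(** Since [b] is 1-Lipschitz, it lies above the lines b (gamma a) - (t - a) and b (gamma c) - (c -
    t), which cross at height (gamma a|gamma c)_b. *)
Lemma approximable_geodesic gamma a c t : geodesic d `[a, c] gamma -> a <= t <= c ->
  gp (gamma a) (gamma c) + `|t - (a + (b (gamma a) - gp (gamma a) (gamma c)))| <=
  b (gamma t).
Proof.
move=> [_ _ gE] tac; have /andP[at_ tc] := tac; have ac := le_trans at_ tc.
have {}gE s u : a <= s <= c -> a <= u <= c -> d (gamma s) (gamma u) = `|s - u|.
  by move=> sac uac; rewrite gE//= in_itv.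
have La := approximable_lipschitz bP (gamma a) (gamma t).
have Lc := approximable_lipschitz bP (gamma c) (gamma t).
move: La Lc; rewrite /gromov_product !gE ?lexx ?ac//.
rewrite (distrC a t) (distrC a c) (ger0_norm (_ : 0 <= c - a)) ?subr_ge0//.
rewrite (ger0_norm (_ : 0 <= t - a)) ?(ger0_norm (_ : 0 <= c - t)) ?subr_ge0// => La Lc.
by case: ger0P => ?; lra.
Qed.

Section Geodesic.
Variables (gamma : R -> X) (a c s t : R).
Hypotheses (as_ : a <= s) (st : s <= t) (tc : t <= c).
Hypothesis gammaG : geodesic d `[a, c] gamma.
Let h := gp (gamma a) (gamma c).
Let t0 := a + (b (gamma a) - h).

Let geodesic_sub : geodesic d `[s, t] gamma.
Proof.
case: gammaG => _ _ gE; split; first exact: interval_is_interval.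
  by exists s; rewrite /= in_itv/= lexx.
by move=> u v su sv; apply: gE; apply: itv_subset; eassumption.
Qed.

(** A subinterval is treated with the [h] and [t0] of the whole geodesic, and the bounds are
    increments of functions of the parameter, so that they add up along a partition. *)
Lemma rho_length_geodesic : exists r,
  [/\ rho_length rho gamma s t = r%:E, path_cost rho (gamma s) (gamma t) r,
      r <= 24 * expR (- h) * sigmoid (t - t0) - 24 * expR (- h) * sigmoid (s - t0) &
      r <= 2 * expR (- h) * t - 2 * expR (- h) * s].
Proof.
have [N [NE NP gL]] := geodesic_rho_length rho1_continuous st geodesic_sub.
have ts0 : 0 <= t - s by rewrite subr_ge0.
have sut u : 0 <= u -> u <= t - s -> a <= s + u <= c.
  by move: as_ tc => as' tc' u0 ul; apply/andP; split; lra.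
exists (N (t - s) - N 0); split=> //.
- exists (t - s), (fun u => gamma (s + u)), N; split=> //; first by rewrite addr0.
  by rewrite subrKC.
- rewrite -mulrBr (_ : t - t0 = (s - t0) + (t - s)); last by ring.
  apply: primitive_le_exp NP _ => // u /andP[u0 ul].
  have := @approximable_geodesic gamma a c (s + u) gammaG.
  rewrite (_ : s + u - _ = s - t0 + u); last by rewrite /t0 /h; ring.
  by apply; exact: sut.
- rewrite -mulrBr; apply: primitive_le_length NP _ => // u /andP[u0 ul].
  by apply: le_trans (approximable_geodesic gammaG (sut u u0 ul)); rewrite lerDl.
Qed.

End Geodesic.

Lemma exists_path_cost x y : exists2 r, path_cost rho x y r &
  r <= 24 * (expR (- gp x y) * Num.min 1 (d x y)).
Proof.
have [S [gamma [gG g0 gl _]]] := catX.1 x y.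
have [r [_ rC r1 r2]] := rho_length_geodesic (lexx 0) (mdist_ge0 x y) (lexx _) gG.
move: rC r1 r2; rewrite g0 gl => rC r1 r2; exists r => //.
have E := expR_gt0 (- gp x y).
case: (leP 1 (d x y)) => l1; last first.
  rewrite mulrA; apply: (le_trans r2); rewrite mulr0 subr0.
  by rewrite ler_wpM2r ?mdist_ge0//; lra.
apply: (le_trans r1); rewrite -mulrBr mulr1; apply: ler_piMr; first by rewrite mulr_ge0// ltW.
have /andP[_ ?] := sigmoid_itv (d x y - (0 + (b x - gp x y))).
by have /andP[? _] := sigmoid_itv (0 - (0 + (b x - gp x y))); lra.
Qed.

Let lengths x y : set (\bar R) := [set L : \bar R | exists a c gamma,
  [/\ a <= c, curve d `[a, c] gamma, gamma a = x, gamma c = y &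
      L = rho_length rho gamma a c]].

Let lengths_cost x y L : lengths x y L -> L = +oo%E \/ exists2 r, L = r%:E & path_cost rho x y r.
Proof.
move=> [a [c [gamma [ac gc <- <- ->]]]].
case lE : (curve_length d gamma `[a, c]) => [l| |].
- by right; apply: (rho_length_path_cost ac gc lE rho1_continuous).
- by left; rewrite /rho_length lE.
- by left; rewrite /rho_length lE.
Qed.

(** Costs are nonnegative and a geodesic has a finite one, so [fine] in [rho_dist] hides no infinite
    value. *)
Let lengths_inf x y : ereal_inf (lengths x y) = (D x y)%:E.
Proof.
rewrite /dist1 /rho_dist fineK// fin_numElt; apply/andP; split.
  apply: (@lt_le_trans _ _ 0%E); first exact: ltNy0.
  apply: le_ereal_inf_tmp => L /lengths_cost[->//|[r -> rC]].
  by rewrite lee_fin; exact: (path_cost_ge0 rho1_gt0 rC).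
have [r rC _] := exists_path_cost x y.
have [a [c [gamma [ac gc ga gc' gl]]]] := path_cost_rho_length rho1_continuous rho1_gt0 rC.
apply: (@le_lt_trans _ _ r%:E); last exact: ltry.
by apply: le_trans gl; apply: ereal_inf_lbound; exists a, c, gamma.
Qed.

Lemma dist1_le_cost x y r : path_cost rho x y r -> D x y <= r.
Proof.
move=> rC; rewrite -lee_fin -lengths_inf.
have [a [c [gamma [ac gc ga gc' gl]]]] := path_cost_rho_length rho1_continuous rho1_gt0 rC.
by apply: le_trans gl; apply: ereal_inf_lbound; exists a, c, gamma.
Qed.

Lemma dist1_adherent x y e : 0 < e -> exists2 r, path_cost rho x y r & r < D x y + e.
Proof.
move=> e0; have : (ereal_inf (lengths x y) < (D x y + e)%:E)%E.
  by rewrite lengths_inf lte_fin ltrDl.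
move=> /ereal_inf_lt[L /lengths_cost[->|[r -> rC]]]; first by [].
by rewrite lte_fin => re; exists r.
Qed.

Lemma dist1_le x y : D x y <= 24 * (expR (- gp x y) * Num.min 1 (d x y)).
Proof. by have [r /dist1_le_cost] := exists_path_cost x y; exact: le_trans. Qed.

Lemma dist1_ge x y : lower_constant * (expR (- gp x y) * Num.min 1 (d x y)) <= D x y.
Proof.
apply/ler_addgt0Pr => e e0; have [r rC re] := dist1_adherent x y e0.
by apply: le_trans (ltW re); exact: path_cost_ge rC.
Qed.

Lemma dist1_le_product x y : D x y <= 24 * expR (- gp x y).
Proof.
apply: le_trans (dist1_le x y) _; rewrite ler_pM2l//.
by rewrite ler_piMr ?expR_ge0// ge_min lexx.
Qed.

Lemma dist1_metric : metric_on setT D.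
Proof.
have D0 x y : 0 <= D x y.
  apply: le_trans (dist1_ge x y); apply: mulr_ge0; first exact: ltW lower_constant_gt0.
  by rewrite mulr_ge0 ?expR_ge0// le_min ler01 mdist_ge0.
split=> [x y _ _//|x y _ _|x y _ _|x y z _ _ _].
- split=> [xy|->]; last first.
    apply/eqP; rewrite eq_le D0 andbT.
    by apply: le_trans (dist1_le y y) _; rewrite mdistxx min_r// mulr0 mulr0.
  apply: mdist_positivity; apply/eqP; rewrite eq_le mdist_ge0 andbT leNgt.
  apply/negP => xy0; have := dist1_ge x y; rewrite xy leNgt => /negP; apply.
  by rewrite !mulr_gt0 ?lower_constant_gt0 ?expR_gt0// lt_min ltr01.
- suff H u v : D u v <= D v u by apply/eqP; rewrite eq_le !H.
  apply/ler_addgt0Pr => e e0; have [r rC re] := dist1_adherent v u e0.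
  by apply: le_trans (ltW re); apply: dist1_le_cost; exact: path_cost_sym.
- apply/ler_addgt0Pr => e e0; have e2 : 0 < e / 2 by rewrite divr_gt0.
  have [r rC re] := dist1_adherent x y e2; have [r' rC' re'] := dist1_adherent y z e2.
  by have := dist1_le_cost (path_cost_cat rC rC'); lra.
Qed.

Lemma dist1_GH_density : GH_density (24 / lower_constant) rho.
Proof.
split; first by split; [exact: rho1_continuous|exact: rho1_gt0].
move=> x y a c gamma ac gG <- <-.
have [r [-> _ r1 r2]] := rho_length_geodesic (lexx a) ac (lexx c) gG.
rewrite lee_fin -[rho_dist _ _ _]/(D _ _).
apply: (@le_trans _ _ (24 * (expR (- gp (gamma a) (gamma c)) * Num.min 1 (d (gamma a) (gamma c))))); last first.
  rewrite -mulrA ler_pM2l// ler_pdivlMl ?lower_constant_gt0//; exact: dist1_ge.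
have lE : d (gamma a) (gamma c) = c - a.
  case: gG => _ _ ->; rewrite /= ?in_itv/= ?lexx ?ac//.
  by rewrite distrC ger0_norm// subr_ge0.
have E := expR_gt0 (- gp (gamma a) (gamma c)); rewrite lE.
case: (leP 1 (c - a)) => l1; last first.
  rewrite mulrA; apply: (le_trans r2); rewrite -mulrBr.
  by rewrite ler_wpM2r ?subr_ge0//; lra.
apply: (le_trans r1); rewrite -mulrBr mulr1; apply: ler_piMr; first by rewrite mulr_ge0// ltW.
set u := a + _.
have /andP[_ ?] := sigmoid_itv (c - u).
by have /andP[? _] := sigmoid_itv (a - u); lra.
Qed.

(** Uniformity is about lengths measured with d_{1,b}. Bounding each chord by the cost of the
    geodesic arc and telescoping avoids identifying these lengths with rho-lengths. *)
Lemma partition_sum_geodesic (I : set R) gamma s t ts : geodesic d I gamma ->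
  I s -> I t -> s <= t -> sorted_in `[s, t] ts ->
  partition_sum D gamma ts <= 24 * (expR (- gp (gamma s) (gamma t)) * Num.min 1 (d (gamma s) (gamma t))).
Proof.
move=> [II _ gE] Is It st tsI.
have sub u : s <= u <= t -> I u by move=> /andP[su ut]; apply: (II s t) => //; rewrite su.
have gG : geodesic d `[s, t] gamma.
  split; first exact: interval_is_interval.
    by exists s; rewrite /= in_itv/= lexx.
  by move=> u v; rewrite /= !in_itv/= => /sub Iu /sub Iv; exact: gE.
have E := expR_gt0 (- gp (gamma s) (gamma t)).
have M0 : 0 <= Num.min 1 (d (gamma s) (gamma t)) by rewrite le_min ler01 mdist_ge0.
case: ts tsI => [|p ts] [tss tsI] /=; first by rewrite !mulr_ge0// ltW.
have bd u : u \in p :: ts -> s <= u <= t by move=> /tsI; rewrite /= in_itv.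
have inc u v : u \in p :: ts -> v \in p :: ts -> u <= v -> exists r,
    [/\ D (gamma u) (gamma v) <= r, r <= 24 * expR (- gp (gamma s) (gamma t)) *
       sigmoid (v - (s + (b (gamma s) - gp (gamma s) (gamma t)))) -
       24 * expR (- gp (gamma s) (gamma t)) *
       sigmoid (u - (s + (b (gamma s) - gp (gamma s) (gamma t)))) &
      r <= 2 * expR (- gp (gamma s) (gamma t)) * v - 2 * expR (- gp (gamma s) (gamma t)) * u].
  move=> /bd/andP[su ut] /bd/andP[sv vt] uv.
  have [r [_ rC r1 r2]] := rho_length_geodesic su uv vt gG.
  by exists r; split=> //; exact: dist1_le_cost.
have lE : d (gamma s) (gamma t) = t - s.
  by rewrite gE// distrC ger0_norm// subr_ge0.
have /andP[sp _] := bd p (mem_head _ _).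
rewrite lE; case: (leP 1 (t - s)) => l1; last first.
  have : polygon D gamma p ts <= 2 * expR (- gp (gamma s) (gamma t)) * t - 2 * expR (- gp (gamma s) (gamma t)) * p.
    apply: (polygon_le (K := fun u => 2 * expR (- gp (gamma s) (gamma t)) * u)) => //.
      by move=> u v up vp uv; have [r [Dr _ r2]] := inc u v up vp uv; exact: le_trans r2.
    by move=> u /bd/andP[su ut]; rewrite ler_wpM2l// mulr_ge0// ltW.
  move=> /le_trans; apply; rewrite -mulrBr mulrA.
  by apply: ler_pM; rewrite ?subr_ge0 ?mulr_ge0 ?(ltW E)//; [have /andP[] := bd p (mem_head _ _)|lra|lra].
set u0 := s + (b (gamma s) - gp (gamma s) (gamma t)) in inc *.
have C0 : 0 <= 24 * expR (- gp (gamma s) (gamma t)) by rewrite mulr_ge0// ltW.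
have : polygon D gamma p ts <= 24 * expR (- gp (gamma s) (gamma t)) -
    24 * expR (- gp (gamma s) (gamma t)) * sigmoid (p - u0).
  apply: (polygon_le (K := fun u => 24 * expR (- gp (gamma s) (gamma t)) * sigmoid (u - u0))) => //.
    by move=> u v up vp uv; have [r [Dr r1 _]] := inc u v up vp uv; exact: le_trans r1.
  by move=> u _; rewrite ler_piMr//; have /andP[] := sigmoid_itv (u - u0).
move=> /le_trans; apply; rewrite mulr1 lerBlDr lerDl mulr_ge0//.
by have /andP[] := sigmoid_itv (p - u0).
Qed.

End Deformation.

End DeformedDistance.

(** * Completions *)

Section SequenceLimits.
Context {R : realType}.
Implicit Types (u : nat -> R) (v : nat * nat -> R) (l e : R).

Lemma cvg_seqP u l : u n @[n --> \oo] --> l <->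
  forall e, 0 < e -> exists N, forall n, (N <= n)%N -> `|u n - l| < e.
Proof.
split=> [/cvgrPdist_lt H e e0|H].
  by have [N _ HN] := H e e0; exists N => n Nn; rewrite distrC; exact: HN.
apply/cvgrPdist_lt => e e0; have [N HN] := H e e0.
by exists N => // n /= Nn; rewrite distrC; exact: HN.
Qed.

Lemma cvg_seq2P v l : v n @[n --> (\oo, \oo)] --> l <->
  forall e, 0 < e -> exists N, forall n m, (N <= n)%N -> (N <= m)%N -> `|v (n, m) - l| < e.
Proof.
split=> [/cvgrPdist_lt H e e0|H].
  have [[A B] /= [[N _ NA] [M _ MB]] AB] := H e e0.
  exists (maxn N M) => n m; rewrite !geq_max => /andP[Nn Mn] /andP[Nm Mm].
  by rewrite distrC; apply: (AB (n, m)); split; [exact: NA|exact: MB].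
apply/cvgrPdist_lt => e e0; have [N HN] := H e e0.
exists ([set n | (N <= n)%N], [set n | (N <= n)%N]); first by split; exists N.
by move=> [n m] [/= Nn Nm]; rewrite distrC; exact: HN.
Qed.

Lemma cvgy_seqP u : u n @[n --> \oo] --> +oo <->
  forall C, exists N, forall n, (N <= n)%N -> C <= u n.
Proof.
split=> [/cvgryPge H C|H].
  by have [N _ HN] := H C; exists N => n Nn; exact: HN.
by apply/cvgryPge => C; have [N HN] := H C; exists N => // n /= Nn; exact: HN.
Qed.

Lemma cvgy_seq2P v : v n @[n --> (\oo, \oo)] --> +oo <->
  forall C, exists N, forall n m, (N <= n)%N -> (N <= m)%N -> C <= v (n, m).
Proof.
split=> [/cvgryPge H C|H].
  have [[A B] /= [[N _ NA] [M _ MB]] AB] := H C.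
  exists (maxn N M) => n m; rewrite !geq_max => /andP[Nn Mn] /andP[Nm Mm].
  by apply: (AB (n, m)); split; [exact: NA|exact: MB].
apply/cvgryPge => C; have [N HN] := H C.
exists ([set n | (N <= n)%N], [set n | (N <= n)%N]); first by split; exists N.
by move=> [n m] [/= Nn Nm]; exact: HN.
Qed.

Lemma cvg_seq_unique u l l' : u n @[n --> \oo] --> l -> u n @[n --> \oo] --> l' -> l = l'.
Proof.
by move=> /(cvg_lim (@norm_hausdorff _ R^o)) <- /(cvg_lim (@norm_hausdorff _ R^o)) <-.
Qed.

Lemma cvg_seq_cauchy u : (forall e, 0 < e -> exists N, forall n m, (N <= n)%N -> (N <= m)%N ->
  `|u n - u m| < e) -> exists l, u n @[n --> \oo] --> l.
Proof.
move=> H; suff : cvg (u @ \oo) by move=> /cvg_ex.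
apply/cauchy_cvgP/cauchy_ballP => e e0; have [N HN] := H e e0.
exists ([set x | exists2 n, (N <= n)%N & u n = x], [set x | exists2 n, (N <= n)%N & u n = x]).
  by split; exists N => // n /= Nn; exists n.
by move=> [x y] [/= [n Nn <-] [m Nm <-]]; exact: HN.
Qed.

End SequenceLimits.

Section Completion.
Context {R : realType} {T : Type} (d : T -> T -> R).
Hypothesis dM : metric_on setT d.
Implicit Types (x y z : nat -> T) (p q : set (nat -> T)) (e : R).

Let d0 a b : 0 <= d a b := metric_on_ge0 dM a b.
Let dC a b : d a b = d b a := metric_on_sym dM a b.
Let dT b a c : d a c <= d a b + d b c := metric_on_triangle dM b a c.
Let dxx a : d a a = 0 := metric_on_xx dM a.

Lemma cauchy_sequenceP x : cauchy_sequence d x <->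
  forall e, 0 < e -> exists N, forall n m, (N <= n)%N -> (N <= m)%N -> d (x n) (x m) < e.
Proof.
rewrite /cauchy_sequence (cvg_seq2P (fun n => d (x n.1) (x n.2))).
split=> H e e0; have [N HN] := H e e0; exists N => n m Nn Nm; have := HN n m Nn Nm;
  by rewrite /= subr0 ger0_norm.
Qed.

Lemma dist_cvg0P x y : d (x n) (y n) @[n --> \oo] --> (0 : R) <->
  forall e, 0 < e -> exists N, forall n, (N <= n)%N -> d (x n) (y n) < e.
Proof.
rewrite cvg_seqP; split=> H e e0; have [N HN] := H e e0;
  by exists N => n /HN; rewrite subr0 ger0_norm.
Qed.

Lemma cauchy_class_refl x : cauchy_sequence d x -> cauchy_class d x x.
Proof.
by move=> xc; split=> //; apply/dist_cvg0P => e e0; exists 0%N => n _; rewrite dxx.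
Qed.

Lemma cauchy_class_eq x y : cauchy_class d x y -> cauchy_class d y = cauchy_class d x.
Proof.
move=> [yc /dist_cvg0P xy]; apply/seteqP; split=> z [zc /dist_cvg0P yz]; split=> //;
  apply/dist_cvg0P => e e0; have [N HN] := xy (e / 2) ltac:(lra);
  have [M HM] := yz (e / 2) ltac:(lra); exists (maxn N M) => n;
  rewrite geq_max => /andP[/HN xyn /HM yzn].
- by have := dT (y n) (x n) (z n); lra.
- by have := dT (x n) (y n) (z n); rewrite (dC (y n) (x n)); lra.
Qed.

Lemma completionP p : completion d p -> exists2 x, p x & forall y, p y ->
  cauchy_sequence d y /\ p = cauchy_class d y.
Proof.
move=> [x xc ->]; exists x; first exact: cauchy_class_refl.
by move=> y xy; split; [case: xy|rewrite (cauchy_class_eq xy)].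
Qed.

Lemma completion_cauchy_class x : cauchy_sequence d x -> completion d (cauchy_class d x).
Proof. by move=> xc; exists x. Qed.

Lemma cauchy_cst a : cauchy_sequence d (fun=> a).
Proof. by apply/cauchy_sequenceP => e e0; exists 0%N => n m _ _; rewrite dxx. Qed.

Lemma to_completion_completion a : completion d (to_completion d a).
Proof. exact/completion_cauchy_class/cauchy_cst. Qed.

Lemma to_completion_cst a : to_completion d a (fun=> a).
Proof. exact/cauchy_class_refl/cauchy_cst. Qed.

Lemma dist_quadrilateral a a' b b' : `|d a b - d a' b'| <= d a a' + d b b'.
Proof.
rewrite ler_norml; have := dT a' a b; have := dT b' a' b; have := dT a a' b'.
by have := dT b a b'; rewrite (dC b' b) (dC a' a) => *; apply/andP; split; lra.
Qed.

Lemma completion_dist_cvg p q x y : completion d p -> completion d q -> p x -> q y ->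
  d (x n) (y n) @[n --> \oo] --> completion_dist d p q.
Proof.
move=> /completionP[_ _ Hp] /completionP[_ _ Hq] px qy.
have [xc pE] := Hp x px; have [yc qE] := Hq y qy.
have [r xyr] : exists r : R, d (x n) (y n) @[n --> \oo] --> r.
  apply: cvg_seq_cauchy => e e0.
  have [N HN] := (cauchy_sequenceP x).1 xc (e / 2) ltac:(lra).
  have [M HM] := (cauchy_sequenceP y).1 yc (e / 2) ltac:(lra).
  exists (maxn N M) => n m; rewrite !geq_max => /andP[Nn Mn] /andP[Nm Mm].
  apply: le_lt_trans (dist_quadrilateral _ _ _ _) _.
  by have := HN _ _ Nn Nm; have := HM _ _ Mn Mm; lra.
rewrite /completion_dist; case: xgetP => [r' _ [x' [y' [px' qy' xy']]]|/(_ r)]; last first.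
  by case; exists x, y.
suff -> : r' = r by [].
apply: (cvg_seq_unique xy').
have [_ /dist_cvg0P xx'] : cauchy_class d x x' by rewrite -pE.
have [_ /dist_cvg0P yy'] : cauchy_class d y y' by rewrite -qE.
apply/cvg_seqP => e e0; have [N HN] := (cvg_seqP _ _).1 xyr (e / 3) ltac:(lra).
have [M HM] := xx' (e / 3) ltac:(lra); have [K HK] := yy' (e / 3) ltac:(lra).
exists (maxn N (maxn M K)) => n; rewrite !geq_max => /and3P[/HN xyn /HM xxn /HK yyn].
have := dist_quadrilateral (x' n) (x n) (y' n) (y n).
move: xyn; rewrite (dC (x' n) (x n)) (dC (y' n) (y n)) ltr_norml ler_norml => /andP[? ?] /andP[? ?].
by rewrite ltr_norml; apply/andP; split; lra.
Qed.

Lemma completion_dist_le p q x y (C : R) : completion d p -> completion d q -> p x -> q y ->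
  (forall e, 0 < e -> exists N, forall n, (N <= n)%N -> d (x n) (y n) <= C + e) ->
  completion_dist d p q <= C.
Proof.
move=> pc qc px qy H; apply/ler_addgt0Pr => e e0.
have [N HN] := (cvg_seqP _ _).1 (completion_dist_cvg pc qc px qy) (e / 2) ltac:(lra).
have [M HM] := H (e / 2) ltac:(lra).
have := HN _ (leq_maxl N M); have := HM _ (leq_maxr N M).
by rewrite ltr_norml => ? /andP[? ?]; lra.
Qed.

Lemma completion_dist_ge p q x y (C : R) : completion d p -> completion d q -> p x -> q y ->
  (forall e, 0 < e -> exists N, forall n, (N <= n)%N -> C - e <= d (x n) (y n)) ->
  C <= completion_dist d p q.
Proof.
move=> pc qc px qy H; apply/ler_addgt0Pr => e e0.
have [N HN] := (cvg_seqP _ _).1 (completion_dist_cvg pc qc px qy) (e / 2) ltac:(lra).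
have [M HM] := H (e / 2) ltac:(lra).
have := HN _ (leq_maxl N M); have := HM _ (leq_maxr N M).
by rewrite ltr_norml => ? /andP[? ?]; lra.
Qed.

Lemma completion_metric : metric_on (completion d) (completion_dist d).
Proof.
split=> [p q pc qc|p q pc qc|p q pc qc|p q r pc qc rc].
- have [x px _] := completionP pc; have [y qy _] := completionP qc.
  apply: (completion_dist_ge pc qc px qy) => e e0; exists 0%N => n _.
  by have := d0 (x n) (y n); lra.
- have [x px Hx] := completionP pc; have [y qy Hy] := completionP qc.
  have xy := completion_dist_cvg pc qc px qy; split=> [pq0|pq].
    have [_ ->] := Hx x px; have [yc ->] := Hy y qy.
    by apply/esym/cauchy_class_eq; split=> //; rewrite -pq0.
  apply: (cvg_seq_unique xy).
  by have [_ pE] := Hx x px; have : cauchy_class d x y by [rewrite -pE pq]; case.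
- have [x px _] := completionP pc; have [y qy _] := completionP qc.
  apply: (cvg_seq_unique (completion_dist_cvg pc qc px qy)).
  under eq_fun do rewrite dC; exact: completion_dist_cvg.
- have [x px _] := completionP pc; have [y qy _] := completionP qc.
  have [z rz _] := completionP rc.
  apply: (completion_dist_le pc rc px rz) => e e0.
  have [N HN] := (cvg_seqP _ _).1 (completion_dist_cvg pc qc px qy) (e / 2) ltac:(lra).
  have [M HM] := (cvg_seqP _ _).1 (completion_dist_cvg qc rc qy rz) (e / 2) ltac:(lra).
  exists (maxn N M) => n; rewrite geq_max => /andP[/HN + /HM].
  rewrite !ltr_norml => /andP[? ?] /andP[? ?].
  by have := dT (y n) (x n) (z n); lra.
Qed.

Lemma cauchy_class_limit x : cauchy_sequence d x ->
  completion_dist d (to_completion d (x n)) (cauchy_class d x) @[n --> \oo] --> (0 : R).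
Proof.
move=> xc; have cc := completion_cauchy_class xc.
have [N0 _ _ _] := completion_metric.
apply/cvg_seqP => e e0.
have [N HN] := (cauchy_sequenceP x).1 xc (e / 2) ltac:(lra).
exists N => n Nn; rewrite subr0 ger0_norm; last exact: N0 (to_completion_completion _) cc.
apply: (@le_lt_trans _ _ (e / 2)); last by lra.
apply: (completion_dist_le (to_completion_completion _) cc (to_completion_cst _)
  (cauchy_class_refl xc)) => e' e'0.
by exists N => m Nm; have := HN n m Nn Nm; lra.
Qed.

(** Points of the completion are sets of sequences, so convergence turns into membership; distances
    to [p] can then be computed along [x]. *)
Lemma limit_mem x p : completion d p ->
  completion_dist d (to_completion d (x n)) p @[n --> \oo] --> (0 : R) -> p x.
Proof.
move=> pc xp; have [y py Hy] := completionP pc; have [yc ->] := Hy y py.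
have xy : forall e, 0 < e -> exists N, forall n, (N <= n)%N -> d (x n) (y n) < e.
  move=> e e0; have [N HN] := (cauchy_sequenceP y).1 yc (e / 3) ltac:(lra).
  have [M HM] := (cvg_seqP _ _).1 xp (e / 3) ltac:(lra).
  exists (maxn N M) => n; rewrite geq_max => /andP[Nn /HM].
  rewrite subr0 ltr_norml => /andP[_ xpn].
  have [K HK] := (cvg_seqP _ _).1 (completion_dist_cvg (to_completion_completion (x n)) pc
    (to_completion_cst _) py) (e / 3) ltac:(lra).
  have := HK _ (leq_maxl K N); have := HN _ n (leq_maxr K N) Nn.
  rewrite ltr_norml => ? /andP[? ?].
  by have := dT (y (maxn K N)) (x n) (y n); lra.
split; last by apply/dist_cvg0P => e /xy[N HN]; exists N => n /HN; rewrite dC.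
apply/cauchy_sequenceP => e e0; have [N HN] := xy (e / 3) ltac:(lra).
have [M HM] := (cauchy_sequenceP y).1 yc (e / 3) ltac:(lra).
exists (maxn N M) => n m; rewrite !geq_max => /andP[/HN xyn Mn] /andP[/HN xym Mm].
have := HM n m Mn Mm; have := dT (y n) (x n) (x m); have := dT (y m) (y n) (x m).
by rewrite (dC (y m) (x m)); lra.
Qed.

Lemma metric_boundaryP p x : metric_boundary d p -> p x -> cauchy_sequence d x /\
  forall a, ~ (forall e, 0 < e -> exists N, forall n, (N <= n)%N -> d (x n) a < e).
Proof.
move=> [pc pX] px; have [_ _ Hp] := completionP pc; have [xc pE] := Hp x px.
split=> // a H; apply: pX; exists a => //; rewrite pE.
apply/esym/cauchy_class_eq; split=> //; apply/dist_cvg0P => e /H[N HN].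
by exists N => n /HN; rewrite dC.
Qed.

Lemma metric_boundary_cauchy_class x : cauchy_sequence d x ->
  (forall a, ~ (forall e, 0 < e -> exists N, forall n, (N <= n)%N -> d (x n) a < e)) ->
  metric_boundary d (cauchy_class d x).
Proof.
move=> xc H; split; first exact: completion_cauchy_class.
move=> [a _ aE]; apply: (H a).
have [_ /dist_cvg0P ax] : to_completion d a x by rewrite aE; exact: cauchy_class_refl.
by move=> e /ax[N HN]; exists N => n /HN; rewrite dC.
Qed.

End Completion.

(** * Uniform curves *)

Section EndLimits.
Context {R : realType} {T : Type} (d : T -> T -> R).
Hypothesis dM : metric_on setT d.
Implicit Types (gamma : R -> T) (I : set R) (p q : set (nat -> T)).

Lemma completion_dist_points a b :
  completion_dist d (to_completion d a) (to_completion d b) = d a b.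
Proof.
apply: (@cvg_seq_unique _ (fun=> d a b)); last exact: cvg_cst.
exact: (completion_dist_cvg dM (to_completion_completion dM a)
  (to_completion_completion dM b) (to_completion_cst dM a) (to_completion_cst dM b)).
Qed.

Section Directed.
Variables (le : R -> R -> Prop) (I : set R).
Hypothesis I0 : I !=set0.
Hypothesis le_refl : forall s, le s s.
Hypothesis le_tr : forall s t u, le s t -> le t u -> le s u.
Hypothesis le_dir : forall s t, I s -> I t -> exists u, [/\ I u, le s u & le t u].

(** An abstract directed relation covers both [left_end] and [right_end]. *)
Definition end_filter : set_system R := filter_from I (fun t0 => [set t | I t /\ le t0 t]).

Lemma end_filter_filter : Filter end_filter.
Proof.
apply: filter_from_filter => // s t Is It; have [u [Iu su tu]] := le_dir Is It.
by exists u => // v [Iv uv]; split; split=> //; [exact: le_tr uv|exact: le_tr uv].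
Qed.

Lemma end_filter_limit gamma :
  (forall e, 0 < e -> exists2 u, I u &
     forall s t, I s -> I t -> le u s -> le s t -> d (gamma s) (gamma t) <= e) ->
  exists p, curve_limit d gamma end_filter p.
Proof.
move=> osc; have FF := end_filter_filter.
have {osc} osc (e : R) : 0 < e -> exists2 u, I u &
    forall s t, I s -> I t -> le u s -> le u t -> d (gamma s) (gamma t) <= e.
  move=> e0; have [u Iu H] := osc (e / 2) ltac:(lra); exists u => // s t Is It us ut.
  have [v [Iv sv tv]] := le_dir Is It.
  have := H s v Is Iv us sv; have := H t v It Iv ut tv.
  rewrite (metric_on_sym dM (gamma t)).
  by have := metric_on_triangle dM (gamma v) (gamma s) (gamma t); lra.
have [eps [e0 eps_mono small]] : exists eps : nat -> R, [/\ forall n, 0 < eps n,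
    forall N m, (N <= m)%N -> eps m <= eps N &
    forall e, 0 < e -> exists N, eps N <= e / 3].
  exists (fun n => n.+1%:R^-1); split=> [n|N m Nm|e e_gt0].
  - by rewrite invr_gt0 ltr0n.
  - by rewrite lef_pV2 ?posrE ?ltr0n// ler_nat.
  - have e3 : 0 < e / 3 by rewrite divr_gt0.
    exists (Num.truncn (e / 3)^-1); rewrite invf_ple ?posrE ?ltr0n//.
    by apply/ltW/truncnS_gt.
have /choice[u uP] n : exists u, I u /\ forall s t, I s -> I t -> le u s -> le u t ->
    d (gamma s) (gamma t) <= eps n.
  by have [u Iu H] := osc _ (e0 n); exists u.
(* [s] and [u m] need not be comparable, hence the detour through a common bound [v], which doubles
   [eps N]. *)
have key N m s : (N <= m)%N -> I s -> le (u N) s -> d (gamma s) (gamma (u m)) <= eps N * 2.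
  move=> Nm Is Ns; have [Im Hm] := uP m; have [IN HN] := uP N.
  have [v [Iv sv mv]] := le_dir Is Im.
  have H1 : d (gamma s) (gamma v) <= eps N by apply: HN => //; exact: le_tr sv.
  have H2 : d (gamma v) (gamma (u m)) <= eps m by apply: Hm.
  have H3 := eps_mono N m Nm.
  by have := metric_on_triangle dM (gamma v) (gamma s) (gamma (u m)); lra.
pose x n := gamma (u n).
have xc : cauchy_sequence d x.
  apply/(cauchy_sequenceP dM) => e e_gt0.
  have [N HN] := small (e / 2) ltac:(lra).
  exists N => n m Nn Nm; have [IN _] := uP N.
  have := key N n (u N) Nn IN (le_refl _); have := key N m (u N) Nm IN (le_refl _).
  rewrite (metric_on_sym dM (gamma (u N)) (gamma (u n))) /x/=.
  by have := metric_on_triangle dM (gamma (u N)) (gamma (u n)) (gamma (u m)); lra.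
have cc := completion_cauchy_class xc.
exists (cauchy_class d x); split=> //; apply/cvgrPdist_lt => e e_gt0.
have [N HN] := small e e_gt0; have [IN _] := uP N; exists (u N) => // s [Is Ns].
have [P0 _ _ _] := completion_metric dM.
rewrite sub0r normrN ger0_norm; last exact: P0 (to_completion_completion dM _) cc.
apply: (@le_lt_trans _ _ (eps N * 2)); last by lra.
apply: (completion_dist_le dM (to_completion_completion dM _) cc
  (to_completion_cst dM _) (cauchy_class_refl dM xc)) => e' e'0.
by exists N => m Nm; have := key N m s Nm Is Ns; rewrite /x/=; lra.
Qed.

End Directed.

Lemma right_end_directed I s t : I s -> I t -> exists u, [/\ I u, s <= u & t <= u].
Proof. by move=> Is It; case: (leP s t) => ?; [exists t|exists s]; split=> //; exact: ltW. Qed.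

Lemma left_end_directed I s t : I s -> I t -> exists u, [/\ I u, u <= s & u <= t].
Proof. by move=> Is It; case: (leP s t) => ?; [exists s|exists t]; split=> //; exact: ltW. Qed.

Lemma right_end_filter I : I !=set0 -> Filter (right_end I).
Proof.
move=> I0; apply: (@end_filter_filter (fun s t => s <= t) I I0).
- by move=> s t u; exact: le_trans.
- exact: right_end_directed.
Qed.

Lemma left_end_filter I : I !=set0 -> Filter (left_end I).
Proof.
move=> I0; apply: (@end_filter_filter (fun s t => t <= s) I I0).
- by move=> s t u st tu; exact: le_trans st.
- exact: left_end_directed.
Qed.

(** Take a partition whose sum is within e of the total length. Beyond its last point, appending any
    two points can raise the sum by at most e, so the curve oscillates by at most e. *)
Lemma right_end_limit I gamma : I !=set0 -> (curve_length d gamma I < +oo)%E ->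
  exists p, curve_limit d gamma (right_end I) p.
Proof.
move=> I0 fin; apply: (@end_filter_limit (fun s t => s <= t) I I0) => //.
- by move=> s t u; exact: le_trans.
- exact: right_end_directed.
move=> e e0; pose l := fine (curve_length d gamma I).
have lE : curve_length d gamma I = l%:E by rewrite fineK// ge0_fin_numE ?curve_length_ge0.
have [|ts [tss tsI] tsl] := @curve_length_gt R T d gamma I (l - e).
  by rewrite lE lte_fin ltrBlDr ltrDl.
have [u Iu tsu] : exists2 u, I u & forall p : R, p \in ts -> p <= u.
  case: I0 => i Ii; elim: ts tss tsI {tsl} => [|q ts IH] tss tsI; first by exists i.
  have [||u Iu H] := IH; first by move: tss => /path_sorted.
    by move=> p pts; apply: tsI; rewrite in_cons pts orbT.
  have Iq : I q by apply: tsI; rewrite mem_head.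
  have [v [Iv qv uv]] := right_end_directed Iq Iu.
  exists v => // p; rewrite in_cons => /predU1P[->//|/H pu]; exact: le_trans uv.
exists u => // s t Is It us st.
have tsS : sorted_in I (rcons (rcons ts s) t).
  apply: sorted_in_rcons => //; first apply: sorted_in_rcons => //.
    by move=> p /tsu pu; exact: le_trans us.
  move=> p; rewrite mem_rcons in_cons => /predU1P[->//|/tsu pu].
  by apply: le_trans st; exact: le_trans us.
have := le_curve_length d gamma tsS; rewrite lE lee_fin.
have -> : partition_sum d gamma (rcons (rcons ts s) t) =
    partition_sum d gamma (rcons ts s) + d (gamma s) (gamma t).
  case: (ts) => [|q r] /=; first by rewrite addr0 add0r.
  by rewrite -cats1 cat_rcons polygon_cat /= addr0.
have : partition_sum d gamma ts <= partition_sum d gamma (rcons ts s).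
  by case: (ts) => //= q r; exact: polygon_rcons_ge.
lra.
Qed.

Lemma left_end_limit I gamma : I !=set0 -> (curve_length d gamma I < +oo)%E ->
  exists p, curve_limit d gamma (left_end I) p.
Proof.
move=> I0 fin; apply: (@end_filter_limit (fun s t => t <= s) I I0) => //.
- by move=> s t u st tu; exact: le_trans st.
- exact: left_end_directed.
move=> e e0; pose l := fine (curve_length d gamma I).
have lE : curve_length d gamma I = l%:E by rewrite fineK// ge0_fin_numE ?curve_length_ge0.
have [|ts [tss tsI] tsl] := @curve_length_gt R T d gamma I (l - e).
  by rewrite lE lte_fin ltrBlDr ltrDl.
have [u Iu tsu] : exists2 u, I u & forall p : R, p \in ts -> u <= p.
  case: I0 => i Ii; elim: ts tss tsI {tsl} => [|q ts IH] tss tsI; first by exists i.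
  have [||u Iu H] := IH; first by move: tss => /path_sorted.
    by move=> p pts; apply: tsI; rewrite in_cons pts orbT.
  have Iq : I q by apply: tsI; rewrite mem_head.
  have [v [Iv qv uv]] := left_end_directed Iq Iu.
  exists v => // p; rewrite in_cons => /predU1P[->//|/H pu]; exact: le_trans pu.
exists u => // s t Is It us st.
have tsS : sorted_in I (t :: s :: ts).
  apply: sorted_in_cons => //; first apply: sorted_in_cons => //.
    by move=> p /tsu pu; exact: le_trans pu.
  move=> p; rewrite in_cons => /predU1P[->//|/tsu pu].
  by apply: le_trans pu; exact: le_trans us.
have := le_curve_length d gamma tsS; rewrite lE lee_fin /= (metric_on_sym dM (gamma t)).
have : partition_sum d gamma ts <= polygon d gamma s ts.
  by case: (ts) => //= q r; rewrite lerDr (metric_on_ge0 dM).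
lra.
Qed.

End EndLimits.

Section UniformCurves.
Context {R : realType} {X : metricType R}.
Variable b : X -> R.
Hypothesis cX : complete_space X.
Hypothesis catX : CAT_minus1 X.
Hypothesis bP : distance_approximable b.
Local Notation d := (@mdist R X).
Local Notation D := (dist1 b).
Local Notation gp := (gromov_product b).
Local Notation k0 := (@lower_constant R).
Implicit Types (x y : nat -> X) (w : X) (p q : set (nat -> X)) (gamma : R -> X) (I : set R).

Let DM : metric_on setT D := dist1_metric catX bP.

Lemma complete_cauchy_sequence x :
  (forall e : R, 0 < e -> exists N, forall n m, (N <= n)%N -> (N <= m)%N -> d (x n) (x m) < e) ->
  exists w, forall e : R, 0 < e -> exists N, forall n, (N <= n)%N -> d (x n) w < e.
Proof.
move=> H; have [|w xw] := @cX (x @ \oo) _.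
  apply/cauchy_ballP => e e0; have [N HN] := H e e0.
  exists ([set a | exists2 n, (N <= n)%N & x n = a], [set a | exists2 n, (N <= n)%N & x n = a]).
    by split; exists N => // n /= Nn; exists n.
  move=> [a a'] [/= [n Nn <-] [m Nm <-]].
  by rewrite -metricType_numDomainType.ball_mdistE; exact: HN.
exists w => e e0.
have /metricType_numDomainType.cvgrPdist_lt/(_ e e0)[N _ HN] := xw.
by exists N => n Nn; rewrite metric_sym; exact: HN.
Qed.

Lemma dist1_le_local (a w : X) : d a w <= 1 -> D a w <= 24 * expR (1 - b a) * d a w.
Proof.
move=> aw1; apply: le_trans (dist1_le catX bP a w) _; rewrite min_r// mulrA.
rewrite ler_wpM2r ?mdist_ge0// ler_pM2l// ler_expR.
have := approximable_lipschitz bP a w; rewrite /gromov_product; lra.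
Qed.

(** First b tends to infinity along [x]. Otherwise b is bounded at arbitrarily late terms, around
    which small d_{1,b} forces small d; the sequence is then d-Cauchy, and by completeness its limit
    lies in X. After that, small d_{1,b} means either a large product or |xy| <= 1 at great
    height. *)
Lemma boundary_product_cvgy p x : metric_boundary D p -> p x ->
  forall C, exists N, forall n m, (N <= n)%N -> (N <= m)%N -> C <= gp (x n) (x m).
Proof.
move=> pB px; have [xc xlim] := metric_boundaryP DM pB px.
have k0_gt0 : 0 < k0 := lower_constant_gt0.
have {}xc := (cauchy_sequenceP DM x).1 xc.
have bx C : exists N, forall n, (N <= n)%N -> C < b (x n).
  apply: contrapT => nbx; have {}nbx N : exists2 n, (N <= n)%N & b (x n) <= C.
    apply: contrapT => H; apply: nbx; exists N => n Nn; rewrite ltNge; apply/negP => bC.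
    by apply: H; exists n.
  have close (e : R) : 0 < e -> exists N, forall n m, (N <= n)%N -> (N <= m)%N -> d (x n) (x m) < e.
    (* The cap at 1 lets min(1, d) < e' be read as d < e'. *)
    move=> e0; pose e' := Num.min 1 (e / 2).
    have e'0 : 0 < e' by rewrite lt_min ltr01 divr_gt0.
    have [N HN] := xc (k0 * (expR (- C) * e')) ltac:(by rewrite !mulr_gt0// expR_gt0).
    have [n Nn bC] := nbx N.
    have near_n m : (N <= m)%N -> d (x n) (x m) < e'.
      move=> Nm; have := le_lt_trans (dist1_ge catX bP (x n) (x m)) (HN n m Nn Nm).
      rewrite ltr_pM2l// => H.
      have : expR (- C) * Num.min 1 (d (x n) (x m)) < expR (- C) * e'.
        apply: le_lt_trans H; rewrite ler_wpM2r ?le_min ?ler01 ?mdist_ge0// ler_expR lerN2.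
        exact: le_trans (gromov_product_le bP _ _) bC.
      rewrite ltr_pM2l ?expR_gt0// gt_min => /orP[|//].
      by rewrite ltNge ge_min lexx.
    have e'e : e' <= e / 2 by rewrite ge_min lexx orbT.
    exists N => m m' /near_n H1 /near_n H2.
    by have := metric_triangle (x m) (x n) (x m'); rewrite (metric_sym (x m) (x n)); lra.
  have [w xw] := complete_cauchy_sequence close; apply: (xlim w) => e e0.
  have K0 : 0 < 24 * expR (1 - b w) by rewrite mulr_gt0// expR_gt0.
  have [|N HN] := xw (Num.min 1 (e / (24 * expR (1 - b w)))).
    by rewrite lt_min ltr01 divr_gt0.
  exists N => n /HN; rewrite metric_sym lt_min => /andP[/ltW xw1].
  rewrite ltr_pdivlMr// mulrC (metric_on_sym DM); exact: le_lt_trans (dist1_le_local xw1).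
(* The extra 1 covers terms at distance at most 1, where the product is at least b - 1. *)
move=> C; have [N HN] := bx (C + 1).
have [M HM] := xc (k0 * expR (- C)) ltac:(by rewrite mulr_gt0// expR_gt0).
exists (maxn N M) => n m; rewrite !geq_max => /andP[/HN bn Mn] /andP[_ Mm].
have [l1|l1] := leP (d (x n) (x m)) 1.
  by have := approximable_lipschitz bP (x n) (x m); rewrite /gromov_product; lra.
have := le_lt_trans (dist1_ge catX bP (x n) (x m)) (HM n m Mn Mm).
by rewrite min_l ?(ltW l1)// mulr1 ltr_pM2l// ltr_expR ltrN2 => /ltW.
Qed.

(** A sequence tending to a boundary point eventually has height at least b w + 1. It is then at
    distance at least 1 from [w], and its product with [w] is at most b w, so [dist1_ge] applies. *)
Lemma boundary_dist_ge w : ((k0 * expR (- b w))%:E <= boundary_dist D w)%E.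
Proof.
apply: le_ereal_inf_tmp => _ [p pB <-]; rewrite lee_fin.
have pc : completion D p by case: pB.
have [x px _] := completionP DM pc.
have k0_gt0 : 0 < k0 := lower_constant_gt0.
apply: (completion_dist_ge DM (to_completion_completion DM w) pc (to_completion_cst DM w) px).
move=> e e0; have [N HN] := boundary_product_cvgy pB px (b w + 1).
exists N => n Nn; have := HN n n Nn Nn; rewrite {1}/gromov_product mdistxx subr0 => bn.
have wn : 1 <= d w (x n).
  by have := approximable_lipschitz bP (x n) w; rewrite (metric_sym (x n)); lra.
have := dist1_ge catX bP w (x n); rewrite min_l// mulr1.
have : expR (- b w) <= expR (- gp w (x n)).
  by rewrite ler_expR lerN2; exact: (gromov_product_le bP).
by nra.
Qed.

(** If both sides failed, at [s] and at [u], the points s, t, u would contradict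
    [approximable_between]; its 6 is halved in the product. *)
Lemma geodesic_one_sided I gamma t : geodesic d I gamma -> I t ->
  (forall s, I s -> s <= t -> b (gamma t) - 3 <= gp (gamma s) (gamma t)) \/
  (forall s, I s -> t <= s -> b (gamma t) - 3 <= gp (gamma t) (gamma s)).
Proof.
move=> [_ _ gE] It.
have [|nH] := pselect (forall s, I s -> s <= t -> b (gamma t) - 3 <= gp (gamma s) (gamma t)).
  by left.
right=> u Iu tu; rewrite leNgt; apply/negP => ub; apply: nH => s Is st.
rewrite leNgt; apply/negP => sb.
have E : d (gamma s) (gamma u) = d (gamma s) (gamma t) + d (gamma t) (gamma u).
  by rewrite !gE// ler0_norm ?ler0_norm ?ler0_norm ?subr_le0//; [lra|exact: le_trans tu].
by case: (approximable_between catX bP E); move: ub sb; rewrite /gromov_product; lra.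
Qed.

Lemma half_geodesic_length I J gamma t : geodesic d I gamma -> I t -> J `<=` I ->
  (forall ts, ts != [::] -> sorted_in J ts -> exists s u, [/\ I s, I u, s <= u,
    sorted_in `[s, u] ts & b (gamma t) - 3 <= gp (gamma s) (gamma u)]) ->
  (curve_length D gamma J <= (24 * expR (3 - b (gamma t)))%:E)%E.
Proof.
move=> gG It JI H; apply: curve_length_le => ts tsJ; rewrite lee_fin.
have [->|ts0] := eqVneq ts [::]; first by rewrite /= mulr_ge0// expR_ge0.
have [s [u [Is Iu su tsI gsu]]] := H ts ts0 tsJ.
apply: le_trans (partition_sum_geodesic catX bP gG Is Iu su tsI) _.
rewrite ler_pM2l//; apply: (@le_trans _ _ (expR (- gp (gamma s) (gamma u)))).
  by rewrite ler_piMr ?expR_ge0// ge_min lexx.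
by rewrite ler_expR; lra.
Qed.

Lemma sorted_in_bounds I ts : ts != [::] -> sorted_in I ts -> exists s u,
  [/\ I s, I u, s <= u & sorted_in `[s, u] ts].
Proof.
case: ts => // s ts _ [tss tsI]; exists s, (last s ts).
have hd v : v \in s :: ts -> s <= v.
  rewrite in_cons => /predU1P[->//|vts]; move: tss.
  by rewrite /= (path_sortedE (@le_trans _ _)) => /andP[/allP/(_ v vts)].
have tl : forall v, v \in s :: ts -> v <= last s ts.
  elim: ts s tss {tsI hd} => [|u ts IH] s /=; first by move=> _ v; rewrite inE => /eqP->.
  move=> /andP[su uts] v; rewrite in_cons => /predU1P[->|]; last exact: IH.
  by apply: le_trans su _; apply: IH => //; rewrite mem_head.
split; [by apply: tsI; rewrite mem_head|by apply: tsI; rewrite mem_last| |].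
  by apply: tl; rewrite mem_head.
by split=> // v vts; rewrite /= in_itv/= hd// tl.
Qed.

Lemma sorted_in_itv_sub (s s' u u' : R) ts : s' <= s -> u <= u' ->
  sorted_in `[s, u] ts -> sorted_in `[s', u'] ts.
Proof.
by move=> ss uu [tss tsI]; split=> // v /tsI; apply: itv_subset.
Qed.

(** The factor e^3 comes from the 3 in [geodesic_one_sided]; 24 / k0 is the ratio of the upper to
    the lower bound for d_{1,b}. *)
Definition uniform_constant : R := 24 * expR 3 / k0.

Lemma uniform_constant_ge : 24 / k0 <= uniform_constant.
Proof.
rewrite ler_pM2r ?invr_gt0 ?lower_constant_gt0// ler_peMr//.
by have := expR_ge1Dx (3 : R); lra.
Qed.

Lemma geodesic_partition_le I gamma s t ts : geodesic d I gamma -> I s -> I t -> s <= t ->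
  sorted_in `[s, t] ts ->
  partition_sum D gamma ts <= uniform_constant * D (gamma s) (gamma t).
Proof.
move=> gG Is It st tsI; have k0_gt0 : 0 < k0 := lower_constant_gt0.
apply: le_trans (partition_sum_geodesic catX bP gG Is It st tsI) _.
apply: (@le_trans _ _ (24 / k0 * D (gamma s) (gamma t))); last first.
  by rewrite ler_wpM2r ?(metric_on_ge0 DM)// uniform_constant_ge.
by rewrite -mulrA ler_pM2l// ler_pdivlMl//; exact: dist1_ge.
Qed.

Lemma geodesic_dist1_curve I gamma : geodesic d I gamma -> curve D I gamma.
Proof.
move=> [II I0 gE]; split=> // t It; apply/cvgrPdist_lt => e e0.
have K0 : 0 < 24 * expR (1 - b (gamma t)) by rewrite mulr_gt0// expR_gt0.
rewrite near_withinE; apply/nbhs_ballP.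
exists (Num.min 1 (e / (24 * expR (1 - b (gamma t))))) => /=.
  by rewrite lt_min ltr01 divr_gt0.
move=> s; rewrite /ball/= lt_min => /andP[/ltW ts1 ts Is].
rewrite sub0r normrN ger0_norm ?(metric_on_ge0 DM)//.
apply: le_lt_trans (dist1_le_local _) _; first by rewrite gE.
by rewrite mulrC -ltr_pdivlMr// gE.
Qed.

Lemma geodesic_half_condition I gamma t : geodesic d I gamma -> I t ->
  (Order.min (curve_length D gamma [set s | I s /\ (s <= t)%R])
             (curve_length D gamma [set s | I s /\ (t <= s)%R])
   <= uniform_constant%:E * boundary_dist D (gamma t))%E.
Proof.
move=> gG It; have k0_gt0 : 0 < k0 := lower_constant_gt0.
apply: (@le_trans _ _ (24 * expR (3 - b (gamma t)))%:E); last first.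
  apply: (@le_trans _ _ (uniform_constant%:E * (k0 * expR (- b (gamma t)))%:E)%E).
    rewrite -EFinM lee_fin expRD /uniform_constant le_eqVlt; apply/orP; left; apply/eqP.
    by field; rewrite gt_eqF.
  apply: lee_wpmul2l; last exact: boundary_dist_ge.
  by rewrite lee_fin divr_ge0 ?mulr_ge0 ?expR_ge0// ltW.
rewrite ge_min; apply/orP.
have [H|H] := geodesic_one_sided gG It; [left|right].
  apply: (half_geodesic_length gG It); first by move=> s [].
  move=> ts ts0 tsJ; have [s [u [[Is st] [Iu ut] su tsI]]] := sorted_in_bounds ts0 tsJ.
  by exists s, t; split=> //; [exact: sorted_in_itv_sub tsI|exact: H].
apply: (half_geodesic_length gG It); first by move=> s [].
move=> ts ts0 tsJ; have [s [u [[Is st] [Iu ut] su tsI]]] := sorted_in_bounds ts0 tsJ.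
by exists t, u; split=> //; [exact: sorted_in_itv_sub tsI|exact: H].
Qed.

Lemma geodesic_uniform I gamma : geodesic d I gamma -> uniform_curve D uniform_constant I gamma.
Proof.
move=> gG; have [II I0 gE] := gG.
have A0 : 0 < uniform_constant.
  by rewrite /uniform_constant divr_gt0 ?mulr_gt0 ?expR_gt0 ?lower_constant_gt0.
have D0 := metric_on_ge0 DM.
split; first exact: geodesic_dist1_curve.
- move=> fin.
  have [p [pc pl]] := left_end_limit DM I0 fin.
  have [q [qc ql]] := right_end_limit DM I0 fin.
  exists p, q; split=> //; apply: curve_length_le => ts tsI; rewrite lee_fin.
  have [P0 _ PC PT] := completion_metric DM.
  have [->|ts0] := eqVneq ts [::]; first by rewrite /= mulr_ge0 ?(ltW A0)// P0.
  have [s0 [u0 [Is0 Iu0 su0 tsI0]]] := sorted_in_bounds ts0 tsI.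
  (* Each end contributes an error e' to the distance, multiplied by the uniformity constant. *)
  apply/ler_addgt0Pr => e e0; pose e' := e / (2 * uniform_constant).
  have e'0 : 0 < e' by rewrite divr_gt0// mulr_gt0.
  have FL := left_end_filter I0; have FR := right_end_filter I0.
  have /cvgrPdist_lt/(_ e' e'0)[s1 Is1 Hs1] := pl.
  have /cvgrPdist_lt/(_ e' e'0)[u1 Iu1 Hu1] := ql.
  have [s [Is ss0 ss1]] := left_end_directed Is0 Is1.
  have [u [Iu uu0 uu1]] := right_end_directed Iu0 Iu1.
  have su : s <= u by apply: le_trans ss0 _; exact: le_trans uu0.
  have := geodesic_partition_le gG Is Iu su (sorted_in_itv_sub ss0 uu0 tsI0).
  have : D (gamma s) (gamma u) <= completion_dist D p q + 2 * e'.
    rewrite -(completion_dist_points DM).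
    have sc := to_completion_completion DM (gamma s).
    have uc := to_completion_completion DM (gamma u).
    have := Hs1 s; rewrite /= => /(_ (conj Is ss1)); rewrite sub0r normrN ger0_norm ?P0//.
    have := Hu1 u; rewrite /= => /(_ (conj Iu uu1)); rewrite sub0r normrN ger0_norm ?P0//.
    have := PT _ _ _ sc pc uc; have := PT _ _ _ pc qc uc; rewrite (PC q _ qc uc); lra.
  move=> H1 H2; apply: (le_trans H2).
  apply: le_trans (ler_wpM2l (ltW A0) H1) _.
  rewrite mulrDr lerD2l /e' le_eqVlt; apply/orP; left; apply/eqP.
  by field; rewrite gt_eqF.
- move=> inf; have FL := left_end_filter I0; have FR := right_end_filter I0.
  apply/cvgryPge => C.
  (* The maximum with 0 excludes the empty partition. *)
  have [|ts tsI tsC] := @curve_length_gt R X D gamma I (uniform_constant * Num.max 0 C).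
    by rewrite inf ltry.
  have ts0 : ts != [::].
    apply: contraTneq tsC => ->; rewrite /= -leNgt mulr_ge0 ?(ltW A0)//.
    by rewrite le_max lexx.
  have [s0 [u0 [Is0 Iu0 su0 tsI0]]] := sorted_in_bounds ts0 tsI.
  exists ([set s | I s /\ s <= s0], [set u | I u /\ u0 <= u]).
    by split; [exists s0|exists u0].
  move=> [s u] [/= [Is ss0] [Iu uu0]].
  have su : s <= u by apply: le_trans ss0 _; exact: le_trans uu0.
  have := lt_le_trans tsC (geodesic_partition_le gG Is Iu su (sorted_in_itv_sub ss0 uu0 tsI0)).
  rewrite ltr_pM2l// => /ltW; apply: le_trans.
  by rewrite le_max lexx orbT.
- by move=> t It; exact: geodesic_half_condition.
Qed.

Lemma dist1_uniform_space : metric_boundary D !=set0 -> uniform_space D uniform_constant.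
Proof.
move=> bd; split=> // x y; have [S [gamma [gG g0 gl _]]] := catX.1 x y.
by exists 0, (d x y), gamma; split=> //; [exact: mdist_ge0|exact: geodesic_uniform].
Qed.

End UniformCurves.

(** * Boundaries and the canonical map *)

Section LimInf.
Context {R : realType}.
Implicit Types (u : nat -> \bar R) (c : \bar R).
Local Open Scope ereal_scope.

Lemma limn_einfE u : limn_einf u = ereal_sup (range (einfs u)).
Proof. by rewrite limn_einf_lim; apply/cvg_lim => //; exact: cvg_einfs_sup. Qed.

Lemma limn_einf_ge u c N : (forall n, (N <= n)%N -> c <= u n) -> c <= limn_einf u.
Proof.
move=> H; rewrite limn_einfE; apply: (@le_trans _ _ (einfs u N)).
  by apply: le_ereal_inf_tmp => _ [n /= Nn <-]; exact: H.
by apply: ereal_sup_ubound; exists N.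
Qed.

Lemma limn_einf_le u c N : (forall n, (N <= n)%N -> u n <= c) -> limn_einf u <= c.
Proof.
move=> H; rewrite limn_einfE; apply: ge_ereal_sup => _ [m _ <-].
apply: le_trans (H (maxn m N) (leq_maxr _ _)).
by apply: ereal_inf_lbound; exists (maxn m N) => //=; exact: leq_maxl.
Qed.

End LimInf.

Section GromovBoundary.
Context {R : realType} {X : metricType R}.
Hypothesis catX : CAT_minus1 X.
Local Notation d := (@mdist R X).
Local Notation gpa := gromov_product_at.
Implicit Types (x y z : nat -> X) (p w : X) (gamma : R -> X) (C : R).

Lemma gromov_product_at_basepoint p w a c : gpa p a c - d p w <= gpa w a c.
Proof.
rewrite /gromov_product_at /gromov_product.
have := metric_triangle a w p; have := metric_triangle c w p.
rewrite (metric_sym w p); lra.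
Qed.

Lemma gromov_product_atC p a c : gpa p a c = gpa p c a.
Proof. by rewrite /gromov_product_at /gromov_product (metric_sym a c); lra. Qed.

Lemma gromov_product_at_hyperbolic p a c w C :
  C + 3 <= gpa p a w -> C + 3 <= gpa p w c -> C <= gpa p a c.
Proof.
move=> H1 H2; apply: le_trans (gromov_hyperbolic catX p a c w).
by rewrite lerBrDr le_min H1.
Qed.

Lemma converges_to_infinityP p x : converges_to_infinity x <->
  forall C, exists N, forall n m, (N <= n)%N -> (N <= m)%N -> C <= gpa p (x n) (x m).
Proof.
split=> [/(_ p)/(cvgy_seq2P (fun n => gpa p (x n.1) (x n.2)))//|H q].
apply/(cvgy_seq2P (fun n => gpa q (x n.1) (x n.2))) => C.
have [N HN] := H (C + d p q); exists N => n m Nn Nm.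
by have := HN n m Nn Nm; have := gromov_product_at_basepoint p q (x n) (x m); rewrite /=; lra.
Qed.

Lemma gromov_classP p x y : gromov_class x y <-> converges_to_infinity y /\
  forall C, exists N, forall n, (N <= n)%N -> C <= gpa p (x n) (y n).
Proof.
split=> -[yc H]; split=> //; first by have /cvgy_seqP := H p.
move=> q; apply/cvgy_seqP => C; have [N HN] := H (C + d p q); exists N => n Nn.
by have := HN n Nn; have := gromov_product_at_basepoint p q (x n) (y n); lra.
Qed.

Lemma gromov_class_refl x : converges_to_infinity x -> gromov_class x x.
Proof.
move=> xc; apply/(gromov_classP (x 0%N)); split=> // C.
have [N HN] := (converges_to_infinityP (x 0%N) x).1 xc C.
by exists N => n Nn; exact: HN.
Qed.

Lemma gromov_class_eq x y : gromov_class x y -> gromov_class y = gromov_class x.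
Proof.
move=> /(gromov_classP (x 0%N))[yc xy].
apply/seteqP; split=> z /(gromov_classP (x 0%N))[zc yz];
  apply/(gromov_classP (x 0%N)); split=> // C;
  have [N HN] := xy (C + 3); have [M HM] := yz (C + 3);
  exists (maxn N M) => n; rewrite geq_max => /andP[/HN H1 /HM H2].
- exact: gromov_product_at_hyperbolic H1 H2.
- by apply: gromov_product_at_hyperbolic H2; rewrite gromov_product_atC.
Qed.

Lemma gromov_boundaryP xi x : gromov_boundary xi -> xi x ->
  converges_to_infinity x /\ xi = gromov_class x.
Proof.
by move=> [y yc ->] yx; rewrite (gromov_class_eq yx); split=> //; case: yx.
Qed.

Lemma geodesic_ray_product gamma m n : geodesic_ray gamma ->
  gpa (gamma 0) (gamma m%:R) (gamma n%:R) = (minn m n)%:R.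
Proof.
move=> ray; rewrite /gromov_product_at /gromov_product !geodesic_rayE// !subr0 !normr_nat.
have [mn|/ltnW mn] := leqP m n; [rewrite distrC|];
  rewrite ger0_norm ?subr_ge0 ?ler_nat//; move: (m%:R) (n%:R) => a c; lra.
Qed.

Lemma geodesic_ray_converges gamma : geodesic_ray gamma ->
  converges_to_infinity (fun n => gamma n%:R).
Proof.
move=> ray; apply/(converges_to_infinityP (gamma 0)) => C.
exists (Num.truncn C).+1 => n m Nn Nm; rewrite geodesic_ray_product//.
apply/ltW; apply: lt_le_trans (truncnS_gt C) _.
by rewrite ler_nat leq_min Nn.
Qed.

Lemma ray_class_boundary gamma : geodesic_ray gamma -> gromov_boundary (ray_class gamma).
Proof. by move=> ray; exists (fun n => gamma n%:R) => //; exact: geodesic_ray_converges. Qed.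

Section Basepoint.
Variables (b : X -> R) (omega : basepoint X).
Hypothesis hb : has_basepoint b omega.
Let bP : distance_approximable b := has_basepoint_approximable hb.
Local Notation gp := (gromov_product b).
Local Notation ge := (gromov_product_end b).

Lemma punctured_gromov_boundary xi : punctured_boundary omega xi -> gromov_boundary xi.
Proof. by case: (omega) => [z//|w] []. Qed.

Lemma gromov_product_end_ray gamma s n : geodesic_ray gamma ->
  b = (fun a => busemann gamma a + s) -> ge (gamma 0) (gamma n%:R) = n%:R.
Proof.
move=> ray ->; rewrite /gromov_product_end !busemann_ray// geodesic_rayE//.
by rewrite subr0 normr_nat; move: (n%:R) => a; lra.
Qed.

(** For a basepoint [z] in X the product vanishes at p = z. For one at infinity, unboundedness would
    make the product tend to infinity, and [x] would be equivalent to the ray that defines [b]. *)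
Lemma punctured_end_bounded xi x : punctured_boundary omega xi -> xi x ->
  exists p C N, forall n, (N <= n)%N -> ge p (x n) <= C.
Proof.
move=> xiB xix; have [xc xiE] := gromov_boundaryP (punctured_gromov_boundary xiB) xix.
move: hb xiB; case: (omega) => [z|w] /=.
  move=> [s bE] _; exists z, 0, 0%N => n _.
  by rewrite /gromov_product_end bE mdistxx; lra.
move=> [gamma [s [ray bE wE]]] [_ xiw]; exists (gamma 0).
apply: contrapT => nb; apply: xiw.
have {nb} nb C N : exists2 n, (N <= n)%N & C < ge (gamma 0) (x n).
  apply: contrapT => H; apply: nb; exists C, N => n Nn; rewrite leNgt; apply/negP => Cn.
  by apply: H; exists n.
(* One large value, at an index [m], spreads to all large [n] because (x n|x m) is large as well. *)
have gy C : exists N, forall n, (N <= n)%N -> C <= ge (gamma 0) (x n).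
  have [N HN] := (converges_to_infinityP (gamma 0) x).1 xc (C + 3).
  have [m Nm Cm] := nb (C + 3) N; exists N => n Nn.
  have := gromov_product_end_hyperbolic catX bP (gamma 0) (x n) (x m).
  by apply: le_trans; rewrite lerBrDr le_min HN// ltW.
rewrite wE /ray_class xiE; apply/esym/gromov_class_eq.
apply/(gromov_classP (gamma 0)); split; first exact: geodesic_ray_converges.
move=> C; have [N HN] := gy (C + 3).
exists (maxn N (Num.truncn (C + 3)).+1) => n; rewrite geq_max => /andP[/HN H1 Nn].
have := gromov_product_at_end_hyperbolic catX bP (gamma 0) (x n) (gamma n%:R).
apply: le_trans; rewrite lerBrDr le_min H1/= (gromov_product_end_ray _ ray bE).
by apply/ltW; apply: lt_le_trans (truncnS_gt _) _; rewrite ler_nat.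
Qed.

Lemma punctured_product_cvgy xi x y : punctured_boundary omega xi -> xi x -> xi y ->
  forall C, exists N, forall n, (N <= n)%N -> C <= gp (x n) (y n).
Proof.
move=> xiB xix xiy C; have xiG := punctured_gromov_boundary xiB.
have [p [C1 [N1 H1]]] := punctured_end_bounded xiB xix.
have [xc xiE] := gromov_boundaryP xiG xix; rewrite xiE in xiy.
have [yc /(_ (C + 2 * (C1 + 3) + C1 - b p + C1 + 9))[N HN]] := (gromov_classP p x y).1 xiy.
(* A product above C1 + 3 makes the other term the minimum in the four-point inequality, which
   bounds the end product of y n by C1 + 3. *)
have [_ /(_ (C1 + 4))[M HM]] := (gromov_classP p x y).1 xiy.
exists (maxn N1 (maxn N M)) => n; rewrite !geq_max => /and3P[/H1 gx /HN xyn /HM xyn'].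
have : ge p (y n) <= C1 + 3.
  have := gromov_product_end_hyperbolic catX bP p (x n) (y n).
  rewrite lerBlDr ge_min => /orP[|]; lra.
rewrite (gromov_product_endE b p).
have := gromov_product_end_ge0 bP p (x n); have := gromov_product_end_ge0 bP p (y n).
lra.
Qed.

Lemma punctured_product_cvgy2 xi x : punctured_boundary omega xi -> xi x ->
  forall C, exists N, forall n m, (N <= n)%N -> (N <= m)%N -> C <= gp (x n) (x m).
Proof.
move=> xiB xix C; have xiG := punctured_gromov_boundary xiB.
have [p [C1 [N1 H1]]] := punctured_end_bounded xiB xix.
have [xc _] := gromov_boundaryP xiG xix.
have [N HN] := (converges_to_infinityP p x).1 xc (C + 2 * C1 - b p).
exists (maxn N1 N) => n m; rewrite !geq_max => /andP[/H1 gn Nn] /andP[/H1 gm Nm].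
by have := HN n m Nn Nm; rewrite (gromov_product_endE b p); lra.
Qed.

Lemma product_cvgy_punctured x :
  (forall C, exists N, forall n m, (N <= n)%N -> (N <= m)%N -> C <= gp (x n) (x m)) ->
  converges_to_infinity x /\ punctured_boundary omega (gromov_class x).
Proof.
move=> H; have xc : converges_to_infinity x.
  apply/(converges_to_infinityP (x 0%N)) => C; have [N HN] := H (C + b (x 0%N)).
  exists N => n m Nn Nm; have := HN n m Nn Nm.
  by have := gromov_product_at_ge bP (x 0%N) (x n) (x m); lra.
have xG : gromov_boundary (gromov_class x) by exists x.
split=> //; move: hb; case: (omega) => [//|w] /= [gamma [s [ray bE wE]]].
split=> // xw; have gx : gromov_class x (fun n => gamma n%:R).
  by rewrite xw wE; apply: gromov_class_refl; exact: geodesic_ray_converges.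
have gy C : exists N, forall n, (N <= n)%N -> C <= ge (gamma 0) (x n).
  have [_ /(_ (C + 3))[N HN]] := (gromov_classP (gamma 0) _ _).1 gx.
  exists (maxn N (Num.truncn (C + 3)).+1) => n; rewrite geq_max => /andP[/HN H1 Nn].
  have := gromov_product_end_hyperbolic catX bP (gamma 0) (x n) (gamma n%:R).
  apply: le_trans; rewrite lerBrDr le_min H1/= (gromov_product_end_ray _ ray bE).
  by apply/ltW; apply: lt_le_trans (truncnS_gt _) _; rewrite ler_nat.
(* Fix x N. If the end product of x m is large, the four-point inequality bounds the product of x N
   and x m at gamma 0, and [gromov_product_endE] makes (x N|x m)_b negative, against the choice of
   [N]. *)
have [N HN] := H 0.
have [M HM] := gy (ge (gamma 0) (x N) + 4 + `|b (gamma 0)|).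
pose m := maxn N M.
have := HN N m (leqnn _) (leq_maxl _ _); have := HM m (leq_maxr _ _).
have := gromov_product_end_hyperbolic catX bP (gamma 0) (x N) (x m).
rewrite (gromov_product_endE b (gamma 0)) lerBlDr ge_min => /orP[|].
  by have := ler_norm (b (gamma 0)); have := gromov_product_end_ge0 bP (gamma 0) (x N); lra.
by have := normr_ge0 (b (gamma 0)); lra.
Qed.

(** Provides a boundary point, so that the deformed space is incomplete. For a basepoint at infinity
    it is the positive end of a line: (gamma n|gamma (-n)) at gamma 0 is 0, so the two ends
    differ. *)
Lemma starlike_punctured_nonempty K : roughly_starlike K omega ->
  punctured_boundary omega !=set0.
Proof.
move: hb; case: (omega) => [z|w] /=.
  move=> _ [/(_ z)[gamma [ray _ _]] _].
  by exists (ray_class gamma); exact: ray_class_boundary.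
move=> [gamma0 [s [ray0 bE wE]]] [/(_ (gamma0 0))[gamma [line _ wg]] _].
have ray : geodesic_ray gamma.
  case: line => _ _ gE; split; first exact: interval_is_interval.
    by exists 0; rewrite /= in_itv/= lexx.
  by move=> ? ? _ _; exact: gE.
exists (ray_class gamma); split; first exact: ray_class_boundary.
move=> gw; move: wg; rewrite -gw => /(gromov_classP (gamma 0))[_ /(_ 1)[N HN]].
have := HN N (leqnn _); rewrite /gromov_product_at /gromov_product.
case: line => _ _ gE; rewrite !gE// !subr0 normrN opprK.
rewrite ger0_norm// (@ger0_norm _ (N%:R + N%:R)) ?addr_ge0//.
move: (N%:R) => a; lra.
Qed.

End Basepoint.

End GromovBoundary.

Section CanonicalMap.
Context {R : realType} {X : metricType R}.
Variables (b : X -> R) (omega : basepoint X).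
Hypothesis cX : complete_space X.
Hypothesis catX : CAT_minus1 X.
Hypothesis hb : has_basepoint b omega.
Local Notation d := (@mdist R X).
Local Notation D := (dist1 b).
Local Notation gp := (gromov_product b).
Local Notation k0 := (@lower_constant R).
Local Notation phi := (canonical_map b).
Implicit Types (x y : nat -> X) (xi zeta p q : set (nat -> X)) (C e : R).

Let bP : distance_approximable b := has_basepoint_approximable hb.
Let DM : metric_on setT D := dist1_metric catX bP.
Let k0_gt0 : 0 < k0 := @lower_constant_gt0 R.

Lemma expR_small e : 0 < e -> exists C : R, forall h, C <= h -> 24 * expR (- h) < e.
Proof.
move=> e0; exists (1 - ln (e / 24)) => h Ch; rewrite -ltr_pdivlMl// mulrC.
rewrite -[ltRHS]lnK ?posrE ?divr_gt0// ltr_expR; lra.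
Qed.

Lemma punctured_cauchy xi x : punctured_boundary omega xi -> xi x -> cauchy_sequence D x.
Proof.
move=> xiB xix; apply/(cauchy_sequenceP DM) => e /expR_small[C HC].
have [N HN] := punctured_product_cvgy2 catX hb xiB xix C.
by exists N => n m Nn Nm; apply: le_lt_trans (dist1_le_product catX bP _ _) (HC _ (HN n m Nn Nm)).
Qed.

Lemma canonical_map_converges xi x : punctured_boundary omega xi -> xi x ->
  converges_in_completion b x (phi xi).
Proof.
move=> xiB; move: x; rewrite /canonical_map.
(* The default is ruled out: the Cauchy class of [x] is a limit common to all sequences in [xi]. *)
case: xgetP => [p _ //|/(_ _)H] x xix; exfalso.
have xc := punctured_cauchy xiB xix.
apply: (H (cauchy_class D x)) => y xiy; split; first exact: completion_cauchy_class.
have yc := punctured_cauchy xiB xiy.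
suff <- : cauchy_class D y = cauchy_class D x by exact: cauchy_class_limit.
apply: (cauchy_class_eq DM); split=> //; apply/(dist_cvg0P DM) => e /expR_small[C HC].
have [N HN] := punctured_product_cvgy catX hb xiB xix xiy C.
by exists N => n /HN /HC; apply: le_lt_trans; exact: dist1_le_product.
Qed.

Lemma canonical_map_mem xi x : punctured_boundary omega xi -> xi x -> phi xi x.
Proof.
by move=> xiB xix; have [pc xp] := canonical_map_converges xiB xix; exact: (limit_mem DM pc xp).
Qed.

Lemma punctured_inhabited xi : punctured_boundary omega xi -> exists x, xi x.
Proof. by move=> /punctured_gromov_boundary[x xc ->]; exists x; exact: gromov_class_refl. Qed.

Lemma canonical_map_completion xi : punctured_boundary omega xi -> completion D (phi xi).
Proof.
by move=> xiB; have [x xix] := punctured_inhabited xiB; have [] := canonical_map_converges xiB xix.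
Qed.

Lemma canonical_map_boundary xi : punctured_boundary omega xi -> metric_boundary D (phi xi).
Proof.
move=> xiB; have [x xix] := punctured_inhabited xiB.
have px := canonical_map_mem xiB xix.
have [_ _ Hp] := completionP DM (canonical_map_completion xiB).
have [xc ->] := Hp x px.
apply: (metric_boundary_cauchy_class DM xc) => a xa.
have [|N HN] := xa (k0 * expR (- b a)); first by rewrite mulr_gt0// expR_gt0.
have [M HM] := punctured_product_cvgy catX hb xiB xix xix (b a + 1).
pose n := maxn N M; have := HM n (leq_maxr _ _); rewrite /gromov_product mdistxx subr0 => bn.
have far : 1 <= d (x n) a by have := approximable_lipschitz bP (x n) a; lra.
have := le_lt_trans (dist1_ge catX bP (x n) a) (HN n (leq_maxl _ _)).
rewrite min_l// mulr1 ltr_pM2l// ltr_expR ltrN2 gromov_productC ltNge.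
by rewrite (gromov_product_le bP).
Qed.

(** Either |xy| <= 1 and the height of x n makes the product large, or [dist1_ge] can be inverted.
    Serves both injectivity and one of the visual bounds. *)
Lemma near_points_product x y e : 0 < e ->
  (forall C, exists N, forall n, (N <= n)%N -> C <= b (x n)) ->
  (exists N, forall n, (N <= n)%N -> D (x n) (y n) < e) ->
  exists N, forall n, (N <= n)%N -> - ln (e / k0) <= gp (x n) (y n).
Proof.
move=> e0 bx [N HN]; have [M HM] := bx (1 - ln (e / k0)).
exists (maxn N M) => n; rewrite geq_max => /andP[/HN xyn /HM bn].
have [l1|l1] := leP (d (x n) (y n)) 1.
  by have := approximable_lipschitz bP (x n) (y n); rewrite /gromov_product; lra.
have := le_lt_trans (dist1_ge catX bP (x n) (y n)) xyn.
rewrite min_l ?(ltW l1)// mulr1 mulrC -ltr_pdivlMr// => /ltW.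
by rewrite -[leRHS]lnK ?posrE ?divr_gt0// ler_expR lerNl.
Qed.

Lemma punctured_height xi x : punctured_boundary omega xi -> xi x ->
  forall C, exists N, forall n, (N <= n)%N -> C <= b (x n).
Proof.
move=> xiB xix C; have [N HN] := punctured_product_cvgy catX hb xiB xix xix C.
by exists N => n /HN; rewrite /gromov_product mdistxx; lra.
Qed.

Lemma canonical_map_inj xi zeta : punctured_boundary omega xi ->
  punctured_boundary omega zeta -> phi xi = phi zeta -> xi = zeta.
Proof.
move=> xiB zetaB xizeta.
have [x xix] := punctured_inhabited xiB; have [y zetay] := punctured_inhabited zetaB.
have px := canonical_map_mem xiB xix; have py := canonical_map_mem zetaB zetay.
have [_ _ Hp] := completionP DM (canonical_map_completion xiB).
have [xc pE] := Hp x px; rewrite -xizeta pE in py; have [_ /(dist_cvg0P DM) xy] := py.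
have [_ ->] := gromov_boundaryP catX (punctured_gromov_boundary xiB) xix.
have [yc ->] := gromov_boundaryP catX (punctured_gromov_boundary zetaB) zetay.
apply/esym/(gromov_class_eq catX)/(gromov_classP (x 0%N)); split=> // C.
(* Chosen so that - ln (e / k0) is C + b (x 0); the last term is lost in passing to products at x
   0. *)
have e0 : 0 < k0 * expR (- (C + b (x 0%N))) by rewrite mulr_gt0// expR_gt0.
have [N HN] := near_points_product e0 (punctured_height xiB xix) (xy _ e0).
exists N => n /HN; rewrite (mulrC k0) mulfK ?gt_eqF// expRK opprK => H.
by have := gromov_product_at_ge bP (x 0%N) (x n) (y n); lra.
Qed.

Lemma canonical_map_surj q : metric_boundary D q ->
  exists2 xi, punctured_boundary omega xi & phi xi = q.
Proof.
move=> qB; have qc : completion D q by case: qB.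
have [x qx Hq] := completionP DM qc.
have gx := boundary_product_cvgy cX catX bP qB qx.
have [xc xB] := product_cvgy_punctured catX hb gx.
exists (gromov_class x) => //.
have := canonical_map_mem xB (gromov_class_refl xc).
have [_ _ Hp] := completionP DM (canonical_map_completion xB).
by move=> /Hp[_ ->]; have [_ ->] := Hq x qx.
Qed.

Lemma canonical_map_bij : set_bij (punctured_boundary omega) (metric_boundary D) phi.
Proof.
split.
- exact: canonical_map_boundary.
- by move=> xi zeta; rewrite !inE; exact: canonical_map_inj.
- by move=> q /canonical_map_surj[xi xiB <-]; exists xi.
Qed.

(** The estimates are theta <= Delta / k0 and Delta <= 48 theta, where 48 is twice 24 because Delta
    / 2 bounds the approximating distances from below. As k0 <= 1, the value 48 / k0 serves for
    both. *)
Definition visual_constant : R := 48 / k0.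

Lemma canonical_map_visual : visual_metric b omega visual_constant
  (fun xi zeta => completion_dist D (phi xi) (phi zeta)).
Proof.
have [P0 PE PC PT] := completion_metric DM.
have V0 : 0 < visual_constant by rewrite divr_gt0.
split.
  split=> [xi zeta /canonical_map_completion xc /canonical_map_completion zc
    |xi zeta xB zB|xi zeta /canonical_map_completion xc /canonical_map_completion zc|].
  - exact: P0.
  - have xc := canonical_map_completion xB; have zc := canonical_map_completion zB.
    split=> [/(PE _ _ xc zc)|->]; first exact: canonical_map_inj.
    exact/(PE _ _ zc zc).
  - exact: PC.
  - move=> xi zeta eta /canonical_map_completion xc /canonical_map_completion zc.
    by move=> /canonical_map_completion ec; exact: PT.
move=> xi zeta xB zB.
have xc := canonical_map_completion xB; have zc := canonical_map_completion zB.
set Delta := completion_dist _ _ _.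
have Delta0 : 0 <= Delta by exact: P0.
split.
(* [Delta] may be 0, so the logarithm is taken of Delta + e. This half bounds an infimum from below
   and treats all representatives; the other half needs only one pair. *)
- apply/lee_addgt0Pr => e e0; have De : 0 < Delta + e by rewrite ltr_wpDl.
  have H : ((- ln ((Delta + e) / k0))%:E <= boundary_product b xi zeta)%E.
    apply: le_ereal_inf_tmp => _ [x [y [xix zetay ->]]].
    have [N HN] : exists N, forall n, (N <= n)%N -> - ln ((Delta + e) / k0) <= gp (x n) (y n).
      apply: near_points_product => //; first exact: punctured_height xB xix.
      have := completion_dist_cvg DM xc zc (canonical_map_mem xB xix) (canonical_map_mem zB zetay).
      move=> /cvg_seqP/(_ e e0)[N HN]; exists N => n /HN.
      by rewrite ltr_norml -/Delta => /andP[_ ?]; lra.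
    by apply: (@limn_einf_ge _ _ _ N) => n /HN; rewrite lee_fin.
  have {}H : (theta1 b xi zeta <= ((Delta + e) / k0)%:E)%E.
    rewrite /theta1; apply: (@le_trans _ _ (expeR (- (- ln ((Delta + e) / k0))%:E)%E)).
      by rewrite lee_expeR leeN2.
    by rewrite -EFinN opprK /= lnK// posrE divr_gt0.
  apply: (@le_trans _ _ (visual_constant^-1%:E * ((Delta + e) / k0)%:E)%E).
    by apply: lee_wpmul2l => //; rewrite lee_fin invr_ge0 ltW.
  rewrite -EFinM -EFinD lee_fin /visual_constant invf_div mulrAC.
  rewrite (_ : k0 * _ / 48 = (Delta + e) / 48); last by field; rewrite gt_eqF.
  by rewrite ler_pdivrMr//; lra.
- have [Delta_le0|Delta_gt0] := leP Delta 0.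
    apply: (@le_trans _ _ 0%E); first by rewrite lee_fin.
    by rewrite mule_ge0 ?expeR_ge0// lee_fin ltW.
  have H : (boundary_product b xi zeta <= (ln (48 / Delta))%:E)%E.
    have [x xix] := punctured_inhabited xB; have [y zetay] := punctured_inhabited zB.
    apply: (@le_trans _ _ (limn_einf (fun n => (gp (x n) (y n))%:E))).
      by apply: ereal_inf_lbound; exists x, y.
    have := completion_dist_cvg DM xc zc (canonical_map_mem xB xix) (canonical_map_mem zB zetay).
    move=> /cvg_seqP/(_ (Delta / 2) ltac:(lra))[N HN].
    apply: (@limn_einf_le _ _ _ N) => n /HN; rewrite ltr_norml -/Delta => /andP[Dl _].
    rewrite lee_fin -ler_expR lnK ?posrE ?divr_gt0// ler_pdivlMr//.
    have := dist1_le_product catX bP (x n) (y n).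
    have := expRxMexpNx_1 (gp (x n) (y n)); have := expR_gt0 (gp (x n) (y n)); nra.
  apply: (@le_trans _ _ (visual_constant%:E * (Delta / 48)%:E)%E).
    have k1 : k0 <= 1.
      rewrite /lower_constant ler_pdivrMr//.
      by have : expR (- 2) <= 1 :> R; [rewrite expR_le1|]; lra.
    rewrite -EFinM lee_fin /visual_constant.
    rewrite (_ : 48 / k0 * (Delta / 48) = Delta / k0); last by field; rewrite gt_eqF.
    by rewrite ler_pdivlMr// ler_piMr.
  apply: lee_wpmul2l; first by rewrite lee_fin ltW.
  apply: (@le_trans _ _ (expeR (- (ln (48 / Delta))%:E)%E)).
    by rewrite -EFinN /= expRN lnK ?posrE ?divr_gt0// invf_div.
  by rewrite lee_expeR leeN2.
Qed.

Lemma dist1_bounded : extended_busemann_functions b ->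
  bounded_distance D <-> distance_functions b.
Proof.
move=> eb; split=> [[C HC]|[z [s bE]]]; last first.
  exists (24 * expR (- s)) => u v; apply: le_trans (dist1_le_product catX bP u v) _.
  rewrite ler_pM2l// ler_expR lerN2.
  by have := gromov_product_at_ge0 z u v; rewrite /gromov_product_at /gromov_product bE; lra.
case: eb => // -[xi [gamma [s [ray bE _]]]]; exfalso.
(* Along the ray b is s - t, so d_{1,b} is at least k0 e^{t-s}; this [t] gives e^{t-s} >= 1 + t - s
   > C / k0. *)
pose t := `|C / k0| + `|s| + 1.
have t1 : 1 <= t by rewrite lerDr addr_ge0.
have t0 : 0 <= t by lra.
have := le_trans (dist1_ge catX bP (gamma 0) (gamma t)) (HC _ _).
rewrite geodesic_rayE// sub0r normrN ger0_norm// min_l// mulr1 leNgt => /negP; apply.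
rewrite mulrC -ltr_pdivrMr//; apply: (@lt_le_trans _ _ (expR (t - s))).
  have := expR_ge1Dx (t - s); have := ler_norm (C / k0); have := ler_norm s.
  by rewrite /t; lra.
rewrite ler_expR lerNr opprB; have := gromov_product_le bP (gamma t) (gamma 0).
by rewrite gromov_productC => /le_trans; apply; rewrite bE busemann_ray//; lra.
Qed.

End CanonicalMap.

Theorem theorem1p10 (R : realType) :
  (exists2 M : R, 1 <= M &
    forall (X : metricType R) (b : X -> R),
      complete_space X -> CAT_minus1 X -> extended_busemann_functions b ->
      GH_density M (rho1 b)) /\
  (forall K : R, 0 <= K -> exists A L : R, [/\ 1 <= A, 1 <= L &
    forall (X : metricType R) (b : X -> R) (omega : basepoint X),
      complete_space X -> CAT_minus1 X ->
      extended_busemann_functions b -> has_basepoint b omega ->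
      roughly_starlike K omega ->
      [/\ (forall (I : set R) (gamma : R -> X),
             geodesic (@mdist R X) I gamma ->
             uniform_curve (dist1 b) A I gamma),
          uniform_space (dist1 b) A,
          (bounded_distance (dist1 b) <-> distance_functions b),
          ((forall xi x, punctured_boundary omega xi -> xi x ->
              converges_in_completion b x (canonical_map b xi)) /\
           set_bij (punctured_boundary omega) (metric_boundary (dist1 b))
             (canonical_map b)) &
          visual_metric b omega L
            (fun xi zeta => completion_dist (dist1 b)
               (canonical_map b xi) (canonical_map b zeta))]]).
Proof.
have k0_gt0 : 0 < @lower_constant R := @lower_constant_gt0 R.
have k1 : @lower_constant R <= 1.
  rewrite /lower_constant ler_pdivrMr//.
  by have : expR (- 2) <= 1 :> R; [rewrite expR_le1|]; lra.
have M1 : 1 <= 24 / @lower_constant R by rewrite ler_pdivlMr// mul1r; lra.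
split.
  exists (24 / @lower_constant R) => // X b cX catX /extended_busemann_basepoint[omega hb].
  exact: dist1_GH_density (has_basepoint_approximable hb).
move=> K K0; exists (@uniform_constant R), (@visual_constant R); split.
- by apply: le_trans M1 _; exact: uniform_constant_ge.
- by rewrite /visual_constant ler_pdivlMr// mul1r; lra.
move=> X b omega cX catX eb hb star; have bP := has_basepoint_approximable hb.
have [xi xiB] := starlike_punctured_nonempty hb star.
split.
- by move=> I gamma; exact: geodesic_uniform.
- apply: dist1_uniform_space => //; exists (canonical_map b xi).
  exact: canonical_map_boundary xiB.
- exact: dist1_bounded hb eb.
- split; last exact: canonical_map_bij.
  by move=> zeta x zB zx; exact: (canonical_map_converges catX hb zB zx).
- exact: canonical_map_visual.
Qed.
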